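(* Let $F$ be the distribution function of a $k$-dimensional simple max-stable random vector $Z$, with exponent function $V$, exponent measure $\Lambda$ and angular measure $H$. The following statements are equivalent: (i) $F$ admits a density $f$, i.e. there is a measurable $f:(0,\infty)^k\to[0,\infty)$ with $F(z)=\int_{(0,z)}f(y)\,\mathrm{d}y$ for all $z\in(0,\infty)^k$; (ii) the exponent measure $\Lambda$ admits a density $\lambda_I$ on each face $E^k_I$, i.e. $\Lambda(A)=\sum_{\emptyset\neq I\subset\{1,\ldots,k\}}\int_A\lambda_I(z)\,\mu_I(\mathrm{d}z)$ for all Borel sets $A\subset E^k$; (iii) the angular measure $H$ admits a density $h_I$ on each face $S^{k-1}_I$, i.e. $H(B)=\sum_{\emptyset\neq I\subset\{1,\ldots,k\}}\int_B h_I(w)\,\sigma_I(\mathrm{d}w)$ for all Borel sets $B\subset S^{k-1}$. In this case, the density $f$ is given, for $z\in(0,\infty)^k$, by $$f(z)=\sum_{\tau\in\mathscr{P}_k}\exp\{-V(z)\}\prod_{j=1}^{|\tau|}\{-\partial_{\tau_j}V(z)\},$$ where $$V(z)=\sum_{\emptyset\neq I\subset\{1,\ldots,k\}}\int_{E^k\setminus[0,z]}\lambda_I(u)\,\mu_I(\mathrm{d}u),\qquad -\partial_{\tau_j}V(z)=\sum_{\tau_j\subset I\subset\{1,\ldots,k\}}\int_{[0,z_{\tau_j^c})}\lambda_I(z_{\tau_j},u_j)\,\mathrm{d}u_{j,I}\,\delta_0(\mathrm{d}u_{j,I^c}).$$ Furthermore, the densities $\lambda_I$ and $h_I$ are related by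 $$\lambda_I(z)=k\,\|z\|_1^{-|I|-1}\,h_I(z/\|z\|_1),\qquad z\in E^k_I.$$
   Context: Let $k\ge 1$ and $E^k=[0,\infty)^k\setminus\{0\}$. A random vector $Z=(Z_1,\dots,Z_k)$ is called simple max-stable if $\mathbb{P}(Z_i\le z)=\exp(-1/z)$ for $z>0$ and every $i$ (standard Fréchet margins) and, for every $n\ge1$, the componentwise maximum of $n$ independent copies of $Z$ has the same distribution as $nZ$. Its exponent function is $V(z)=-\log F(z)$, $z\in(0,\infty)^k$, where $F$ is the distribution function of $Z$. Its exponent measure $\Lambda$ is the measure on $E^k$ with $\Lambda(E^k\setminus[0,z])=V(z)$; it satisfies $\Lambda(uA)=u^{-1}\Lambda(A)$ for $u>0$ and Borel $A$, and $\Lambda(\{z\in E^k: z_i>1\})=1$ for all $i$. Its angular measure $H$ is the probability measure on $S^{k-1}=\{w\in[0,1]^k: w_1+\cdots+w_k=1\}$ with $\Lambda(\{z\in E^k:\|z\|_1>r,\ z/\|z\|_1\in B\})=k r^{-1}H(B)$ for all $r>0$ and Borel $B\subset S^{k-1}$. For $I\subset\{1,\dots,k\}$, $I^c$ is the complement of $I$ in $\{1,\dots,k\}$ and $z_I$ is the subvector of $z$ with components in $I$. For nonempty $I$, the faces are $E^k_I=\{z\in E^k: z_i>0 \text{ for } i\in I,\ z_i=0\text{ for } i\notin I\}$ and $S^{k-1}_I=\{w\in S^{k-1}: w_i>0\text{ for } i\in I,\ w_i=0\text{ for } i\notin I\}$. The measure $\mu_I(\mathrm{d}z)=\mathrm{d}z_I\,\delta_0(\mathrm{d}z_{I^c})$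 is Lebesgue measure on $E^k_I$. The measure $\sigma_I$ is Lebesgue measure on the $(|I|-1)$-dimensional face $S^{k-1}_I$, concretely $(|I|-1)$-dimensional Lebesgue measure in the coordinates obtained by dropping one coordinate of $w_I$; for $|I|=1$ it is the Dirac mass at the vertex. $\mathscr{P}_k$ is the set of all partitions $\tau=\{\tau_1,\ldots,\tau_{|\tau|}\}$ of $\{1,\ldots,k\}$ into nonempty blocks. For nonempty $\tau_j$, $\partial_{\tau_j}V$ denotes the partial derivative of $V$ with respect to the variables $z_i$, $i\in\tau_j$, once each. In the integral formula for $-\partial_{\tau_j}V(z)$, the integration variable is $u_j\in[0,\infty)^{|\tau_j^c|}$, with components indexed by $\tau_j^c$, ranging over $0\le u_{j}<z_{\tau_j^c}$ componentwise; the components with index in $I\cap\tau_j^c$ are integrated with respect to Lebesgue measure and those with index in $I^c$ are set to $0$; $(z_{\tau_j},u_j)$ is the vector in $[0,\infty)^k$ assembled from $z_{\tau_j}$ and $u_j$.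
   Formalization: The formulas for the density f, for the partial derivatives of V, and for the relation between λ_I and h_I are understood almost everywhere (for arbitrary versions of the densities), since pointwise they can fail and the mixed derivatives of V need not exist at every z. *)

(* Defs.v *)
From HB Require Import structures.
From mathcomp Require Import all_boot all_order all_algebra.
From mathcomp Require Import all_classical all_reals all_analysis measurable_realfun.
Set Implicit Arguments.
Unset Strict Implicit.
Unset Printing Implicit Defensive.
Import Order.TTheory GRing.Theory Num.Theory.
Import numFieldNormedType.Exports.
Local Open Scope classical_set_scope.
Local Open Scope ring_scope.

(* [pushforward] bundled over a measurable map, so that it is canonically a
   measure without a side condition. *)
Section image_measure.
Context d d' (T : measurableType d) (T' : measurableType d') (R : realType).
Context (m : {measure set T -> \bar R}) (f : {mfun T >-> T'}).

Definition image_measure : set T' -> \bar R := pushforward m f.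

Let image_measure0 : image_measure set0 = 0%E.
Proof. exact: measure0. Qed.

Let image_measure_ge0 A : (0 <= image_measure A)%E.
Proof. exact: measure_ge0. Qed.

Let image_measure_sigma_additive : semi_sigma_additive image_measure.
Proof. exact: measure_semi_sigma_additive. Qed.

HB.instance Definition _ := isMeasure.Build _ _ _ image_measure
  image_measure0 image_measure_ge0 image_measure_sigma_additive.

End image_measure.

Lemma image_prod_sigma_finite d1 d2 d3 (T1 : measurableType d1)
    (T2 : measurableType d2) (T3 : measurableType d3) (R : realType)
    (m1 : {sigma_finite_measure set T1 -> \bar R})
    (m2 : {sigma_finite_measure set T2 -> \bar R})
    (f : {mfun (T1 * T2)%type >-> T3}) (g : T3 -> T1 * T2) :
  measurable_fun setT g -> cancel f g ->
  sigma_finite setT (image_measure (m1 \x m2)%E f).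
Proof.
move=> mg fK; have /sigma_finiteP[F [FT ndF Foo]] := sigma_finiteT m1.
have /sigma_finiteP[G [GT ndG Goo]] := sigma_finiteT m2.
exists (fun i => g @^-1` (F i `*` G i)).
  rewrite -preimage_bigcup; apply/esym/seteqP; split => // z _ /=.
  have [i _ Fi] : (\bigcup_i F i) (g z).1 by rewrite -FT.
  have [j _ Gj] : (\bigcup_i G i) (g z).2 by rewrite -GT.
  exists (maxn i j) => //; split.
    by move: Fi; exact/subsetPset/ndF/leq_maxl.
  by move: Gj; exact/subsetPset/ndG/leq_maxr.
move=> i; have [mF Fi] := Foo i; have [mG Gi] := Goo i; split.
  by rewrite -[X in measurable X]setTI; apply: mg => //; exact: measurableX.
rewrite /image_measure /pushforward -comp_preimage.
rewrite (_ : g \o f = id); last by apply/funext => x /=; exact: fK.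
rewrite preimage_id [ltLHS]product_measure1E//.
by rewrite lte_mul_pinfty// ge0_fin_numE.
Qed.

Section tuple_cons_measure.
Context d (T : measurableType d) (R : realType) (n : nat).

Definition tuple_cons (x : T * n.-tuple T) : n.+1.-tuple T :=
  [tuple of x.1 :: x.2].

Lemma measurable_tuple_cons : measurable_fun setT tuple_cons.
Proof. exact: measurable_cons measurable_fst measurable_snd. Qed.

HB.instance Definition _ :=
  @isMeasurableFun.Build _ _ _ _ tuple_cons measurable_tuple_cons.

Context (m1 : {sigma_finite_measure set T -> \bar R})
        (m2 : {sigma_finite_measure set (n.-tuple T) -> \bar R}).

Definition tuple_cons_measure : set (n.+1.-tuple T) -> \bar R :=
  image_measure (m1 \x m2)%E tuple_cons.

HB.instance Definition _ := Measure.on tuple_cons_measure.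

Lemma tuple_cons_measure_sigma_finite : sigma_finite setT tuple_cons_measure.
Proof.
pose g (t : n.+1.-tuple T) := (thead t, [tuple of behead t]).
apply: (@image_prod_sigma_finite _ _ _ _ _ _ _ _ _ _ g).
  by apply: measurable_fun_pair; [exact: measurable_tnth|exact: measurable_behead].
by move=> [a t]; congr (_, _); apply/val_inj.
Qed.

HB.instance Definition _ := @Measure_isSigmaFinite.Build _ _ _
  tuple_cons_measure tuple_cons_measure_sigma_finite.

End tuple_cons_measure.

(* The product measure m 0 \x ... \x m (n - 1) on n.-tuple T, characterized by
   [tuple_measure_box]. *)
Fixpoint tuple_measure d (T : measurableType d) (R : realType) (n : nat) :
    ('I_n -> {sigma_finite_measure set T -> \bar R}) ->
    {sigma_finite_measure set (n.-tuple T) -> \bar R} :=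
  if n is n'.+1 return
    ('I_n -> {sigma_finite_measure set T -> \bar R}) ->
    {sigma_finite_measure set (n.-tuple T) -> \bar R}
  then fun m =>
    tuple_cons_measure (m ord0) (tuple_measure (fun i => m (lift ord0 i)))
  else fun=> \d_ [tuple].

Lemma tuple_measure_box d (T : measurableType d) (R : realType) (n : nat)
    (m : 'I_n -> {sigma_finite_measure set T -> \bar R}) (A : 'I_n -> set T) :
  (forall i, measurable (A i)) ->
  tuple_measure m [set t | forall i, A i (tnth t i)]
  = (\prod_(i < n) m i (A i))%E.
Proof.
elim: n => [|n IH] in m A * => mA.
  by rewrite big_ord0 /= diracE mem_set// => -[].
rewrite big_ord_recl /= -IH//.
rewrite /tuple_cons_measure /image_measure /pushforward.
rewrite -product_measure1E//=; last first.
  rewrite (_ : mkset _ =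
    \bigcap_(i in [set: 'I_n]) ((@tnth _ T ^~ i) @^-1` A (lift ord0 i))).
    apply: fin_bigcap_measurable => // i _; rewrite -[X in measurable X]setTI.
    exact: measurable_tnth.
  by apply/seteqP; split => [t At i _|t At i]; exact: At.
congr (_ _); apply/seteqP; split => -[a t] /=.
  move=> At; split => [|i]; first exact: (At ord0).
  by have := At (lift ord0 i); rewrite tnthS.
move=> [Aa At] i; by case: (unliftP ord0 i) => [j ->|->//]; rewrite tnthS; exact: At.
Qed.

Notation rvec R k := (k.-tuple (measurableTypeR R)).

Section vectors.
Context (R : realType) (k : nat).
Implicit Types (z u : rvec R k) (I S : {set 'I_k}).

Definition entry z (i : 'I_k) : R := tnth z i.

Definition upd z (i : 'I_k) (t : R) : rvec R k :=
  [tuple if j == i then t else entry z j | j < k].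

Definition scalep (a : R) z : rvec R k := [tuple a * entry z i | i < k].

(* (z_S, u_{S^c}) *)
Definition assemble S z u : rvec R k :=
  [tuple if i \in S then entry z i else entry u i | i < k].

Definition norm1 z : R := \sum_(i < k) `|entry z i|.

Definition orthant : set (rvec R k) := [set z | forall i, 0 < entry z i].

Definition Espace : set (rvec R k) :=
  [set z | (forall i, 0 <= entry z i) /\ exists i, entry z i != 0].

Definition Eface I : set (rvec R k) :=
  [set z | forall i, if i \in I then 0 < entry z i else entry z i == 0].

Definition simplex : set (rvec R k) :=
  [set w | (forall i, 0 <= entry w i <= 1) /\ \sum_(i < k) entry w i = 1].

Definition simplex_face I : set (rvec R k) := simplex `&` Eface I.

Definition obox z : set (rvec R k) :=
  [set y | forall i, 0 < entry y i < entry z i].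

Definition cbox z : set (rvec R k) :=
  [set y | forall i, 0 <= entry y i <= entry z i].

End vectors.

Section reference_measures.
Context (R : realType) (k : nat).

Definition lebesgue_vec :
    {sigma_finite_measure set (rvec R k) -> \bar R} :=
  tuple_measure (fun=> @lebesgue_measure R).

(* dz_I delta_0(dz_{I^c}) on the whole of R^k; mu_I is its restriction to
   Eface I, which is imposed through the domains of integration below. *)
Definition face_measure (I : {set 'I_k}) :
    {sigma_finite_measure set (rvec R k) -> \bar R} :=
  tuple_measure (fun i : 'I_k =>
    if i \in I then
      @lebesgue_measure R : {sigma_finite_measure set (measurableTypeR R) -> \bar R}
    else \d_ ((0 : R) : measurableTypeR R)).

Definition fill_coord (i : 'I_k) (u : rvec R k) : rvec R k :=
  upd u i (1 - \sum_(j < k | j != i) entry u j).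

Lemma measurable_fill_coord i : measurable_fun setT (fill_coord i).
Proof.
have mc j : measurable_fun setT (fun u : rvec R k => entry u j).
  exact: measurable_tnth.
apply/measurable_fun_tnthP => j.
suff : measurable_fun setT (fun u : rvec R k => entry (fill_coord i u) j) by [].
have -> : (fun u : rvec R k => entry (fill_coord i u) j) = if j == i
    then fun u => 1 - \sum_(l < k | l != i) entry u l else fun u => entry u j.
  by apply/funext => u; rewrite /entry tnth_mktuple; case: ifP.
case: ifP => // _; apply: measurable_funB => //.
under eq_fun do rewrite big_mkcond.
by apply: measurable_sum => l; case: (l != i).
Qed.

HB.instance Definition _ i :=
  @isMeasurableFun.Build _ _ _ _ (fill_coord i) (measurable_fill_coord i).

(* Lebesgue measure on the face of the simplex indexed by I: Lebesgue measure
   in the coordinates of I other than some chosen i in I, the i-th coordinate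
   being recovered as one minus the sum of the others. For I = [set i] this is
   the Dirac mass at the i-th vertex. It lives on the hyperplane spanned by the
   face, and is restricted to the face by the domains of integration. It does
   not depend on i, as the change of coordinates has Jacobian 1 or -1. *)
Definition simplex_measure (I : {set 'I_k}) :
    {measure set (rvec R k) -> \bar R} :=
  if [pick i in I] is Some i
  then image_measure (face_measure (I :\ i)%SET) (fill_coord i) else mzero.

End reference_measures.

Section max_stable.
Context (R : realType) (k : nat).

Definition same_law d1 (T1 : measurableType d1) (P1 : probability T1 R)
    (X1 : T1 -> rvec R k) d2 (T2 : measurableType d2) (P2 : probability T2 R)
    (X2 : T2 -> rvec R k) :=
  forall A, measurable A -> P1 (X1 @^-1` A) = P2 (X2 @^-1` A).

(* The sets A i may be the whole space, so subfamilies are covered. *)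
Definition independent_vecs d (T : measurableType d) (P : probability T R)
    (n : nat) (X : 'I_n -> T -> rvec R k) :=
  forall A : 'I_n -> set (rvec R k), (forall i, measurable (A i)) ->
    P [set x | forall i, A i (X i x)] = (\prod_(i < n) P (X i @^-1` A i))%E.

Definition cmax (T : Type) (n : nat) (X : 'I_n.+1 -> T -> rvec R k) (x : T) :
    rvec R k :=
  [tuple \big[Order.max/entry (X ord0 x) i]_(j < n.+1) entry (X j x) i | i < k].

Definition simple_max_stable d (T : measurableType d) (P : probability T R)
    (Z : {RV P >-> rvec R k}) :=
  (forall i z, 0 < z -> P [set x | entry (Z x) i <= z] = (expR (- z^-1))%:E) /\
  (forall (n : nat) d' (T' : measurableType d') (P' : probability T' R)
     (X : 'I_n.+1 -> {RV P' >-> rvec R k}),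
     independent_vecs P' (fun i => X i : T' -> rvec R k) ->
     (forall i, same_law P' (X i) P Z) ->
     same_law P' (cmax (fun i => X i : T' -> rvec R k))
              P (fun x => scalep n.+1%:R (Z x))).

Definition joint_cdf d (T : measurableType d) (P : probability T R)
    (Z : {RV P >-> rvec R k}) (z : rvec R k) : \bar R :=
  P [set x | forall i, entry (Z x) i <= entry z i].

Definition exponent_function d (T : measurableType d) (P : probability T R)
    (Z : {RV P >-> rvec R k}) (z : rvec R k) : R :=
  - ln (fine (joint_cdf Z z)).

(* A measure on Espace is represented as a measure on R^k carried by Espace. *)
Definition exponent_measure (V : rvec R k -> R)
    (L : {measure set (rvec R k) -> \bar R}) :=
  L (~` @Espace R k) = 0%E /\
  forall z, orthant z -> L (@Espace R k `\` cbox z) = (V z)%:E.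

Definition angular_measure (L : {measure set (rvec R k) -> \bar R})
    (H : probability (rvec R k) R) :=
  H (@simplex R k) = 1%E /\
  forall r (B : set (rvec R k)), 0 < r -> measurable B -> B `<=` @simplex R k ->
    L [set z | [/\ Espace z, r < norm1 z & B (scalep (norm1 z)^-1 z)]]
    = ((k%:R * r^-1)%:E * H B)%E.

End max_stable.

Section densities.
Context (R : realType) (k : nat).
Implicit Types (lam h : {set 'I_k} -> rvec R k -> R).

Definition cdf_density (F : rvec R k -> \bar R) (f : rvec R k -> R) :=
  [/\ measurable_fun (@orthant R k) f,
      forall y, orthant y -> 0 <= f y &
      forall z, orthant z ->
        F z = (\int[lebesgue_vec R k]_(y in obox z) (f y)%:E)%E].

Definition exponent_density (L : {measure set (rvec R k) -> \bar R}) lam :=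
  [/\ forall I : {set 'I_k}, I != finset.set0 -> measurable_fun (Eface I) (lam I),
      forall I : {set 'I_k}, I != finset.set0 ->
        forall z, Eface I z -> 0 <= lam I z &
      forall A, measurable A -> A `<=` @Espace R k ->
        L A = (\sum_(I : {set 'I_k} | I != finset.set0)
          \int[face_measure R I]_(z in A `&` Eface I) (lam I z)%:E)%E].

Definition angular_density (H : probability (rvec R k) R) h :=
  [/\ forall I : {set 'I_k}, I != finset.set0 ->
        measurable_fun (simplex_face I) (h I),
      forall I : {set 'I_k}, I != finset.set0 ->
        forall w : rvec R k, simplex_face I w -> 0 <= h I w &
      forall B, measurable B -> B `<=` @simplex R k ->
        H B = (\sum_(I : {set 'I_k} | I != finset.set0)
          \int[simplex_measure R I]_(w in B `&` simplex_face I) (h I w)%:E)%E].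

(* The sum over I containing S of the integrals of lam_I(z_S, u) over
   0 <= u < z_{S^c} against du_I delta_0(du_{I^c}). The variable u ranges over
   all of R^k: its coordinates in S carry a Dirac mass and are not used. The
   domain excludes the null set of u at which (z_S, u) is outside Eface I,
   where lam_I is not defined. *)
Definition partial_integral lam (S : {set 'I_k}) (z : rvec R k) : \bar R :=
  (\sum_(I : {set 'I_k} | S \subset I)
    \int[face_measure R (I :\: S)%SET]_(u in
        [set u | (forall i, i \notin S -> (0 <= entry u i < entry z i)%R) /\
                 Eface I (assemble S z u)])
      (lam I (assemble S z u))%:E)%E.

(* Iterated partial derivative along s, one variable at a time, the last element
   of s first. It is meaningful when [has_partials] holds, since [derive1] is
   total. *)
Fixpoint partials (s : seq 'I_k) (V : rvec R k -> R) (z : rvec R k) : R :=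
  if s is i :: s' then derive1 (fun t => partials s' V (upd z i t)) (entry z i)
  else V z.

Fixpoint has_partials (s : seq 'I_k) (V : rvec R k -> R) (z : rvec R k) :
    Prop :=
  if s is i :: s' then
    (\forall t \near entry z i, has_partials s' V (upd z i t)) /\
    derivable (fun t => partials s' V (upd z i t)) (entry z i) 1
  else True.

(* d_S V; the order of differentiation is that of [enum S]. *)
Definition dpartial (S : {set 'I_k}) := partials (enum S).

End densities.

(* Main.v *)
Require Import Defs.
From HB Require Import structures.
From mathcomp Require Import all_boot all_order all_algebra.
From mathcomp Require Import all_classical all_reals all_analysis measurable_realfun.
From mathcomp Require Import lra ring.
Set Implicit Arguments.
Unset Strict Implicit.
Unset Printing Implicit Defensive.
Import Order.TTheory GRing.Theory Num.Theory.
Import numFieldNormedType.Exports.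
Local Open Scope classical_set_scope.
Local Open Scope ring_scope.

(** Why the theorem is true.

    Densities on faces. The families [lam] indexed by faces are awkward to
    differentiate, so they are joined into one function, [glue lam], which is a
    density with respect to the product measure [refmeas]: each of its factors
    is Lebesgue measure plus a unit mass at 0, and on the face of I the product
    restricts to Lebesgue measure of that face ([refmeas_Eface]). Having
    densities on all faces is then absolute continuity with respect to
    [refmeas].

    Exponent and angular measure. In polar coordinates on a face
    ([ge0_integral_polar]) a point is its norm times a point of the simplex. The
    radial part of the exponent measure is dr / r^2, so a density of one of the
    two measures is turned into a density of the other by inserting, or by
    integrating out, a power of the norm ([exponent_density_of_angular],
    [angular_density_of_exponent]). The relation between lam and h is the
    uniqueness of densities.

    Distribution function and exponent measure. Z is the componentwise maximum
    of a Poisson process with intensity L. Above a level e > 0 only finitely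
    many points matter, and there the law of Z is that of the maximum of a
    Poisson number of independent points, with law proportional to L beyond e
    ([law_clamp]). Maxima of independent points preserve absolute continuity
    with respect to [refmeas] ([maxconv_null]); this gives the density of F from
    that of L. Conversely, a set A of a face that is null there generates a null
    cylinder; Z avoids it by the density of F, hence so does the single point
    that makes up the process with positive probability, and L A = 0
    ([exponent_face_null]). The Radon-Nikodym theorem produces the densities.

    The formula for f. Both F and -V have increments that are integrals of a
    density over boxes. The difficulty is that a mixed partial derivative needs
    lower-order derivatives in a neighbourhood, where almost everywhere
    statements say nothing. But the candidate derivative, the integral [pint] of
    the density over the coordinates that are not differentiated, is monotone
    and continuous in those coordinates. So Lebesgue differentiation, applied at
    rational values of the free coordinates, gives the derivative at all their
    values, for almost every value of the others. At almost every z
    all iterated partial derivatives thus exist on the cylinders through z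
    ([regular_ae]), in any order, and are given by [pint]. Differentiating
    F = exp(-V) along all the coordinates is then the formula of Faa di Bruno
    ([partials_expR]), while for F itself the same iterated derivative is f. *)

Lemma exists_lt_invS (R : realType) (e : R) : 0 < e -> exists n : nat, n.+1%:R^-1 < e.
Proof.
move=> e0; exists (Num.bound e^-1); rewrite invf_plt ?posrE//.
apply: (lt_trans (archi_boundP _)); last by rewrite ltr_nat.
by rewrite invr_ge0 ltW.
Qed.

(** * Product measures on tuples *)

Section tuple_boxes.
Context d (T : measurableType d) (R : realType) (n : nat).
Implicit Types (A B : 'I_n -> set T) (X : set (n.-tuple T)).

Definition tbox A : set (n.-tuple T) := [set t | forall i, A i (tnth t i)].

Lemma measurable_tbox A : (forall i, measurable (A i)) -> measurable (tbox A).
Proof.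
move=> mA; rewrite (_ : tbox A =
    \bigcap_(i in [set: 'I_n]) ((@tnth _ T ^~ i) @^-1` A i)).
  apply: fin_bigcap_measurable => // i _; rewrite -[X in measurable X]setTI.
  exact: measurable_tnth.
by apply/seteqP; split => [t At i _|t At i]; exact: At.
Qed.

Lemma tboxI A B : tbox A `&` tbox B = tbox (fun i => A i `&` B i).
Proof.
apply/seteqP; split => [t [tA tB] i|t tAB]; first by split; [exact: tA|exact: tB].
by split=> i; have [] := tAB i.
Qed.

Lemma measurable_tupleE : (@measurable _ (n.-tuple T)) =
  <<s [set X | exists2 A, (forall i, measurable (A i)) & X = tbox A] >>.
Proof.
apply/seteqP; split => X; last first.
  apply: smallest_sub; first exact: sigma_algebra_measurable.
  by move=> Y [A mA ->]; exact: measurable_tbox.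
apply: smallest_sub; first exact: smallest_sigma_algebra.
move=> Y HY.
suff [i [C mC <-]] : exists i, preimage_set_system setT (fun x => tnth x i)
    (@measurable _ T) Y.
  apply: sub_sigma_algebra; exists (fun j => if j == i then C else setT).
    by move=> j; case: ifP.
  rewrite setTI; apply/seteqP; split => [t Ct j|t /(_ i)].
    by case: eqP => // ->.
  by rewrite eqxx.
move: HY; elim/big_ind : _ => [//|A B hA hB [/hA|/hB]//|i _ h]; by exists i.
Qed.

Lemma tuple_measure_tbox (m : 'I_n -> {sigma_finite_measure set T -> \bar R}) A :
  (forall i, measurable (A i)) ->
  tuple_measure m (tbox A) = (\prod_(i < n) m i (A i))%E.
Proof. exact: tuple_measure_box. Qed.

(** Boxes form a pi-system that generates the product sigma-algebra. *)
Lemma measure_eq_tbox (m1 m2 : {measure set (n.-tuple T) -> \bar R})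
    (B : nat -> 'I_n -> set T) :
  (forall j i, measurable (B j i)) -> (forall j, m1 (tbox (B j)) < +oo)%E ->
  \bigcup_j tbox (B j) = setT ->
  (forall A, (forall i, measurable (A i)) -> m1 (tbox A) = m2 (tbox A)) ->
  forall X, measurable X -> m1 X = m2 X.
Proof.
move=> mB Boo BT m12 X mX.
apply: (measure_unique _ (fun j => tbox (B j)) measurable_tupleE) => //.
- move=> _ _ [A mA ->] [A' mA' ->]; rewrite tboxI; eexists; last by [].
  by move=> i; exact: measurableI.
- by move=> j; exists (B j).
- by move=> _ [A mA ->]; exact: m12.
Qed.

(** One nondecreasing sequence per coordinate, so that two points of the space
    always lie in a common box of the sequence. *)
Lemma tuple_measure_exhaust (m : 'I_n -> {sigma_finite_measure set T -> \bar R}) :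
  exists B : nat -> 'I_n -> set T,
    [/\ forall j i, measurable (B j i), forall j i, (m i (B j i) < +oo)%E,
        forall j, (tuple_measure m (tbox (B j)) < +oo)%E,
        \bigcup_j tbox (B j) = setT &
        forall i, nondecreasing_seq (fun j => B j i)].
Proof.
have H i : exists F : (set T)^nat, [/\ setT = \bigcup_j F j, nondecreasing_seq F &
    forall j, measurable (F j) /\ (m i (F j) < +oo)%E].
  by have /sigma_finiteP := sigma_finiteT (m i).
have /choice[F hF] := H.
have nd i : nondecreasing_seq (F i) by case: (hF i).
exists (fun j i => F i j); split=> //.
- by move=> j i; have [_ _ /(_ j)[]] := hF i.
- by move=> j i; have [_ _ /(_ j)[]] := hF i.
- move=> j; rewrite tuple_measure_box => [|i]; last by have [_ _ /(_ j)[]] := hF i.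
  rewrite ltey_eq prode_fin_num// => i _.
  by rewrite ge0_fin_numE//; have [_ _ /(_ j)[]] := hF i.
- apply/seteqP; split=> // t _.
  have /choice[g hg] : forall i, exists j, F i j (tnth t i).
    move=> i; have [+ _ _] := hF i.
    by move=> /seteqP[/(_ (tnth t i) I) [j _ ?] _]; exists j.
  exists (\max_i g i)%N => // i; move: (hg i).
  by apply/subsetPset/nd; exact: leq_bigmax.
Qed.

(** Inside a face this lets Lebesgue measure, the unit mass at 0 and their sum
    be exchanged factor by factor. *)
Lemma tuple_measure_restrict
    (m m' : 'I_n -> {sigma_finite_measure set T -> \bar R}) (E : 'I_n -> set T) :
  (forall i, measurable (E i)) ->
  (forall i (A : set T), measurable A -> A `<=` E i -> m i A = m' i A) ->
  forall X, measurable X -> X `<=` tbox E -> tuple_measure m X = tuple_measure m' X.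
Proof.
move=> mE mm' X mX XE.
have mEE := measurable_tbox mE.
have [B [mB _ Boo BT _]] := tuple_measure_exhaust m.
have := @measure_eq_tbox (mrestr (tuple_measure m) mEE)
  (mrestr (tuple_measure m') mEE) B mB.
rewrite /mrestr /= => /(_ _ BT) => H.
rewrite -(setIidl XE); apply: H => //.
  move=> j; apply: le_lt_trans (Boo j); apply: le_measure; rewrite ?inE//.
  - by apply: measurableI => //; exact: measurable_tbox.
  - exact: measurable_tbox.
move=> A mA; rewrite /mrestr !tboxI !tuple_measure_box.
- by apply: eq_bigr => i _; apply: mm' => //; exact: measurableI.
- by move=> i; exact: measurableI.
- by move=> i; exact: measurableI.
Qed.

End tuple_boxes.

(** Recognizing a measure on boxes is enough, because product measures are
    sigma-finite on boxes. *)
Lemma tuple_measure_pushforward d (T : measurableType d) (R : realType) (n : nat)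
    (m : 'I_n -> {sigma_finite_measure set T -> \bar R})
    d1 (T1 : measurableType d1) (mu : {measure set T1 -> \bar R})
    (f : T1 -> n.-tuple T) :
  measurable_fun setT f ->
  (forall A : 'I_n -> set T, (forall i, measurable (A i)) ->
    mu (f @^-1` tbox A) = (\prod_(i < n) m i (A i))%E) ->
  forall X, measurable X -> tuple_measure m X = mu (f @^-1` X).
Proof.
move=> mf H X mX.
pose f' : {mfun T1 >-> n.-tuple T} := HB.pack f (isMeasurableFun.Build _ _ _ _ f mf).
have [B [mB _ Boo BT _]] := tuple_measure_exhaust m.
have := @measure_eq_tbox _ _ _ _ (tuple_measure m) (image_measure mu f') B mB Boo BT.
apply => // A mA.
by rewrite [LHS]tuple_measure_tbox// -H.
Qed.

(** * Measurability of the operations on vectors *)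

Section vector_maps.
Context (R : realType) (k : nat).
Implicit Types (z u : rvec R k) (I S : {set 'I_k}).

Lemma entry_upd z i t j : entry (upd z i t) j = if j == i then t else entry z j.
Proof. by rewrite /entry tnth_mktuple. Qed.

Lemma entry_assemble S z u i :
  entry (assemble S z u) i = if i \in S then entry z i else entry u i.
Proof. by rewrite /entry tnth_mktuple. Qed.

Lemma entry_scalep a z i : entry (scalep a z) i = a * entry z i.
Proof. by rewrite /entry tnth_mktuple. Qed.

Lemma rvecP z u : (forall i, entry z i = entry u i) -> z = u.
Proof. by move=> h; apply: eq_from_tnth => i; exact: h. Qed.

Lemma measurable_entry i : measurable_fun setT (fun z : rvec R k => entry z i).
Proof. exact: measurable_tnth. Qed.

Lemma measurable_rvecP d (T : measurableType d) (f : T -> rvec R k) :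
  (forall i, measurable_fun setT (fun x => entry (f x) i)) -> measurable_fun setT f.
Proof. by move=> h; apply/measurable_fun_tnthP => i; exact: h. Qed.

Lemma measurable_entry_comp d (T : measurableType d) (f : T -> rvec R k) i :
  measurable_fun setT f -> measurable_fun setT (fun x => entry (f x) i).
Proof. by move=> mf; exact: (measurableT_comp (measurable_entry i)). Qed.

Lemma measurable_upd d (T : measurableType d) (f : T -> rvec R k) i (g : T -> R) :
  measurable_fun setT f -> measurable_fun setT g ->
  measurable_fun setT (fun x => upd (f x) i (g x)).
Proof.
move=> mf mg; apply: measurable_rvecP => j.
under eq_fun do rewrite entry_upd.
by case: (j == i) => //; exact: measurable_entry_comp.
Qed.

Lemma measurable_assemble d (T : measurableType d) S (f g : T -> rvec R k) :
  measurable_fun setT f -> measurable_fun setT g ->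
  measurable_fun setT (fun x => assemble S (f x) (g x)).
Proof.
move=> mf mg; apply: measurable_rvecP => j.
under eq_fun do rewrite entry_assemble.
by case: (j \in S) => //; exact: measurable_entry_comp.
Qed.

Lemma measurable_scalep d (T : measurableType d) (g : T -> R) (f : T -> rvec R k) :
  measurable_fun setT g -> measurable_fun setT f ->
  measurable_fun setT (fun x => scalep (g x) (f x)).
Proof.
move=> mg mf; apply: measurable_rvecP => j.
under eq_fun do rewrite entry_scalep.
by apply: measurable_funM => //; exact: measurable_entry_comp.
Qed.

Lemma measurable_norm1 : measurable_fun setT (@norm1 R k).
Proof.
apply: measurable_sum => i; apply: measurableT_comp; first exact: normr_measurable.
exact: measurable_entry.
Qed.

Lemma measurable_preimage d (T : measurableType d) d' (T' : measurableType d')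
    (f : T -> T') X : measurable_fun setT f -> measurable X ->
  measurable (f @^-1` X).
Proof. by move=> mf mX; rewrite -[X in measurable X]setTI; exact: mf. Qed.

Lemma measurable_box (A : 'I_k -> set (measurableTypeR R)) :
  (forall i, measurable (A i)) ->
  measurable [set z : rvec R k | forall i, A i (entry z i)].
Proof. by move=> mA; exact: measurable_tbox. Qed.

Lemma measurable_orthant : measurable (@orthant R k).
Proof.
rewrite (_ : @orthant R k = tbox (fun _ => `]0, +oo[%classic : set (measurableTypeR R))).
  exact: measurable_tbox.
by apply/seteqP; split => z h i; move: (h i); rewrite /= in_itv/= andbT.
Qed.

Lemma EspaceE : @Espace R k =
  [set z | forall i, 0 <= entry z i] `\` [set z | forall i, entry z i = 0].
Proof.
apply/seteqP; split => z [z0 h]; split => //.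
  by case: h => i /eqP zi /(_ i).
apply: contrapT => h'; apply: h => i; apply: contrapT => /eqP zi; apply: h'.
by exists i.
Qed.

Lemma measurable_Espace : measurable (@Espace R k).
Proof.
rewrite EspaceE; apply: measurableD.
- rewrite (_ : mkset _ = tbox (fun _ => `[0, +oo[%classic : set (measurableTypeR R))).
    exact: measurable_tbox.
  by apply/seteqP; split => z h i; move: (h i); rewrite /= in_itv/= andbT.
- by apply: (@measurable_box (fun=> [set 0])) => i; exact: measurable_set1.
Qed.

Definition Efactor I i : set (measurableTypeR R) :=
  if i \in I then `]0, +oo[%classic else [set 0].

Lemma measurable_Efactor I i : measurable (Efactor I i).
Proof. by rewrite /Efactor; case: ifP. Qed.

Lemma EfaceE I : @Eface R k I = tbox (Efactor I).
Proof.
apply/seteqP; split => z h i; move: (h i); rewrite /Efactor;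
  by case: ifP => _ /=; rewrite ?in_itv/= ?andbT// => /eqP.
Qed.

Lemma measurable_Eface I : measurable (@Eface R k I).
Proof. by rewrite EfaceE; apply: measurable_tbox => i; exact: measurable_Efactor. Qed.

Lemma measurable_cbox z : measurable (@cbox R k z).
Proof.
rewrite (_ : cbox z =
    tbox (fun i => `[0, entry z i]%classic : set (measurableTypeR R))).
  exact: measurable_tbox.
by apply/seteqP; split => u h i; move: (h i); rewrite /= in_itv/=.
Qed.

Lemma measurable_obox z : measurable (@obox R k z).
Proof.
rewrite (_ : obox z =
    tbox (fun i => `]0, entry z i[%classic : set (measurableTypeR R))).
  exact: measurable_tbox.
by apply/seteqP; split => u h i; move: (h i); rewrite /= in_itv/=.
Qed.

End vector_maps.

(** * Integrating one coordinate of a product separately *)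

Section disintegration.
Context (R : realType) (k : nat).
Local Notation RM := (measurableTypeR R).
Implicit Types m : 'I_k -> {sigma_finite_measure set RM -> \bar R}.

(** Fubini without leaving R^k: rather than being removed from the product,
    the separated coordinate receives an arbitrary probability measure, which
    the integrand then overwrites. *)
Lemma tuple_measure_disint m m' i :
  (forall j, j != i -> m' j = m j) -> m' i setT = 1%E ->
  forall X, measurable X ->
  tuple_measure m X =
  (tuple_measure m' \x m i)%E ((fun p : rvec R k * RM => upd p.1 i p.2) @^-1` X).
Proof.
move=> mm' m'1 X mX.
apply: (@tuple_measure_pushforward _ _ _ _ _ _ _ (tuple_measure m' \x m i)%E) => //.
  by apply: measurable_upd; [exact: measurable_fst|exact: measurable_snd].
move=> A mA.
rewrite (_ : _ @^-1` _ = tbox (fun j => if j == i then setT else A j) `*` A i).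
  have mA' j : measurable (if j == i then setT else A j) by case: ifP.
  rewrite [LHS]product_measure1E//; last exact: measurable_tbox.
  transitivity ((\prod_j m' j (if j == i then setT else A j)) * m i (A i))%E.
    by congr (_ * _)%E; exact: tuple_measure_tbox.
  rewrite (bigD1 i)//= eqxx m'1 mul1e.
  rewrite [RHS](bigD1 i)//= muleC; congr (_ * _)%E.
  by apply: eq_bigr => j ji; rewrite (negbTE ji) mm'.
apply/seteqP; split => [[u t] /= h|[u t] /= [hu ht] j].
  split=> [j|]; last by have := h i; rewrite -/(entry _ i) entry_upd eqxx.
  by have := h j; rewrite -/(entry _ j) entry_upd; case: eqP.
rewrite -/(entry _ j) entry_upd; case: eqP => [->//|ji].
by have := hu j; case: eqP.
Qed.

Lemma ge0_integral_disint m m' i (g : rvec R k -> \bar R) :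
  (forall j, j != i -> m' j = m j) -> m' i setT = 1%E ->
  measurable_fun setT g -> (forall z, 0 <= g z)%E ->
  (\int[tuple_measure m]_z g z =
   \int[tuple_measure m']_u \int[m i]_t g (upd u i t))%E.
Proof.
move=> mm' m'1 mg g0.
pose f (p : rvec R k * RM) := upd p.1 i p.2.
have mf : measurable_fun setT f.
  by apply: measurable_upd; [exact: measurable_fst|exact: measurable_snd].
transitivity (\int[pushforward (tuple_measure m' \x m i)%E f]_z g z)%E.
  by apply: eq_measure_integral => X mX _; exact: (tuple_measure_disint mm' m'1).
rewrite ge0_integral_pushforward//= fubini_tonelli1//=.
exact: measurableT_comp.
Qed.

Lemma ge0_integral_disintr m m' i (g : rvec R k -> \bar R) :
  (forall j, j != i -> m' j = m j) -> m' i setT = 1%E ->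
  measurable_fun setT g -> (forall z, 0 <= g z)%E ->
  (\int[tuple_measure m]_z g z =
   \int[m i]_t \int[tuple_measure m']_u g (upd u i t))%E.
Proof.
move=> mm' m'1 mg g0.
pose f (p : rvec R k * RM) := upd p.1 i p.2.
have mf : measurable_fun setT f.
  by apply: measurable_upd; [exact: measurable_fst|exact: measurable_snd].
transitivity (\int[pushforward (tuple_measure m' \x m i)%E f]_z g z)%E.
  by apply: eq_measure_integral => X mX _; exact: (tuple_measure_disint mm' m'1).
rewrite ge0_integral_pushforward//= fubini_tonelli2//=.
exact: measurableT_comp.
Qed.

End disintegration.

(** * The reference measure of the orthant and its faces *)

Section lebesgue_affine.
Context (R : realType).
Local Notation mu := (@lebesgue_measure R).

Lemma lebesgue_measure_shift (c : R) (A : set (measurableTypeR R)) :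
  measurable A -> mu A = mu ((fun x => x + c) @^-1` A).
Proof.
move=> mA.
have mf : measurable_fun setT (fun x : measurableTypeR R => x + c : measurableTypeR R).
  exact: measurable_funD.
pose f : {mfun measurableTypeR R >-> measurableTypeR R} :=
  HB.pack (fun x : measurableTypeR R => x + c) (isMeasurableFun.Build _ _ _ _ _ mf).
apply: (@lebesgue_measure_unique _ (image_measure mu f)) => // _ [[a b] _ <-].
rewrite /image_measure /pushforward /=.
rewrite (_ : _ @^-1` _ = `]a - c, b - c]%classic); last first.
  by apply/seteqP; split => x /=; rewrite !in_itv/= lerBrDr ltrBlDr.
rewrite !lebesgue_measure_itv/= !lte_fin ltrD2r -!EFinB.
by congr (if _ then _%:E else _); ring.
Qed.

Lemma lebesgue_measure_scale (r : R) (A : set (measurableTypeR R)) :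
  0 < r -> measurable A -> mu A = (r%:E * mu ((fun x => (r * x)%R) @^-1` A))%E.
Proof.
move=> r0 mA.
have mf : measurable_fun setT (fun x : measurableTypeR R => r * x : measurableTypeR R).
  exact: measurable_funM.
pose f : {mfun measurableTypeR R >-> measurableTypeR R} :=
  HB.pack (fun x : measurableTypeR R => r * x) (isMeasurableFun.Build _ _ _ _ _ mf).
have := @lebesgue_measure_unique _ (mscale (NngNum (ltW r0)) (image_measure mu f)).
apply => // _ [[a b] _ <-].
transitivity (r%:E * mu ((fun x => (r * x)%R) @^-1` `]a, b]))%E; last by [].
rewrite (_ : _ @^-1` _ = `]a / r, b / r]%classic); last first.
  by apply/seteqP; split => x /=; rewrite !in_itv/= ler_pdivlMr// ltr_pdivrMr// (mulrC r).
rewrite !lebesgue_measure_itv/= !lte_fin ltr_pM2r ?invr_gt0//.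
case: ifP => _; last by rewrite mule0.
by rewrite -!EFinB -EFinM -mulrBl mulrCA divff ?gt_eqF// mulr1.
Qed.

(** Its k-th power restricts on every face of the orthant to Lebesgue measure
    of that face, so that densities on the faces are one density with respect
    to a product measure. *)
Definition atom_lebesgue : set (measurableTypeR R) -> \bar R :=
  measure_add (\d_ (0 : measurableTypeR R)) mu.

HB.instance Definition _ := Measure.on atom_lebesgue.

Lemma atom_lebesgueE A : atom_lebesgue A = (\d_ (0%R : measurableTypeR R) A + mu A)%E.
Proof. exact: measure_addE. Qed.

Lemma atom_lebesgue_sigma_finite : sigma_finite setT atom_lebesgue.
Proof.
have [F FT Foo] := sigma_finiteT mu; exists F => // i; have [mF Fi] := Foo i.
split=> //; rewrite atom_lebesgueE lte_add_pinfty//.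
by rewrite diracE; case: (_ \in _); rewrite ltry.
Qed.

HB.instance Definition _ := @Measure_isSigmaFinite.Build _ _ _
  atom_lebesgue atom_lebesgue_sigma_finite.

End lebesgue_affine.

Section reference.
Context (R : realType) (k : nat).
Local Notation RM := (measurableTypeR R).
Implicit Types (z u : rvec R k) (I S : {set 'I_k}).

Definition refmeas : {sigma_finite_measure set (rvec R k) -> \bar R} :=
  tuple_measure (fun=> @atom_lebesgue R).

Lemma lebesgue_set1N (A : set RM) : measurable A ->
  A `<=` `]0, +oo[ -> atom_lebesgue A = @lebesgue_measure R A.
Proof.
move=> mA A0; rewrite atom_lebesgueE diracE memNset ?add0e// => /A0 /=.
by rewrite in_itv/= ltxx.
Qed.

Lemma atom_lebesgue_set1 (A : set RM) : A `<=` [set 0] ->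
  atom_lebesgue A = \d_ (0 : RM) A.
Proof.
move=> A0; rewrite atom_lebesgueE.
have -> : @lebesgue_measure R A = 0%E; last by rewrite adde0.
have [->|->] := subset_set1 A0; first by rewrite measure0.
exact: lebesgue_measure_set1.
Qed.

Lemma refmeas_Eface I X : measurable X -> X `<=` @Eface R k I ->
  face_measure R I X = refmeas X.
Proof.
move=> mX; rewrite EfaceE => XI.
apply: (@tuple_measure_restrict _ RM _ _
  (fun i => if i \in I then
      @lebesgue_measure R : {sigma_finite_measure set RM -> \bar R}
    else \d_ ((0 : R) : RM)) (fun=> @atom_lebesgue R) (@Efactor R k I)) => //.
  by move=> i; exact: measurable_Efactor.
move=> i A mA; rewrite /Efactor; case: ifP => _ AI.
  by rewrite [RHS]lebesgue_set1N.
by rewrite [RHS]atom_lebesgue_set1.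
Qed.

Lemma refmeas_orthant X : measurable X -> X `<=` @orthant R k ->
  lebesgue_vec R k X = refmeas X.
Proof.
move=> mX XI.
apply: (@tuple_measure_restrict _ RM _ _ (fun=> @lebesgue_measure R)
  (fun=> @atom_lebesgue R) (fun _ => `]0, +oo[%classic : set RM)) => //.
  by move=> i A mA AI; rewrite [RHS]lebesgue_set1N.
by move=> z /XI h i; rewrite /= in_itv/= andbT; exact: h.
Qed.

Lemma face_measure_scale I (r : R) X : 0 < r -> measurable X ->
  (face_measure R I X = (r ^+ #|I|)%:E * face_measure R I ((scalep r : rvec R k -> _) @^-1` X))%E.
Proof.
move=> r0 mX.
have rI : 0 <= r ^+ #|I| by rewrite exprn_ge0// ltW.
have := @tuple_measure_pushforward _ _ _ _ _ _ _
  (mscale (NngNum rI) (face_measure R I)) (scalep r : rvec R k -> rvec R k).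
apply => //; first exact: measurable_scalep.
move=> A mA; rewrite /mscale/=.
have mrA i : measurable ((fun x : RM => r * x : RM) @^-1` A i).
  by apply: measurable_preimage => //; exact: measurable_funM.
rewrite (_ : _ @^-1` _ = tbox (fun i => (fun x : RM => r * x : RM) @^-1` A i)); last first.
  by apply/seteqP; split => u h i; have := h i; rewrite /= tnth_mktuple.
transitivity ((r ^+ #|I|)%:E * \prod_(i < k) (if i \in I then
      @lebesgue_measure R : {sigma_finite_measure set RM -> \bar R}
    else \d_ ((0%R : R) : RM)) ((fun x : RM => (r * x)%R : RM) @^-1` A i))%E.
  by congr (_ * _)%E; exact: tuple_measure_tbox.
have -> : ((r ^+ #|I|)%:E = \prod_(i < k) (if i \in I then r%:E else 1))%E.
  rewrite -big_mkcond/= big_const iter_mule.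
  by rewrite mule1 EFin_expe.
rewrite -big_split/=; apply: eq_bigr => i _; case: ifP => _.
  by rewrite -lebesgue_measure_scale.
rewrite mul1e.
change (\d_ (0 : RM) ((fun x : RM => r * x : RM) @^-1` A i) = \d_ (0 : RM) (A i) :> \bar R).
rewrite !diracE; congr (_%:R%:E); congr nat_of_bool.
by apply/idP/idP; rewrite !inE/= mulr0.
Qed.

End reference.

Section null_assemble.
Context (R : realType) (k : nat).
Local Notation RM := (measurableTypeR R).
Context (m : 'I_k -> {sigma_finite_measure set RM -> \bar R}).
Local Notation M := (tuple_measure m).

(** A vector assembled from two independent copies has their common law. This
    holds for probability measures; the truncation to boxes of finite measure
    makes it true up to a constant factor. *)
Lemma tuple_measure_assemble_null S N : measurable N -> M N = 0%E ->
  (M \x M)%E ((fun p : rvec R k * rvec R k => assemble S p.1 p.2) @^-1` N) = 0%E.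
Proof.
move=> mN N0.
have [B [mB Boo MBoo BT Bnd]] := tuple_measure_exhaust m.
have mtB j : measurable (tbox (B j)) by exact: measurable_tbox.
pose f (p : rvec R k * rvec R k) := assemble S p.1 p.2.
have mf : measurable_fun setT f.
  by apply: measurable_assemble; [exact: measurable_fst|exact: measurable_snd].
pose D j : set (rvec R k * rvec R k) := tbox (B j) `*` tbox (B j).
have mD j : measurable (D j) by exact: measurableX.
suff Z j : (M \x M)%E (f @^-1` N `&` D j) = 0%E.
  have : (M \x M)%E.-negligible (\bigcup_j (f @^-1` N `&` D j)).
    apply: negligible_bigcup => j; apply/negligibleP; last exact: Z.
    by apply: measurableI => //; exact: measurable_preimage.
  rewrite (_ : \bigcup_j _ = f @^-1` N); last first.
    apply/seteqP; split=> [p [j _ []//]|[x y] h].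
    have [a _ xa] : (\bigcup_j tbox (B j)) x by rewrite BT.
    have [b _ yb] : (\bigcup_j tbox (B j)) y by rewrite BT.
    exists (maxn a b) => //; split=> //; split => i.
      by move: (xa i); apply/subsetPset/Bnd/leq_maxl.
    by move: (yb i); apply/subsetPset/Bnd/leq_maxr.
  by move/negligibleP; apply; exact: measurable_preimage.
pose f' : {mfun (rvec R k * rvec R k)%type >-> rvec R k} :=
  HB.pack f (isMeasurableFun.Build _ _ _ _ _ mf).
have cE : exists c : {nonneg R}, (\prod_(i < k) m i (B j i) = c%:num%:E)%E.
  have c0 : (0 <= \prod_(i < k) m i (B j i))%E by apply: prode_ge0 => i _; exact: measure_ge0.
  have cf : (\prod_(i < k) m i (B j i) \is a fin_num)%E.
    by apply: prode_fin_num => i _; rewrite ge0_fin_numE.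
  by exists (NngNum (fine_ge0 c0)); rewrite /= fineK.
have [c cE'] := cE.
have fB : (M \x M)%E (D j) \is a fin_num.
  rewrite ge0_fin_numE// [ltLHS]product_measure1E//.
  by apply: lte_mul_pinfty; rewrite ?ge0_fin_numE//; exact: MBoo.
transitivity (mscale c (mrestr M (mtB j)) N); last first.
  transitivity (c%:num%:E * M (N `&` tbox (B j)))%E; first by [].
  rewrite (_ : M _ = 0%E) ?mule0//.
  apply/eqP; rewrite eq_le measure_ge0 andbT -[leRHS]N0.
  by apply: le_measure; rewrite ?inE//; exact: measurableI.
apply: (@measure_eq_tbox _ _ _ _ (image_measure (mrestr (M \x M)%E (mD j)) f')
  (mscale c (mrestr M (mtB j))) B mB _ BT) => //.
- move=> a; apply: (@le_lt_trans _ _ ((M \x M)%E (D j))); last by rewrite ltey_eq fB.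
  change ((M \x M)%E (f @^-1` tbox (B a) `&` D j) <= (M \x M)%E (D j))%E.
  apply: le_measure; last exact: subIsetr; rewrite inE; last exact: mD.
  by apply: measurableI; [exact: measurable_preimage|exact: mD].
- move=> A mA.
  transitivity (c%:num%:E * M (tbox A `&` tbox (B j)))%E; last by [].
  transitivity ((M \x M)%E (f @^-1` tbox A `&` D j)); first by [].
  have -> : (f @^-1` tbox A `&` D j) =
      tbox (fun i => if i \in S then A i `&` B j i else B j i) `*`
      tbox (fun i => if i \in S then B j i else A i `&` B j i).
    apply/seteqP; split => -[x y].
      move=> [xyA [xB yB]]; split => i; have := xyA i; move: (xB i) (yB i);
        by rewrite /f /= tnth_mktuple /entry; case: ifP.
    move=> [xA yA]; split.
      move=> i; move: (xA i) (yA i); rewrite /f /= tnth_mktuple /entry.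
      by case: ifP => _ hx hy; [case: hx|case: hy].
    by split => i; move: (xA i) (yA i); rewrite /=; case: ifP => _ hx hy //;
      [case: hx|case: hy].
  have mA1 i : measurable (if i \in S then A i `&` B j i else B j i).
    by case: ifP => // _; exact: measurableI.
  have mA2 i : measurable (if i \in S then B j i else A i `&` B j i).
    by case: ifP => // _; exact: measurableI.
  transitivity ((\prod_i m i (if i \in S then A i `&` B j i else B j i)) *
       (\prod_i m i (if i \in S then B j i else A i `&` B j i)))%E.
    rewrite [LHS]product_measure1E//; try exact: measurable_tbox.
    by congr (_ * _)%E; exact: tuple_measure_tbox.
  rewrite -cE' tboxI.
  transitivity ((\prod_(i < k) m i (B j i)) * \prod_(i < k) m i (A i `&` B j i))%E; last first.
    congr (_ * _)%E; apply/esym/tuple_measure_tbox => i; exact: measurableI.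
  rewrite -!big_split/=; apply: eq_bigr => i _; case: ifP => // _.
  by rewrite muleC.
Qed.

End null_assemble.

(** * The distribution function of a max-stable vector *)

Section lower_orthants.
Context (R : realType) (k : nat).
Local Notation RM := (measurableTypeR R).

Definition lbox (z : rvec R k) : set (rvec R k) :=
  [set x | forall i, entry x i <= entry z i].

Definition cvec (c : R) : rvec R k := [tuple c | i < k].

Lemma entry_cvec c i : entry (cvec c) i = c.
Proof. by rewrite /entry tnth_mktuple. Qed.

Lemma set1_cvec0E : [set cvec 0] = tbox (fun=> [set 0] : set RM).
Proof.
apply/seteqP; split => x; first by move=> -> i /=; rewrite -/(entry _ i) entry_cvec.
by move=> h; apply: rvecP => i; rewrite entry_cvec; exact: h.
Qed.

Lemma measurable_set1_cvec0 : measurable [set cvec 0].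
Proof.
by rewrite set1_cvec0E; apply: measurable_tbox => i; exact: measurable_set1.
Qed.

Lemma lboxE z : lbox z = tbox (fun i => `]-oo, entry z i]%classic : set RM).
Proof. by apply/seteqP; split => u h i; move: (h i); rewrite /= in_itv/=. Qed.

Lemma measurable_lbox z : measurable (lbox z).
Proof. by rewrite lboxE; exact: measurable_tbox. Qed.

Lemma lbox_exhaust (x : rvec R k) : exists j : nat, forall i, entry x i <= j%:R.
Proof.
have H i : exists j : nat, entry x i <= j%:R.
  exists (Num.bound `|entry x i|); apply: ltW.
  by apply: le_lt_trans (archi_boundP _); rewrite ?ler_norm.
have /choice[g hg] := H; exists (\max_i g i)%N => i.
by apply: le_trans (hg i) _; rewrite ler_nat; exact: leq_bigmax.
Qed.

Lemma measurable_lboxE : (@measurable _ (rvec R k)) = <<s range lbox >>.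
Proof.
apply/seteqP; split => X; last first.
  apply: smallest_sub; first exact: sigma_algebra_measurable.
  by move=> _ [z _ <-]; exact: measurable_lbox.
have sG : sigma_algebra setT <<s range lbox >> by exact: smallest_sigma_algebra.
have cC A : <<s range lbox >> A -> <<s range lbox >> (~` A).
  exact: sigma_algebraC.
have cU F : (forall i : nat, <<s range lbox >> (F i)) -> <<s range lbox >> (\bigcup_i F i).
  exact: sigma_algebra_bigcup.
apply: smallest_sub => // Y HY.
have [i [C mC <-]] : exists i, preimage_set_system setT (fun x : rvec R k => entry x i)
    (@measurable _ RM) Y.
  move: HY; elim/big_ind : _ => [//|A B hA hB [/hA|/hB]//|i _ h]; by exists i.
rewrite setTI.
pose HS := [set D : set R | <<s range lbox >> ((fun x : rvec R k => entry x i) @^-1` D)].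
suff : HS C by [].
have ray c : HS `]-oo, c]%classic.
  rewrite /HS/= (_ : _ @^-1` _ =
      \bigcup_j lbox (upd (cvec j%:R) i c)).
    by apply: cU => j; apply: sub_sigma_algebra; eexists.
  apply/seteqP; split => [x /=|x [j _ /(_ i)]].
    rewrite in_itv/= => xc; have [j hj] := lbox_exhaust x.
    by exists j => // l; rewrite entry_upd entry_cvec; case: eqP => [->|].
  by rewrite entry_upd eqxx /= in_itv.
have HS0 : HS set0 by rewrite /HS/= preimage_set0; exact: sigma_algebra0.
have HSC D : HS D -> HS (~` D) by move=> HD; rewrite /HS/= preimage_setC; exact: cC.
have HSU F : (forall i : nat, HS (F i)) -> HS (\bigcup_i F i).
  by move=> HF; rewrite /HS/= preimage_bigcup; exact: cU.
move: mC; apply: smallest_sub.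
  by split=> // D HD; rewrite setTD; exact: HSC.
move=> _ [[a b] _ <-].
have -> : [set` `](a, b).1, (a, b).2]] = ~` (~` `]-oo, b]%classic `|` `]-oo, a]%classic).
  apply/seteqP; split => x; rewrite /= !in_itv/=.
    by move=> /andP[ax xb] [//|]; rewrite leNgt ax.
  by move=> /not_orP[/contrapT -> /negP]; rewrite -ltNge => ->.
apply: (HSC); rewrite -bigcup2E; apply: (HSU) => -[|[|j]]; rewrite /bigcup2/=;
  [apply: (HSC); exact: ray|exact: ray|exact: HS0].
Qed.

Lemma measure_eq_lbox (m1 m2 : {measure set (rvec R k) -> \bar R}) :
  (m1 setT < +oo)%E -> (forall z, m1 (lbox z) = m2 (lbox z)) ->
  forall X, measurable X -> m1 X = m2 X.
Proof.
move=> m1oo m12 X mX.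
apply: (measure_unique _ (fun j : nat => lbox (cvec j%:R)) measurable_lboxE) => //.
- move=> _ _ [a _ <-] [b _ <-].
  exists ([tuple Order.min (entry a i) (entry b i) | i < k] : rvec R k) => //.
  apply/seteqP; split => x.
    move=> h; split => i; have := h i; rewrite /entry tnth_mktuple le_min;
    by move=> /andP[].
  by move=> [ha hb] i; rewrite /entry tnth_mktuple le_min; apply/andP; split;
    [exact: ha|exact: hb].
- apply/seteqP; split => // x _; have [j hj] := lbox_exhaust x.
  by exists j => // i; rewrite entry_cvec.
- by move=> _ [z _ <-]; exact: m12.
- move=> j; apply: le_lt_trans m1oo; apply: le_measure; rewrite ?inE//.
  exact: measurable_lbox.
Qed.

End lower_orthants.

Lemma measure_fin_cover d (T : measurableType d) (R : realType)
    (mu : {measure set T -> \bar R}) (I : finType) (F : I -> set T) (A : set T) :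
  measurable A -> (forall i, measurable (F i)) ->
  (forall x, A x -> exists i, F i x) -> (mu A <= \sum_i mu (F i))%E.
Proof.
move=> mA mF AF.
apply: (@le_trans _ _ (mu (\big[setU/set0]_i F i))).
  apply: le_measure; rewrite ?inE//; first exact: bigsetU_measurable.
  by move=> x /AF[i Fi]; rewrite (bigD1 i)//=; left.
elim: (index_enum I) => [|i s IH]; first by rewrite !big_nil measure0.
rewrite !big_cons; apply: le_trans (measureU2 _ _ _) _ => //.
  exact: bigsetU_measurable.
exact: leeD.
Qed.

Section cdf.
Context (R : realType) (k : nat) (d : measure_display) (T : measurableType d)
  (P : probability T R) (Z : {RV P >-> rvec R k}).
Local Notation RM := (measurableTypeR R).
Hypothesis Zms : simple_max_stable Z.

Let mZ : measurable_fun setT Z. Proof. exact: measurable_funP. Qed.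

Lemma measurable_RV_preimage (A : set (rvec R k)) : measurable A -> measurable (Z @^-1` A).
Proof. exact: measurable_preimage. Qed.

Lemma joint_cdfE z : joint_cdf Z z = P (Z @^-1` lbox z). Proof. by []. Qed.

(** Max-stability for two independent copies of Z, which exist as the
    coordinates of a product space. *)
Lemma joint_cdf_double z :
  (joint_cdf Z (scalep 2 z) * joint_cdf Z (scalep 2 z) = joint_cdf Z z)%E.
Proof.
pose M := tuple_measure (fun _ : 'I_2 => (P : {sigma_finite_measure set T -> \bar R})).
have M1 : M setT = 1%E.
  have -> : [set: 2.-tuple T] = tbox (fun=> setT) by apply/seteqP; split.
  rewrite [LHS]tuple_measure_tbox//.
  by rewrite big1// => i _; exact: probability_setT.
pose M' : probability (2.-tuple T) R := HB.pack (M : set _ -> _)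
  (Measure.on M) (Measure_isProbability.Build _ _ _ M M1).
have mX j : measurable_fun setT (fun t : 2.-tuple T => Z (tnth t j)).
  by apply: measurableT_comp; [exact: mZ|exact: measurable_tnth].
pose X j : {RV M' >-> rvec R k} := HB.pack (fun t : 2.-tuple T => Z (tnth t j))
  (isMeasurableFun.Build _ _ _ _ _ (mX j)).
have [_ /(_ 1%N _ _ M' X)] := Zms.
have boxE (A : 'I_2 -> set (rvec R k)) : (forall i, measurable (A i)) ->
    M [set x | forall i, A i (X i x)] = (\prod_(i < 2) P (Z @^-1` A i))%E.
  move=> mA; apply: (@tuple_measure_tbox _ _ _ _ (fun _ => P) (fun i => Z @^-1` A i)).
  by move=> i; exact: measurable_RV_preimage.
have lawX i A : measurable A -> M (X i @^-1` A) = P (Z @^-1` A).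
  move=> mA; have := boxE (fun j => if j == i then A else setT).
  rewrite (_ : mkset _ = X i @^-1` A); last first.
    apply/seteqP; split => [t /(_ i)|t ? j]; first by rewrite eqxx.
    by case: eqP => [->|].
  move=> ->; last by move=> j; case: ifP.
  rewrite (bigD1 i)//= eqxx big1 ?mule1// => j ji.
  by rewrite (negbTE ji) preimage_setT; exact: probability_setT.
move=> /(_ _ _ (lbox (scalep 2 z))).
rewrite (_ : cmax _ @^-1` _ = [set x | forall i, lbox (scalep 2 z) (X i x)]); last first.
  apply/seteqP; split => t.
    move=> h j i; have := h i; rewrite /cmax {1}/entry tnth_mktuple.
    by move=> /(bigmax_leP _ _ _ _)[_]; apply.
  move=> h i; rewrite /cmax {1}/entry tnth_mktuple.
  by apply/bigmax_leP; split => [|j _]; exact: h.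
rewrite (_ : _ @^-1` lbox _ = Z @^-1` lbox z); last first.
  apply/seteqP; split => t h i; have := h i; rewrite !entry_scalep ler_pM2l//.
move=> H; rewrite [RHS]joint_cdfE -H//.
- apply: etrans (esym (boxE (fun=> lbox (scalep 2 z)) (fun=> measurable_lbox _))).
  by rewrite big_ord_recl big_ord1.
- move=> A mA; apply: etrans (boxE A mA) _; apply: eq_bigr => i _.
  by apply/esym; exact: lawX.
- exact: measurable_lbox.
Qed.

Lemma joint_cdf_fin z : joint_cdf Z z \is a fin_num.
Proof.
rewrite joint_cdfE fin_num_measure//.
by apply: measurable_RV_preimage; exact: measurable_lbox.
Qed.

(** From 1 - exp(-x) <= x. *)
Lemma margin_gt i z : 0 < z -> (P [set x | (z < entry (Z x) i)%R] <= (z^-1)%:E)%E.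
Proof.
move=> z0; have [/(_ i z z0) + _] := Zms.
have mA : measurable [set x | entry (Z x) i <= z].
  rewrite (_ : mkset _ = (fun x => entry (Z x) i) @^-1` (`]-oo, z]%classic : set RM)).
    apply: measurable_preimage => //; exact: measurable_entry_comp.
  by apply/seteqP; split => x; rewrite /= in_itv.
have -> : [set x | z < entry (Z x) i] = ~` [set x | entry (Z x) i <= z].
  by apply/seteqP; split => x /=; rewrite ltNge => /negP.
rewrite probability_setC// => ->; rewrite -EFinB lee_fin lerBlDr.
by rewrite -lerBlDl; exact: expR_ge1Dx.
Qed.

(** If F vanished at z it would vanish at all 2^n z by [joint_cdf_double]; but
    far out each of the k margins exceeds its coordinate with probability less
    than 1/k. Without this lemma V could be the junk value of a logarithm at
    0. *)
Lemma joint_cdf_gt0 z : orthant z -> (0 < joint_cdf Z z)%E.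
Proof.
move=> z0; rewrite lt_neqAle measure_ge0 andbT; apply/negP => /eqP/esym F0.
have F0n n : joint_cdf Z (scalep (2 ^+ n) z) = 0%E.
  elim: n => [|n IH].
    by rewrite (_ : scalep _ z = z)//; apply: rvecP => i; rewrite entry_scalep expr0 mul1r.
  have := joint_cdf_double (scalep (2 ^+ n) z); rewrite IH.
  rewrite (_ : scalep 2 _ = scalep (2 ^+ n.+1) z); last first.
    by apply: rvecP => i; rewrite !entry_scalep exprS mulrA.
  by move/eqP; rewrite mule_eq0 orbb => /eqP.
(* beyond level k + 1 the k margins have total mass less than 1 *)
have [n hn] : exists n : nat, forall i, k.+1%:R <= 2 ^+ n * entry z i.
  have H i : exists n : nat, k.+1%:R <= n%:R * entry z i.
    exists (Num.bound (k.+1%:R / entry z i)).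
    rewrite -ler_pdivrMr//; apply: ltW; apply: archi_boundP.
    by rewrite divr_ge0// ltW.
  have /choice[g hg] := H; exists (\max_i g i)%N => i.
  apply: le_trans (hg i) _; rewrite ler_pM2r// -natrX ler_nat.
  apply: leq_trans (leq_bigmax i) _; exact: ltnW (ltn_expl _ _).
pose w := scalep (2 ^+ n) z.
have w0 i : k.+1%:R <= entry w i by rewrite entry_scalep.
have wp i : 0 < entry w i by apply: lt_le_trans (w0 i).
have mA i : measurable [set x | entry w i < entry (Z x) i].
  rewrite (_ : mkset _ = (fun x => entry (Z x) i) @^-1` (`]entry w i, +oo[%classic : set RM)).
    apply: measurable_preimage => //; exact: measurable_entry_comp.
  by apply/seteqP; split => x; rewrite /= in_itv/= andbT.
have : (1 <= \sum_(i < k) P [set x | (entry w i < entry (Z x) i)%R])%E.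
  have -> : (1 = P (~` (Z @^-1` lbox w)))%E.
    rewrite probability_setC; first by rewrite -joint_cdfE F0n sube0.
    by apply: measurable_RV_preimage; exact: measurable_lbox.
  apply: measure_fin_cover => //.
    by apply: measurableC; apply: measurable_RV_preimage; exact: measurable_lbox.
  by move=> x /= /existsNP[i /negP]; rewrite -ltNge => h; exists i.
apply/negP; rewrite -ltNge; apply: (@le_lt_trans _ _ (\sum_(i < k) (k.+1%:R^-1)%:E)%E).
  apply: lee_sum => i _; apply: le_trans (margin_gt i (wp i)) _.
  by rewrite lee_fin lef_pV2// ?posrE.
rewrite sumEFin lte_fin sumr_const card_ord -[_ *+ k]mulr_natl ltr_pdivrMr ?ltr0n// mul1r.
by rewrite ltr_nat.
Qed.

Lemma joint_cdf_expR z : orthant z ->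
  joint_cdf Z z = (expR (- exponent_function Z z))%:E.
Proof.
move=> z0; rewrite /exponent_function opprK lnK ?fineK ?joint_cdf_fin//.
by rewrite posrE fine_gt0// joint_cdf_gt0//= ltey_eq joint_cdf_fin.
Qed.

Lemma RV_orthant : P (~` (Z @^-1` @orthant R k)) = 0%E.
Proof.
suff H i : P [set x | entry (Z x) i <= 0] = 0%E.
  apply/eqP; rewrite eq_le measure_ge0 andbT.
  apply: (@le_trans _ _ (\sum_i P [set x | (entry (Z x) i <= 0)%R])%E).
    apply: measure_fin_cover => [|i|x /= /existsNP[i /negP]].
    - by apply: measurableC; apply: measurable_RV_preimage; exact: measurable_orthant.
    - rewrite (_ : mkset _ = (fun x => entry (Z x) i) @^-1`
          (`]-oo, 0]%classic : set RM)).
        apply: measurable_preimage => //; exact: measurable_entry_comp.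
      by apply/seteqP; split => x; rewrite /= in_itv.
    - by rewrite -leNgt => h; exists i.
  by rewrite big1.
apply/eqP; rewrite eq_le measure_ge0 andbT; apply/lee_addgt0Pr => e e0.
rewrite add0e; have [/(_ i) h _] := Zms.
(* exp(-1/z) <= z <= e / 2 *)
pose z := Num.min (e / 2) 1.
have z0 : 0 < z by rewrite lt_min divr_gt0/=.
have mA c : measurable [set x | entry (Z x) i <= c].
  rewrite (_ : mkset _ = (fun x => entry (Z x) i) @^-1` (`]-oo, c]%classic : set RM)).
    apply: measurable_preimage => //; exact: measurable_entry_comp.
  by apply/seteqP; split => x; rewrite /= in_itv.
apply: (@le_trans _ _ (P [set x | entry (Z x) i <= z])).
  apply: le_measure; rewrite ?inE// => x /= /le_trans; apply; exact: ltW.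
rewrite h// lee_fin expRN; apply: (@le_trans _ _ z); last first.
  by rewrite ge_min; apply/orP; left; lra.
rewrite invf_ple ?posrE ?expR_gt0//.
by apply: le_trans (expR_ge1Dx _); rewrite lerDr.
Qed.

End cdf.

(** * Maxima of independent vectors and absolute continuity *)

Section null_sections.
Context d (T : measurableType d) (R : realType).

Lemma ge0_integral_nullP (m : {measure set T -> \bar R}) (f : T -> \bar R) :
  measurable_fun setT f -> (forall x, 0 <= f x)%E ->
  (\int[m]_x f x = 0)%E <-> m [set x | f x != 0%E] = 0%E.
Proof.
move=> mf f0.
have mS : measurable [set x | f x != 0%E].
  by rewrite -[X in measurable X]setTI; exact: emeasurable_neq.
have -> : (\int[m]_x f x = \int[m]_x `|f x|)%E.
  by apply: eq_integral => x _; rewrite gee0_abs.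
split=> [/(ae_eq_integral_abs _ measurableT mf)[N [mN N0 hN]]|h].
  apply/eqP; rewrite eq_le measure_ge0 andbT -[leRHS]N0; apply: le_measure; rewrite ?inE//.
  by move=> x /= /eqP fx; apply: hN => /= /(_ I).
apply/(ae_eq_integral_abs _ measurableT mf).
exists [set x | f x != 0%E]; split=> // x /=.
by move=> h'; apply/eqP => fx; apply: h'.
Qed.

Context d' (T' : measurableType d').

(** Null sets of a product are recognized on sections, so absolute continuity
    can be transported to a product one factor at a time. *)
Lemma product_measure_nullP (m1 : {sigma_finite_measure set T -> \bar R})
    (m2 : {sigma_finite_measure set T' -> \bar R}) (X : set (T * T')) :
  measurable X ->
  (m1 \x m2)%E X = 0%E <-> m1 [set x | m2 (xsection X x) != 0%E] = 0%E.
Proof.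
move=> mX; apply: (@ge0_integral_nullP m1 (fun x => m2 (xsection X x))) => //.
exact: measurable_fun_xsection.
Qed.

End null_sections.

Section max_convolution.
Context (R : realType) (k : nat).
Local Notation RM := (measurableTypeR R).

Definition vmax (p : rvec R k * rvec R k) : rvec R k :=
  [tuple Order.max (entry p.1 i) (entry p.2 i) | i < k].

Lemma entry_vmax p i : entry (vmax p) i = Order.max (entry p.1 i) (entry p.2 i).
Proof. by rewrite /entry tnth_mktuple. Qed.

Lemma measurable_vmax : measurable_fun setT vmax.
Proof.
apply: measurable_rvecP => i; under eq_fun do rewrite entry_vmax.
by apply: measurable_maxr; apply: measurable_entry_comp;
  [exact: measurable_fst|exact: measurable_snd].
Qed.

HB.instance Definition _ := isMeasurableFun.Build _ _ _ _ vmax measurable_vmax.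

Lemma vmax_lbox z : vmax @^-1` lbox z = lbox z `*` lbox z.
Proof.
apply/seteqP; split => -[x y] /=.
  by move=> h; split => i; have := h i; rewrite entry_vmax ge_max => /andP[].
by move=> [hx hy] i; rewrite entry_vmax ge_max (hx i) (hy i).
Qed.

Section op.
Context (m1 m2 : {finite_measure set (rvec R k) -> \bar R}).

(** The law of the componentwise maximum of independent vectors, for measures
    that need not have mass 1. *)
Definition maxconv : set (rvec R k) -> \bar R := image_measure (m1 \x m2)%E vmax.

HB.instance Definition _ := Measure.on maxconv.

Lemma maxconv_fin : fin_num_fun maxconv.
Proof.
move=> A mA; rewrite ge0_fin_numE//.
apply: (@le_lt_trans _ _ (maxconv setT)); first by apply: le_measure; rewrite ?inE.
change ((m1 \x m2)%E (vmax @^-1` setT) < +oo)%E.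
rewrite preimage_setT -setXTT [ltLHS]product_measure1E//.
by rewrite lte_mul_pinfty// ?ge0_fin_numE// ltey_eq fin_num_measure.
Qed.

HB.instance Definition _ := Measure_isFinite.Build _ _ _ maxconv maxconv_fin.

Lemma maxconv_lbox z : maxconv (lbox z) = (m1 (lbox z) * m2 (lbox z))%E.
Proof.
change ((m1 \x m2)%E (vmax @^-1` lbox z) = m1 (lbox z) * m2 (lbox z))%E.
by rewrite vmax_lbox [LHS]product_measure1E//; exact: measurable_lbox.
Qed.

End op.

(** Starts from the mass at 0, which is neutral for maxima of nonnegative
    vectors. *)
Fixpoint maxconv_pow (m : {finite_measure set (rvec R k) -> \bar R}) (n : nat) :
    {finite_measure set (rvec R k) -> \bar R} :=
  if n is n'.+1 then maxconv (maxconv_pow m n') m else \d_ (cvec k (0 : R)).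

Lemma maxconv_pow_lbox m n z : orthant z ->
  maxconv_pow m n (lbox z) = (m (lbox z) ^+ n)%E.
Proof.
move=> z0; elim: n => [|n IH].
  change (\d_ (cvec k (0 : R)) (lbox z) = 1 :> \bar R)%E.
  by rewrite diracE mem_set// => i; rewrite entry_cvec ltW.
change (maxconv (maxconv_pow m n) m (lbox z) = m (lbox z) ^+ n.+1)%E.
by rewrite maxconv_lbox IH expeS muleC.
Qed.

(** The maximum of two vectors takes each coordinate from one of them, so it
    lies in N only if one of the finitely many ways of assembling the two
    vectors does; [tuple_measure_assemble_null] applies to each of them. *)
Lemma maxconv_null (m1 m2 : {finite_measure set (rvec R k) -> \bar R}) :
  (forall N, measurable N -> refmeas R k N = 0%E -> m1 N = 0%E) ->
  (forall N, measurable N -> refmeas R k N = 0%E -> m2 N = 0%E) ->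
  forall N, measurable N -> refmeas R k N = 0%E -> maxconv m1 m2 N = 0%E.
Proof.
move=> ac1 ac2 N mN N0.
pose X := vmax @^-1` N.
have mX : measurable X by apply: measurable_preimage => //; exact: measurable_vmax.
have X0 : (refmeas R k \x refmeas R k)%E X = 0%E.
  (* S is the set of coordinates where the first vector is the larger one *)
  pose F (S : {set 'I_k}) := (fun p : rvec R k * rvec R k => assemble S p.1 p.2) @^-1` N.
  have mF S : measurable (F S).
    apply: measurable_preimage => //.
    by apply: measurable_assemble; [exact: measurable_fst|exact: measurable_snd].
  apply/eqP; rewrite eq_le measure_ge0 andbT.
  apply: (@le_trans _ _ (\sum_S (refmeas R k \x refmeas R k)%E (F S))%E).
    apply: measure_fin_cover => // p Np.
    exists [set i | entry p.2 i <= entry p.1 i]%SET; rewrite /F/=.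
    rewrite (_ : assemble _ _ _ = vmax p)//; apply: rvecP => i.
    rewrite entry_assemble entry_vmax inE; case: leP => //.
  by rewrite big1// => S _; exact: tuple_measure_assemble_null.
change ((m1 \x m2)%E X = 0%E).
have mU (m : {sigma_finite_measure set (rvec R k) -> \bar R}) :
    measurable [set x | m (xsection X x) != 0%E].
  rewrite -[X in measurable X]setTI; apply: emeasurable_neq => //.
  exact: measurable_fun_xsection.
have /product_measure_nullP := X0 => /(_ mX) /ac1 => /(_ (mU _)) h.
apply/product_measure_nullP => //.
apply/eqP; rewrite eq_le measure_ge0 andbT -[leRHS]h; apply: le_measure; rewrite ?inE//.
move=> x /=; apply: contraNN => /eqP; move/ac2 => -> //.
exact: measurable_xsection.
Qed.

(** The empty maximum is the origin, which is not a null set of [refmeas]. *)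
Lemma maxconv_pow_null (m : {finite_measure set (rvec R k) -> \bar R}) n :
  (forall N, measurable N -> refmeas R k N = 0%E -> m N = 0%E) ->
  forall N, measurable N -> refmeas R k N = 0%E -> maxconv_pow m n N = 0%E.
Proof.
move=> ac; elim: n => [|n IH] N mN N0; last exact: (maxconv_null IH ac).
change (\d_ (cvec k (0 : R)) N = 0 :> \bar R)%E.
rewrite diracE; case: (boolP (_ \in N)) => // /[!inE] N0v.
suff : (1 <= refmeas R k N)%E by rewrite N0 lee_fin ler10.
apply: (@le_trans _ _ (refmeas R k (tbox (fun=> [set 0%R] : set RM)))).
  have -> : refmeas R k (tbox (fun=> [set 0%R] : set RM)) =
      (\prod_(i < k) @atom_lebesgue R [set 0%R])%E.
    by apply: tuple_measure_tbox => i; exact: measurable_set1.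
  rewrite big1// => i _; rewrite atom_lebesgueE lebesgue_measure_set1 adde0.
  by rewrite diracE mem_set.
apply: le_measure; rewrite ?inE//.
  by apply: measurable_tbox => i; exact: measurable_set1.
move=> x x0; rewrite (_ : x = cvec k (0 : R))//.
by apply: rvecP => i; rewrite entry_cvec; exact: x0.
Qed.

End max_convolution.

Section clamp.
Context (R : realType) (k : nat).
Local Notation RM := (measurableTypeR R).

(** Raising all coordinates to the level e hides the points of the Poisson
    process below that level. *)
Definition clamp (e : R) (x : rvec R k) : rvec R k := vmax (x, cvec k e).

Lemma entry_clamp e x i : entry (clamp e x) i = Order.max (entry x i) e.
Proof. by rewrite /clamp entry_vmax /= entry_cvec. Qed.

Lemma measurable_clamp e : measurable_fun setT (clamp e).
Proof.
apply: measurable_rvecP => i; under eq_fun do rewrite entry_clamp.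
by apply: measurable_maxr => //; exact: measurable_entry.
Qed.

HB.instance Definition _ e := isMeasurableFun.Build _ _ _ _ (clamp e) (measurable_clamp e).

Lemma clamp_lbox e z : clamp e @^-1` lbox z =
  if [forall i, e <= entry z i] then lbox z else set0.
Proof.
case: ifPn => [/forallP h|/forallPn[i /negP]].
  apply/seteqP; split => x hx i; have := hx i; rewrite entry_clamp ge_max.
    by case/andP.
  by rewrite (h i) andbT.
move=> h; apply/seteqP; split => // x /(_ i); rewrite entry_clamp ge_max => /andP[_ h'].
by apply: h; rewrite h'.
Qed.

End clamp.

(** * The Poisson representation above a positive level *)

Section compound_poisson.
Context (R : realType) (k : nat) (d : measure_display) (T : measurableType d)
  (P : probability T R) (Z : {RV P >-> rvec R k})
  (L : {measure set (rvec R k) -> \bar R}).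
Local Notation RM := (measurableTypeR R).
Local Notation V := (exponent_function Z).
Hypothesis Zms : simple_max_stable Z.
Hypothesis LV : exponent_measure V L.

Definition far (e : R) : set (rvec R k) := @Espace R k `\` cbox (cvec k e).

Lemma measurable_far e : measurable (far e).
Proof. by apply: measurableD; [exact: measurable_Espace|exact: measurable_cbox]. Qed.

Lemma measurable_Z : measurable_fun setT Z.
Proof. exact: measurable_funP. Qed.

HB.instance Definition _ := isMeasurableFun.Build _ _ _ _ (Z : T -> rvec R k) measurable_Z.

Section level.
Context (e : R) (e0 : 0 < e).

Let orthant_e : orthant (cvec k e).
Proof. by move=> i; rewrite entry_cvec. Qed.

Lemma exponent_far : L (far e) = (V (cvec k e))%:E.
Proof. by case: LV => _; apply. Qed.

Lemma exponent_far_lty : (L (far e) < +oo)%E.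
Proof. by rewrite exponent_far ltry. Qed.

Definition far_measure : {finite_measure set (rvec R k) -> \bar R} :=
  mfrestr (measurable_far e) exponent_far_lty.

Lemma far_measureE A : far_measure A = L (A `&` far e). Proof. by []. Qed.

Definition poisson_weight (n : nat) : {nonneg R} :=
  NngNum (divr_ge0 (expR_ge0 (- V (cvec k e))) (ler0n R n`!)).

(** The law of the componentwise maximum of a Poisson number of independent
    points with intensity [far_measure]: its weights exp(-v) / n! come without
    v^n, which is contained in the powers of the unnormalized measure. *)
Definition compound_max : {measure set (rvec R k) -> \bar R} :=
  mseries (fun n => mscale (poisson_weight n) (maxconv_pow far_measure n)) 0.

Lemma compound_maxE A : compound_max A =
  (\sum_(0 <= n <oo) ((poisson_weight n)%:num%:E * maxconv_pow far_measure n A))%E.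
Proof. by []. Qed.

Lemma far_measure_lbox z : (forall i, e <= entry z i) ->
  far_measure (lbox z) = (V (cvec k e) - V z)%:E.
Proof.
move=> ez; have z0 : orthant z by move=> i; exact: lt_le_trans (ez i).
have [_ LV'] := LV.
have : L (far e) = (far_measure (lbox z) + L (@Espace R k `\` cbox z))%E.
  rewrite far_measureE -measureU.
  - congr (L _); apply/seteqP; split => x.
      move=> [Ex nx]; case: (pselect (cbox z x)) => xz; last by right.
      by left; split => // i; case/andP: (xz i).
    move=> [[]//|[Ex nx]]; split => // h; apply: nx => i.
    by have := h i; rewrite entry_cvec => /andP[-> /= /le_trans]; apply.
  - by apply: measurableI; [exact: measurable_lbox|exact: measurable_far].
  - by apply: measurableD; [exact: measurable_Espace|exact: measurable_cbox].
  - apply/seteqP; split => // x [[xz _] [[x0 _]]]; apply => i.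
    by rewrite x0; exact: xz.
rewrite exponent_far LV'// => h.
have : far_measure (lbox z) \is a fin_num.
  by apply: fin_num_measure; exact: measurable_lbox.
by move: h; case: (far_measure (lbox z)) => //= r [->] _; rewrite addrK.
Qed.

(** The exponential series sums to exp(-V(e)) exp(V(e) - V(z)). *)
Lemma compound_max_lbox z : (forall i, e <= entry z i) ->
  compound_max (lbox z) = joint_cdf Z z.
Proof.
move=> ez; have z0 : orthant z by move=> i; exact: lt_le_trans (ez i).
rewrite joint_cdf_expR// compound_maxE.
set a := V (cvec k e) - V z.
have -> : (\sum_(0 <= n <oo) ((poisson_weight n)%:num%:E *
    maxconv_pow far_measure n (lbox z)) =
  \sum_(0 <= n <oo) (expR (- V (cvec k e)) * exp_coeff a n)%:E)%E.
  apply: eq_eseriesr => n _.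
  rewrite maxconv_pow_lbox// far_measure_lbox// -EFin_expe -EFinM /exp_coeff/=.
  by congr (_%:E); rewrite -/a; ring.
apply/cvg_lim => //.
under eq_fun do rewrite sumEFin -mulr_sumr.
apply: cvg_EFin; first by near=> n.
have -> : expR (- V z) = expR (- V (cvec k e)) * expR a.
  by rewrite -expRD; congr expR; rewrite /a; ring.
apply: cvgMr; exact: is_cvg_series_exp_coeff.
Unshelve. all: by end_near. Qed.

(** Points below e in every coordinate do not influence the part of the
    maximum that exceeds e; only finitely many others remain, hence the law of
    Z is compound Poisson as far as it is visible through [clamp e]. *)
Lemma law_clamp C : measurable C -> (forall x, C (clamp e x) <-> C x) ->
  P (Z @^-1` C) = compound_max C.
Proof.
move=> mC hC.
have -> : C = clamp e @^-1` C by apply/seteqP; split => x /hC.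
pose m1 := image_measure (image_measure P Z) (clamp e : {mfun rvec R k >-> rvec R k}).
pose m2 := image_measure compound_max (clamp e : {mfun rvec R k >-> rvec R k}).
apply: (@measure_eq_lbox _ _ m1 m2) => //.
  change (P (Z @^-1` (clamp e @^-1` setT)) < +oo)%E.
  by rewrite !preimage_setT probability_setT ltry.
move=> z; change (P (Z @^-1` (clamp e @^-1` lbox z)) = compound_max (clamp e @^-1` lbox z)).
rewrite clamp_lbox; case: ifPn => [/forallP h|_]; last by rewrite preimage_set0 !measure0.
by rewrite compound_max_lbox.
Qed.

(** With positive probability the process has exactly one point beyond e, and
    then this point is the maximum: the term n = 1 of the series bounds L from
    above. *)
Lemma exponent_null_of_law C : measurable C -> (forall x, C (clamp e x) <-> C x) ->
  P (Z @^-1` C) = 0%E -> L (C `&` far e) = 0%E.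
Proof.
move=> mC hC; rewrite law_clamp// compound_maxE => h.
have c0 : clamp e (cvec k (0 : R)) = cvec k e.
  by apply: rvecP => i; rewrite entry_clamp !entry_cvec max_r// ltW.
have pos n : (0 <= (poisson_weight n)%:num%:E * maxconv_pow far_measure n C)%E.
  by rewrite mule_ge0.
(* all terms of the series are nonnegative, so the term n = 1 vanishes with the sum *)
have : ((poisson_weight 1)%:num%:E * maxconv_pow far_measure 1 C <= 0)%E.
  rewrite -h; apply: le_trans (nneseries_lim_ge 2 _) => //.
  rewrite big_nat_recr//= leeDr//; apply: sume_ge0 => i _; exact: (pos i).
rewrite pmule_rle0; last by rewrite lte_fin divr_gt0// expR_gt0.
rewrite measure_le0 => /eqP h1; apply/eqP; rewrite -measure_le0 -h1.
change (far_measure C <= (\d_ (cvec k (0 : R)) \x far_measure)%E (@vmax R k @^-1` C))%E.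
apply: (@le_trans _ _ ((\d_ (cvec k (0 : R)) \x far_measure)%E
  ([set cvec k (0 : R)] `*` (C `&` far e)))).
  have m0 : measurable [set cvec k (0 : R)] by exact: measurable_set1_cvec0.
  have mCf : measurable (C `&` far e) by apply: measurableI => //; exact: measurable_far.
  rewrite [leRHS]product_measure1E//.
  apply: (@le_trans _ _ (1 * far_measure (C `&` far e))%E).
    by rewrite mul1e !far_measureE -setIA setIid.
  apply: lee_pmul => //.
  change (1 <= \d_ (cvec k (0%R : R)) [set cvec k (0%R : R)] :> \bar R)%E.
  by rewrite diracE mem_set.
apply: le_measure; rewrite ?inE.
- apply: measurableX; first exact: measurable_set1_cvec0.
  by apply: measurableI => //; exact: measurable_far.
- by apply: measurable_preimage => //; exact: measurable_vmax.
- move=> [x y] /= [-> [Cy [[y0 _] _]]]; rewrite (_ : vmax _ = y)//.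
  by apply: rvecP => i; rewrite entry_vmax /= entry_cvec max_r.
Qed.

(** Every term of the Poisson series is a maximum of points from L, so
    [maxconv_pow_null] makes all of them vanish. *)
Lemma law_null_of_exponent N :
  (forall A, measurable A -> refmeas R k A = 0%E -> L (A `&` @Espace R k) = 0%E) ->
  measurable N -> N `<=` [set x | forall i, e < entry x i] ->
  refmeas R k N = 0%E -> P (Z @^-1` N) = 0%E.
Proof.
move=> ac mN Ne N0; rewrite law_clamp//; last first.
  move=> x; split=> Nx.
    have := Ne _ Nx => /= h; rewrite (_ : x = clamp e x)//.
    apply: rvecP => i; have := h i; rewrite entry_clamp lt_max ltxx orbF => /ltW h'.
    by rewrite max_l.
  rewrite (_ : clamp e x = x)//.
  by apply: rvecP => i; rewrite entry_clamp max_l// ltW//; exact: Ne.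
rewrite compound_maxE eseries0// => n _ _.
rewrite maxconv_pow_null ?mule0// => A mA A0.
rewrite far_measureE; apply/eqP; rewrite eq_le measure_ge0 andbT -[leRHS](ac _ mA A0).
apply: le_measure; rewrite ?inE.
- by apply: measurableI => //; exact: measurable_far.
- by apply: measurableI => //; exact: measurable_Espace.
- by apply: setIS => x [].
Qed.

End level.
End compound_poisson.

(** * Polar coordinates *)

Lemma ge0_integral_image d d' (T : measurableType d) (T' : measurableType d')
    (R : realType) (m : {measure set T -> \bar R}) (phi : {mfun T >-> T'})
    (f : T' -> \bar R) :
  measurable_fun setT f -> (forall x, 0 <= f x)%E ->
  (\int[image_measure m phi]_x f x = \int[m]_x f (phi x))%E.
Proof.
move=> mf f0; rewrite [LHS](@ge0_integral_pushforward _ _ _ _ _ phi)//.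
Qed.

Section polar.
Context (R : realType) (k : nat).
Local Notation RM := (measurableTypeR R).
Local Notation mu := (@lebesgue_measure R).
Implicit Types (z u w : rvec R k) (I : {set 'I_k}).

Lemma ge0_integral_shift (c : R) (f : R -> \bar R) :
  measurable_fun setT f -> (forall x, 0 <= f x)%E ->
  (\int[mu]_x f (x + c)%R = \int[mu]_x f x)%E.
Proof.
move=> mf f0; apply/esym.
have mS : measurable_fun setT (fun x : RM => x + c : RM) by exact: measurable_funD.
transitivity (\int[pushforward mu (fun x : RM => (x + c)%R : RM)]_x f x)%E.
  by apply: eq_measure_integral => X mX _; exact: lebesgue_measure_shift.
by rewrite ge0_integral_pushforward.
Qed.

Lemma ge0_integral_face_scale I (r : R) (f : rvec R k -> \bar R) : 0 < r ->
  measurable_fun setT f -> (forall x, 0 <= f x)%E ->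
  (\int[face_measure R I]_z f z =
   (r ^+ #|I|)%:E * \int[face_measure R I]_z f (scalep r z))%E.
Proof.
move=> r0 mf f0.
have mS : measurable_fun setT (scalep r : rvec R k -> rvec R k).
  exact: measurable_scalep.
have rI : 0 <= r ^+ #|I| by rewrite exprn_ge0// ltW.
pose sc : {mfun rvec R k >-> rvec R k} :=
  HB.pack (scalep r : rvec R k -> rvec R k) (isMeasurableFun.Build _ _ _ _ _ mS).
transitivity (\int[mscale (NngNum rI) (image_measure (face_measure R I) sc)]_x f x)%E.
  by apply: eq_measure_integral => X mX _; exact: face_measure_scale.
by rewrite ge0_integral_mscale//= ge0_integral_image.
Qed.

Lemma simplex_measureE I : I != finset.set0 -> exists2 i, i \in I &
  simplex_measure R I = image_measure (face_measure R (I :\ i)%SET) (@fill_coord R k i).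
Proof.
rewrite /simplex_measure; case: pickP => [i Ii _|h /set0Pn[i]]; first by exists i.
by rewrite h.
Qed.

Lemma ge0_integral_simplexE I i (f : rvec R k -> \bar R) :
  measurable_fun setT f -> (forall x, 0 <= f x)%E ->
  (\int[image_measure (face_measure R (I :\ i)%SET) (@fill_coord R k i)]_w f w =
   \int[face_measure R (I :\ i)%SET]_u f (fill_coord i u))%E.
Proof.
by move=> mf f0; rewrite ge0_integral_image.
Qed.

Lemma fill_coord_sum i u : \sum_(j < k) entry (fill_coord i u) j = 1.
Proof.
rewrite (bigD1 i)//= entry_upd eqxx -[RHS](subrK (\sum_(j < k | j != i) entry u j)).
by congr (_ + _); apply: eq_bigr => j ji; rewrite entry_upd (negbTE ji).
Qed.

Lemma norm1_ge0E z : (forall i, 0 <= entry z i) -> norm1 z = \sum_(i < k) entry z i.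
Proof. by move=> z0; apply: eq_bigr => i _; rewrite ger0_norm. Qed.

Lemma Eface_ge0 I z : Eface I z -> forall i, 0 <= entry z i.
Proof. by move=> Iz i; have := Iz i; case: ifP => _ => [/ltW|/eqP ->]. Qed.

Lemma Eface_scalep I (r : R) z : 0 < r -> Eface I (scalep r z) <-> Eface I z.
Proof.
move=> r0; split => h i; have := h i; rewrite entry_scalep; case: ifP => _.
- by rewrite pmulr_rgt0.
- by rewrite mulf_eq0 gt_eqF.
- by rewrite pmulr_rgt0.
- by move/eqP ->; rewrite mulr0.
Qed.

(** Writing the chosen coordinate as the norm minus the sum of the others is a
    translation; the remaining coordinates are then rescaled by the norm,
    which produces the Jacobian r^(|I| - 1). *)
Lemma ge0_integral_polar I (g : rvec R k -> \bar R) : I != finset.set0 ->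
  measurable_fun setT g -> (forall z, 0 <= g z)%E ->
  (forall z, ~ Eface I z -> g z = 0%E) ->
  (\int[face_measure R I]_z g z =
   \int[simplex_measure R I]_w \int[mu]_(r in `]0%R, +oo[)
      ((r ^+ #|I|.-1)%:E * g (scalep r w)))%E.
Proof.
move=> I0 mg g0 gI; have [i Ii ->] := simplex_measureE I0.
pose J := (I :\ i)%SET; have IJ : #|I|.-1 = #|J| by rewrite (cardsD1 i I) Ii.
pose s u := \sum_(j < k | j != i) entry u j.
have ms : measurable_fun setT s.
  rewrite /s; under eq_fun do rewrite big_mkcond.
  by apply: measurable_sum => l; case: (l != i); [exact: measurable_entry|].
pose wt (r : R) : R := if 0 < r then r ^+ #|J| else 0.
have wt0 r : 0 <= wt r by rewrite /wt; case: ifP => // r0; rewrite exprn_ge0// ltW.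
have mwt : measurable_fun setT wt.
  by apply: measurable_fun_ifT => //; first [exact: measurable_fun_ltr|exact: exprn_measurable].
pose G (p : rvec R k * R) : \bar R := ((wt p.2)%:E * g (scalep p.2 p.1))%E.
have mG : measurable_fun setT G.
  apply: emeasurable_funM.
    by apply/measurable_EFinP; exact: (measurableT_comp mwt measurable_snd).
  apply: (measurableT_comp mg).
  by apply: measurable_scalep; [exact: measurable_snd|exact: measurable_fst].
have G0 p : (0 <= G p)%E by apply: mule_ge0 => //; rewrite lee_fin.
transitivity (\int[image_measure (face_measure R J) (@fill_coord R k i)]_w
   \int[mu]_r G (w, r))%E; last first.
  apply: eq_integral => w _; rewrite IJ [RHS]integral_mkcond; apply: eq_integral => r _.
  by rewrite patchE mem_setE in_itv/= andbT /G/= /wt; case: ifP => //; rewrite mul0e.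
rewrite ge0_integral_simplexE; last 2 first.
- exact: (@measurable_fun_fubini_tonelli_F _ _ _ _ _ mu G).
- by move=> w; apply: integral_ge0 => r _; exact: (G0 (w, r)).
(* coordinates u outside i, norm r, on the face *)
pose fl (p : rvec R k * R) : rvec R k := upd p.1 i (p.2 - s p.1).
have mfl : measurable_fun setT fl.
  apply: measurable_upd; first exact: measurable_fst.
  apply: measurable_funB; first exact: measurable_snd.
  exact: (measurableT_comp ms measurable_fst).
have mgfl : measurable_fun setT (g \o fl) by exact: measurableT_comp.
transitivity (\int[face_measure R J]_u \int[mu]_r g (fl (u, r)))%E.
  rewrite (@ge0_integral_disint _ _ _ (fun j : 'I_k => if j \in J then
      mu : {sigma_finite_measure set RM -> \bar R}
    else \d_ ((0 : R) : RM)) i g)//; last 2 first.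
  - by move=> j ji; rewrite /J in_setD1 ji.
  - by rewrite /J in_setD1 eqxx/=; exact: diracT.
  apply: eq_integral => u _; rewrite Ii.
  rewrite -[RHS](@ge0_integral_shift (s u) (fun r => g (fl (u, r))))//.
  - by apply: eq_integral => t _; rewrite /fl/= addrK.
  - by apply: (measurableT_comp mgfl); exact: measurable_pair1.
have gfl0 p : (0 <= (g \o fl) p)%E by exact: g0.
rewrite [LHS](@fubini_tonelli _ _ _ _ _ (face_measure R J) mu (g \o fl))//.
pose G' (p : rvec R k * R) := G (fill_coord i p.1, p.2).
have mG' : measurable_fun setT G'.
  apply: (measurableT_comp mG); apply: measurable_fun_pair; last exact: measurable_snd.
  exact: (measurableT_comp (measurable_fill_coord i) measurable_fst).
have G'0 p : (0 <= G' p)%E by exact: G0.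
rewrite [RHS](@fubini_tonelli _ _ _ _ _ (face_measure R J) mu G')//.
apply: eq_integral => r _; rewrite /G' /G/=.
have [r0|r0] := ltP 0 r; last first.
  transitivity (0%E : \bar R); last first.
    by apply/esym/integral0_eq => u _; rewrite /wt ltNge r0 mul0e.
  apply: integral0_eq => u _.
  apply: gI => h; move: r0; apply/negP; rewrite -ltNge.
  have := h i; rewrite Ii entry_upd eqxx => h1.
  rewrite -(subrK (s u) r) ltr_wpDr// sumr_ge0// => j ji.
  by have := Eface_ge0 h j; rewrite entry_upd (negbTE ji).
rewrite [LHS](ge0_integral_face_scale J r0)//; last first.
  by apply: (measurableT_comp mgfl); exact: measurable_pair2.
rewrite /wt r0 ge0_integralZl//; last 2 first.
- have mh : measurable_fun setT (fun u : rvec R k => scalep r (fill_coord i u)).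
    by apply: measurable_scalep => //; exact: measurable_fill_coord.
  exact: (measurableT_comp mg mh).
- by rewrite lee_fin exprn_ge0// ltW.
congr (_ * _)%E; apply: eq_integral => u _; congr (g _).
apply: rvecP => j; rewrite entry_scalep !entry_upd; case: eqP => // _.
  rewrite mulrBr mulr1 mulr_sumr; congr (_ - _).
  by apply: eq_bigr => l _; rewrite entry_scalep.
by rewrite entry_scalep.
Qed.

End polar.

Section with_density.
Context d (T : measurableType d) (R : realType) (mu : {measure set T -> \bar R})
  (f : T -> \bar R).
Hypotheses (mf : measurable_fun setT f) (f0 : forall x, (0 <= f x)%E).

Lemma with_density_measure :
  exists m : {measure set T -> \bar R}, forall A, m A = (\int[mu]_(x in A) f x)%E.
Proof.
pose m (A : set T) : \bar R := (\int[mu]_(x in A) f x)%E.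
have m0 : m set0 = 0%E by exact: integral_set0.
have mge0 A : (0 <= m A)%E by apply: integral_ge0.
have madd : semi_sigma_additive m.
  move=> F mF tF mUF; rewrite /m ge0_integral_bigcup//.
    by apply: is_cvg_ereal_nneg_natsum_cond => n _ _; apply: integral_ge0.
  exact: measurable_funTS.
pose m' : {measure set T -> \bar R} := HB.pack m (isMeasure.Build _ _ _ m m0 mge0 madd).
by exists m'.
Qed.

End with_density.

Section real_analysis.
Context (R : realType).

Lemma measurable_invr : measurable_fun setT (fun x : R => x^-1).
Proof.
have -> : [set: R] = [set 0] `|` ~` [set 0] by rewrite setUv.
apply/measurable_funU => //; first exact: measurableC.
split; first exact: measurable_fun_set1.
apply: open_continuous_measurable_fun; first by rewrite openC; exact: closed_eq.
by move=> x; rewrite inE/= => /eqP x0; exact: inv_continuous.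
Qed.

(** The radial part of the exponent measure. *)
Lemma integral_powN2 (r : R) : 0 < r ->
  (\int[@lebesgue_measure R]_(x in `]r, +oo[) ((x ^- 2)%:E) = (r^-1)%:E)%E.
Proof.
move=> r0.
have mf : measurable_fun setT (fun x : R => (x ^- 2)%:E).
  apply/measurable_EFinP; apply: (measurableT_comp measurable_invr).
  exact: exprn_measurable.
have dF x : r <= x -> is_derive x 1 (fun y : R => - y^-1) (x ^- 2).
  move=> rx; have x0 : x != 0 by rewrite gt_eqF// (lt_le_trans r0).
  apply: is_derive_eq; first by apply: is_deriveN; apply: (is_deriveV x0).
  by rewrite scaleNr opprK /GRing.scale/= mulr1.
rewrite integral_itv_obnd_cbnd; last exact: measurable_funTS.
rewrite (@ge0_continuous_FTC2y _ _ (fun y : R => - y^-1) r 0).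
- by rewrite sub0e EFinN oppeK.
- by move=> x rx; rewrite invr_ge0 exprn_ge0// (le_trans _ rx)// ltW.
- apply: continuous_in_subspaceT => x; rewrite inE/= in_itv/= andbT => rx.
  have x0 : x != 0 by rewrite gt_eqF// (lt_le_trans r0).
  apply: (@continuous_comp _ _ _ (fun x : R => x ^+ 2) (fun x : R => x^-1)).
    exact: exprn_continuous.
  by apply: inv_continuous; rewrite expf_neq0.
- rewrite -oppr0; apply: cvgN; apply/gtr0_cvgV0; last exact: cvg_id.
  by exists 0; split.
- by move=> x rx; have [] := dF x (ltW rx).
- apply: cvg_at_right_filter.
  by have [+ _] := dF r (lexx r); move=> /derivable1_diffP/differentiable_continuous.
- move=> x; rewrite in_itv/= andbT => rx; have := dF x (ltW rx).
  by move=> h; rewrite derive1E; exact: derive_val.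
Qed.

End real_analysis.

Section cones.
Context (R : realType) (k : nat).
Local Notation RM := (measurableTypeR R).
Implicit Types (z u w : rvec R k) (I : {set 'I_k}).

Definition angle z : rvec R k := scalep (norm1 z)^-1 z.

Definition cone (r : R) (B : set (rvec R k)) : set (rvec R k) :=
  [set z | [/\ Espace z, r < norm1 z & B (angle z)]].

Lemma measurable_angle : measurable_fun setT angle.
Proof.
apply: measurable_scalep => //.
exact: (measurableT_comp (@measurable_invr R) (@measurable_norm1 R k)).
Qed.

Lemma measurable_simplex : measurable (@simplex R k).
Proof.
have -> : @simplex R k = [set w | forall i, 0 <= entry w i <= 1] `&`
    [set w | \sum_(i < k) entry w i = 1] by [].
apply: measurableI.
  rewrite (_ : mkset _ = tbox (fun=> `[0, 1]%classic : set RM)).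
    exact: measurable_tbox.
  by apply/seteqP; split => z h i; have := h i; rewrite /= in_itv.
rewrite (_ : mkset _ = (fun z => \sum_(i < k) entry z i) @^-1` [set 1 : R]) //.
apply: measurable_preimage => //.
by apply: measurable_sum => i; exact: measurable_entry.
Qed.

Lemma measurable_norm_gt (r : R) : measurable [set z : rvec R k | r < norm1 z].
Proof.
rewrite (_ : mkset _ = @norm1 R k @^-1` (`]r, +oo[%classic : set RM)).
  by apply: measurable_preimage => //; exact: measurable_norm1.
by apply/seteqP; split => z; rewrite /= in_itv/= andbT.
Qed.

Lemma coneE r B : cone r B =
  @Espace R k `&` ([set z | r < norm1 z] `&` angle @^-1` B).
Proof. by apply/seteqP; split => z; [case|case=> ? []]. Qed.

Lemma measurable_cone r B : measurable B -> measurable (cone r B).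
Proof.
move=> mB; rewrite coneE; apply: measurableI; first exact: measurable_Espace.
apply: measurableI; first exact: measurable_norm_gt.
by apply: measurable_preimage => //; exact: measurable_angle.
Qed.

Lemma Espace_norm_gt0 z : Espace z -> 0 < norm1 z.
Proof.
move=> [z0 [i zi]]; apply: (@lt_le_trans _ _ `|entry z i|); first by rewrite normr_gt0.
by rewrite /norm1 (bigD1 i)//= lerDl sumr_ge0.
Qed.

Lemma angle_simplex z : Espace z -> simplex (angle z).
Proof.
move=> Ez; have n0 := Espace_norm_gt0 Ez; have [z0 _] := Ez.
have S1 : \sum_(i < k) entry (angle z) i = 1.
  under eq_bigr do rewrite entry_scalep.
  by rewrite -mulr_sumr -norm1_ge0E// mulVf// gt_eqF.
have a0 i : 0 <= entry (angle z) i.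
  by rewrite entry_scalep mulr_ge0// invr_ge0 ltW.
split=> [i|]; last exact: S1.
rewrite a0/= -[leRHS]S1 (bigD1 i)//= lerDl; apply: sumr_ge0 => j _; exact: a0.
Qed.

Lemma scalep_angle z : Espace z -> scalep (norm1 z) (angle z) = z.
Proof.
move=> /Espace_norm_gt0 n0; apply: rvecP => i.
by rewrite !entry_scalep mulrA divff ?gt_eqF// mul1r.
Qed.

Lemma Eface_Espace I z : I != finset.set0 -> Eface I z -> Espace z.
Proof.
move=> /set0Pn[i Ii] Iz; split; first exact: Eface_ge0 Iz.
by exists i; have := Iz i; rewrite Ii => h; rewrite gt_eqF.
Qed.

Lemma norm1_scalep_simplex r w : 0 < r -> simplex w -> norm1 (scalep r w) = r.
Proof.
move=> r0 [w0 w1]; rewrite norm1_ge0E; last first.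
  move=> i; rewrite entry_scalep; apply: mulr_ge0; first exact: ltW.
  by case/andP: (w0 i).
by under eq_bigr do rewrite entry_scalep; rewrite -mulr_sumr w1 mulr1.
Qed.

Lemma angle_scalep_simplex r w : 0 < r -> simplex w -> angle (scalep r w) = w.
Proof.
move=> r0 Sw; rewrite /angle norm1_scalep_simplex//; apply: rvecP => i.
by rewrite !entry_scalep mulrA mulVf ?gt_eqF// mul1r.
Qed.

Lemma simplex_Espace w : simplex w -> Espace w.
Proof.
move=> [w0 w1]; split; first by move=> i; case/andP: (w0 i).
apply: contrapT => h; move/eqP : w1; rewrite big1 ?(eq_sym 0) ?oner_eq0// => i _.
by apply: contrapT => /eqP wi; apply: h; exists i.
Qed.

Lemma scalep_Espace r z : 0 < r -> Espace z -> Espace (scalep r z).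
Proof.
move=> r0 [z0 [i zi]]; split.
  by move=> j; rewrite entry_scalep mulr_ge0// ltW.
by exists i; rewrite entry_scalep mulf_neq0// gt_eqF.
Qed.

Lemma measure_eq_rays (m1 m2 : {measure set RM -> \bar R}) :
  (m1 setT < +oo)%E -> (forall r : R, m1 `]r, +oo[%classic = m2 `]r, +oo[%classic) ->
  forall X, measurable X -> m1 X = m2 X.
Proof.
move=> m1oo m12 X mX.
apply: (@measure_unique _ R RM (@RGenOInfty.G R)
  (fun j : nat => `](- j%:R)%R, +oo[%classic) (RGenOInfty.measurableE R)) => //.
- move=> _ _ [a ->] [b ->]; exists (Order.max a b).
  apply/seteqP; split => x; rewrite /= !in_itv/= !andbT gt_max.
    by move=> [-> ->].
  by move=> /andP[].
- by move=> j; exists (- j%:R).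
- apply/seteqP; split => // x _; exists (Num.bound `|x|) => //=.
  rewrite in_itv/= andbT ltrNl; apply: le_lt_trans (archi_boundP _) => //.
  by rewrite -normrN ler_norm.
- by move=> _ [r ->]; exact: m12.
- move=> j; apply: le_lt_trans m1oo; apply: le_measure; rewrite ?inE//.
Qed.

(** The pair of norm and angle determines a point, so sets given by a norm and
    an angle are a pi-system once the norm is kept above 1/n; the levels 1/n
    exhaust the punctured orthant. *)
Lemma measure_eq_cone (N1 N2 : {measure set (rvec R k) -> \bar R}) :
  (forall r B, 0 < r -> measurable B -> B `<=` @simplex R k ->
    N1 (cone r B) = N2 (cone r B)) ->
  (forall r : R, (0 < r)%R -> N1 (cone r (@simplex R k)) < +oo)%E ->
  forall A, measurable A -> A `<=` @Espace R k -> N1 A = N2 A.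
Proof.
move=> h12 hoo A mA AE.
(* both measures are finite on D n *)
pose D n := cone (n.+1%:R^-1) (@simplex R k).
have mD n : measurable (D n) by exact: measurable_cone measurable_simplex.
have Dr n : 0 < n.+1%:R^-1 :> R by rewrite invr_gt0.
pose psi z : RM * rvec R k := (norm1 z, angle z).
have mpsi : measurable_fun setT psi.
  by apply: measurable_fun_pair; [exact: measurable_norm1|exact: measurable_angle].
pose psi' : {mfun rvec R k >-> (RM * rvec R k)%type} :=
  HB.pack psi (isMeasurableFun.Build _ _ _ _ _ mpsi).
pose nmf : rvec R k -> RM := @norm1 R k.
have mnm : measurable_fun setT nmf by exact: measurable_norm1.
pose nm : {mfun rvec R k >-> RM} := HB.pack nmf (isMeasurableFun.Build _ _ _ _ _ mnm).
(* first sets given by a norm in X and an angle in B, and for fixed B only rays X *)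
have rect n X B : measurable X -> measurable B ->
    N1 (psi @^-1` (X `*` B) `&` D n) = N2 (psi @^-1` (X `*` B) `&` D n).
  move=> mX mB.
  pose E := angle @^-1` B `&` D n.
  have mE : measurable E.
    apply: measurableI => //; apply: measurable_preimage => //; exact: measurable_angle.
  have -> : psi @^-1` (X `*` B) `&` D n = @norm1 R k @^-1` X `&` E.
    by rewrite setIA.
  apply: (@measure_eq_rays (image_measure (mrestr N1 mE) nm)
    (image_measure (mrestr N2 mE) nm)) => //.
    change (N1 (@norm1 R k @^-1` setT `&` E) < +oo)%E.
    rewrite preimage_setT setTI; apply: le_lt_trans (hoo _ (Dr n)).
    by apply: le_measure; rewrite ?inE//; [exact: (mD n)|exact: subIsetr].
  move=> r.
  change (N1 (@norm1 R k @^-1` (`]r, +oo[%classic : set RM) `&` E) =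
    N2 (@norm1 R k @^-1` (`]r, +oo[%classic : set RM) `&` E)).
  have -> : @norm1 R k @^-1` (`]r, +oo[%classic : set RM) `&` E =
      cone (Order.max r n.+1%:R^-1) (B `&` @simplex R k).
    apply/seteqP; split => z; rewrite /= in_itv/= andbT.
      by move=> [rz [Bz [Ez nz Sz]]]; split => //; rewrite gt_max rz nz.
    by move=> [Ez]; rewrite gt_max => /andP[rz nz] [Bz Sz]; split.
  apply: h12; first by rewrite lt_max Dr orbT.
    by apply: measurableI => //; exact: measurable_simplex.
  exact: subIsetr.
have AD n : N1 (A `&` D n) = N2 (A `&` D n).
  pose C := (fun p : RM * rvec R k => scalep p.1 p.2) @^-1` A.
  have mC : measurable C.
    apply: measurable_preimage => //.
    by apply: measurable_scalep; [exact: measurable_fst|exact: measurable_snd].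
  have -> : A `&` D n = psi @^-1` C `&` D n.
    apply/seteqP; split => z [hz Dz]; split => //; have [Ez _ _] := Dz.
      by rewrite /C/psi/= scalep_angle.
    by move: hz; rewrite /C/psi/= scalep_angle.
  apply: (@measure_unique _ _ _ _ (fun=> setT `*` setT)
    (@measurable_prod_measurableType _ _ RM (rvec R k)) _ _ _
    (image_measure (mrestr N1 (mD n)) psi') (image_measure (mrestr N2 (mD n)) psi')) => //.
  - move=> _ _ [X1 mX1 [B1 mB1 <-]] [X2 mX2 [B2 mB2 <-]].
    exists (X1 `&` X2); first exact: measurableI.
    exists (B1 `&` B2); first exact: measurableI.
    by rewrite setXI.
  - by move=> i; exists setT => //; exists setT.
  - by rewrite setXTT; apply/seteqP; split => // x _; exists 0%N.
  - by move=> _ [X mX [B mB <-]]; exact: rect.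
  - move=> i; change (N1 (psi @^-1` (setT `*` setT) `&` D n) < +oo)%E.
    rewrite setXTT preimage_setT setTI; exact: hoo.
have AU : A = \bigcup_n (A `&` D n).
  apply/seteqP; split => z; last by move=> [n _ []].
  move=> Az; have Ez := AE _ Az; have n0 := Espace_norm_gt0 Ez.
  have [n hn] := exists_lt_invS n0; exists n => //.
  by split => //; split => //; exact: angle_simplex.
have mAD n : measurable (A `&` D n) by exact: measurableI.
have nd : nondecreasing_seq (fun n => A `&` D n).
  move=> m n mn; apply/subsetPset => z [Az [Ez nz Sz]]; split => //; split => //.
  by apply: le_lt_trans nz; rewrite lef_pV2 ?posrE// ler_nat.
have mU : measurable (\bigcup_n (A `&` D n)) by rewrite -AU.
have c1 := nondecreasing_cvg_mu (mu := N1) mAD mU nd.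
have c2 := nondecreasing_cvg_mu (mu := N2) mAD mU nd.
rewrite AU.
have -> : N1 (\bigcup_n (A `&` D n)) = limn (fun n => N1 (A `&` D n)) by apply/esym/cvg_lim.
have -> : N2 (\bigcup_n (A `&` D n)) = limn (fun n => N2 (A `&` D n)) by apply/esym/cvg_lim.
by congr (limn _); apply/funext => n; exact: AD.
Qed.

End cones.

(** * Densities of the exponent measure and of the angular measure *)

Section face_densities.
Context (R : realType) (k : nat).
Local Notation RM := (measurableTypeR R).
Local Notation mu := (@lebesgue_measure R).
Implicit Types (z u w : rvec R k) (I : {set 'I_k}).

Section family.
Context (lam : {set 'I_k} -> rvec R k -> R).
Hypothesis mlam : forall I : {set 'I_k}, I != finset.set0 -> measurable_fun (Eface I) (lam I).
Hypothesis lam0 : forall I : {set 'I_k}, I != finset.set0 ->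
  forall z, Eface I z -> 0 <= lam I z.

Definition on_face I : rvec R k -> \bar R := (EFin \o lam I) \_ (@Eface R k I).

Lemma on_faceE I z : Eface I z -> on_face I z = (lam I z)%:E.
Proof. by move=> Iz; rewrite /on_face patchE mem_set. Qed.

Lemma on_face0 I z : ~ Eface I z -> on_face I z = 0%E.
Proof. by move=> Iz; rewrite /on_face patchE memNset. Qed.

Lemma on_face_ge0 I z : I != finset.set0 -> (0 <= on_face I z)%E.
Proof.
move=> I0; have [Iz|Iz] := pselect (Eface I z); last by rewrite on_face0.
by rewrite on_faceE// lee_fin lam0.
Qed.

Lemma measurable_on_face I : I != finset.set0 -> measurable_fun setT (on_face I).
Proof.
move=> I0; apply/(measurable_restrictT _ (@measurable_Eface R k I)).
by apply/measurable_EFinP; exact: mlam.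
Qed.

(** Faces are disjoint, so at every point at most one term of the sum is
    nonzero. *)
Definition glue z : \bar R := (\sum_(I : {set 'I_k} | I != finset.set0) on_face I z)%E.

Lemma glue_ge0 z : (0 <= glue z)%E.
Proof. by apply: sume_ge0 => I; exact: on_face_ge0. Qed.

Lemma measurable_glue : measurable_fun setT glue.
Proof.
have -> : glue = (fun z => \sum_(I : {set 'I_k})
    (if I != finset.set0 then on_face I z else 0))%E.
  by apply/funext => z; exact: big_mkcond.
apply: emeasurable_sum => I; case: (boolP (I != finset.set0)) => // I0; exact: measurable_on_face.
Qed.

Lemma Eface_inj I J z : Eface I z -> Eface J z -> I = J.
Proof.
move=> Iz Jz; apply/setP => i; have := Iz i; have := Jz i.
case: (i \in I); case: (i \in J) => //; first by move=> /eqP ->; rewrite ltxx.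
by move=> h /eqP e; rewrite e ltxx in h.
Qed.

Lemma integral_on_face I A : I != finset.set0 -> measurable A ->
  (\int[face_measure R I]_(z in A `&` Eface I) (lam I z)%:E =
   \int[face_measure R I]_(z in A) on_face I z)%E.
Proof. by move=> I0 mA; rewrite integral_mkcondr. Qed.

Lemma integral_glue A : measurable A ->
  (\sum_(I : {set 'I_k} | I != finset.set0)
     \int[face_measure R I]_(z in A `&` Eface I) (lam I z)%:E =
   \int[refmeas R k]_(z in A) glue z)%E.
Proof.
move=> mA; rewrite /glue.
have -> : (\int[refmeas R k]_(z in A)
    \sum_(I : {set 'I_k} | I != finset.set0) on_face I z =
  \int[refmeas R k]_(z in A)
    \sum_(I : {set 'I_k}) (if I != finset.set0 then on_face I z else 0))%E.
  by apply: eq_integral => z _; exact: big_mkcond.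
rewrite ge0_integral_sum//; last 2 first.
- move=> I; case: (boolP (I != finset.set0)) => // I0; apply: measurable_funTS; exact: measurable_on_face.
- by move=> I z _; case: ifPn => // I0; exact: on_face_ge0.
transitivity (\sum_(I : {set 'I_k}) (if I != finset.set0 then
  \int[face_measure R I]_(z in A `&` Eface I) (lam I z)%:E else 0))%E.
  exact: big_mkcond.
apply: eq_bigr => I _; case: ifPn => I0; last by rewrite integral0.
rewrite -integral_mkcondr; apply: eq_measure_integral => X mX XI.
by apply: refmeas_Eface => // z /XI [].
Qed.

(** The density that a cone inherits from its angles: the integrand is that of
    [ge0_integral_polar], beyond norm r. *)
Definition radial I (r : R) w : \bar R :=
  (\int[mu]_(t in `]r, +oo[) ((t ^+ #|I|.-1)%:E * on_face I (scalep t w)))%E.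

Lemma radial_ge0 I r w : I != finset.set0 -> 0 <= r -> (0 <= radial I r w)%E.
Proof.
move=> I0 r0; apply: integral_ge0 => t; rewrite /= in_itv/= andbT => rt.
by rewrite mule_ge0 ?on_face_ge0// lee_fin exprn_ge0// ltW// (le_lt_trans r0).
Qed.

Lemma measurable_radial I r : I != finset.set0 -> 0 <= r ->
  measurable_fun setT (radial I r).
Proof.
move=> I0 r0.
pose wt (t : R) : R := if r < t then t ^+ #|I|.-1 else 0.
have wt0 t : 0 <= wt t.
  by rewrite /wt; case: ifP => // r1; rewrite exprn_ge0// ltW// (le_lt_trans r0).
have mwt : measurable_fun setT wt.
  by apply: measurable_fun_ifT => //; first [exact: measurable_fun_ltr|exact: exprn_measurable].
pose G (p : rvec R k * R) : \bar R := ((wt p.2)%:E * on_face I (scalep p.2 p.1))%E.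
have mG : measurable_fun setT G.
  apply: emeasurable_funM.
    by apply/measurable_EFinP; exact: (measurableT_comp mwt measurable_snd).
  apply: (measurableT_comp (measurable_on_face I0)).
  by apply: measurable_scalep; [exact: measurable_snd|exact: measurable_fst].
rewrite (_ : radial I r = fun w => \int[mu]_t G (w, t))%E.
  apply: (@measurable_fun_fubini_tonelli_F _ _ _ _ _ mu G) => // p.
  by apply: mule_ge0; [rewrite lee_fin|exact: on_face_ge0].
apply/funext => w; rewrite /radial integral_mkcond; apply: eq_integral => t _.
by rewrite patchE mem_setE in_itv/= andbT /G/= /wt; case: ifP => //; rewrite mul0e.
Qed.

Lemma measurable_simplex_face I : measurable (@simplex_face R k I).
Proof. by apply: measurableI; [exact: measurable_simplex|exact: measurable_Eface]. Qed.

(** The measure of a face of the simplex only charges the hyperplane where the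
    coordinates sum to 1, on which the radial formulas simplify. *)
Lemma eq_integral_simplex I (f g : rvec R k -> \bar R) : I != finset.set0 ->
  measurable_fun setT f -> (forall w, 0 <= f w)%E ->
  measurable_fun setT g -> (forall w, 0 <= g w)%E ->
  (forall w, \sum_(i < k) entry w i = 1 -> f w = g w) ->
  (\int[simplex_measure R I]_w f w = \int[simplex_measure R I]_w g w)%E.
Proof.
move=> I0 mf f0 mg g0 fg; have [i Ii ->] := simplex_measureE R I0.
rewrite !ge0_integral_simplexE//; apply: eq_integral => u _.
exact/fg/fill_coord_sum.
Qed.

(** Points of the orthant with norm beyond r and angle in B become, in polar
    coordinates, the product of B with a half-line. *)
Lemma integral_cone I r B : I != finset.set0 -> 0 < r -> measurable B ->
  B `<=` @simplex R k ->
  (\int[face_measure R I]_(z in cone r B) on_face I z =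
   \int[simplex_measure R I]_(w in B `&` simplex_face I) radial I r w)%E.
Proof.
move=> I0 r0 mB BS; have mC := measurable_cone r mB.
have mBS : measurable (B `&` simplex_face I).
  by apply: measurableI => //; exact: measurable_simplex_face.
pose G := on_face I \_ (cone r B).
have mG : measurable_fun setT G.
  by apply/(measurable_restrictT _ mC)/measurable_funTS; exact: measurable_on_face.
have G0 z : (0 <= G z)%E by rewrite /G patchE; case: ifP => // _; exact: on_face_ge0.
rewrite integral_mkcond (ge0_integral_polar I0 mG G0); last first.
  by move=> z Iz; rewrite /G patchE; case: ifP => // _; rewrite on_face0.
rewrite [RHS]integral_mkcond.
have H0 w : (0 <= (radial I r \_ (B `&` simplex_face I)) w)%E.
  by rewrite patchE; case: ifP => // _; apply: radial_ge0 => //; exact: ltW.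
apply: eq_integral_simplex => //.
- pose wt (t : R) : R := if 0 < t then t ^+ #|I|.-1 else 0.
  have wt0 t : 0 <= wt t by rewrite /wt; case: ifP => // r1; rewrite exprn_ge0// ltW.
  have mwt : measurable_fun setT wt.
    by apply: measurable_fun_ifT => //; first [exact: measurable_fun_ltr|exact: exprn_measurable].
  pose G' (p : rvec R k * R) : \bar R := ((wt p.2)%:E * G (scalep p.2 p.1))%E.
  have mG' : measurable_fun setT G'.
    apply: emeasurable_funM.
      by apply/measurable_EFinP; exact: (measurableT_comp mwt measurable_snd).
    apply: (measurableT_comp mG).
    by apply: measurable_scalep; [exact: measurable_snd|exact: measurable_fst].
  rewrite (_ : (fun w => _) = fun w => \int[mu]_t G' (w, t))%E.
    apply: (@measurable_fun_fubini_tonelli_F _ _ _ _ _ mu G') => // p.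
    by apply: mule_ge0; [rewrite lee_fin|exact: G0].
  apply/funext => w; rewrite integral_mkcond; apply: eq_integral => t _.
  by rewrite patchE mem_setE in_itv/= andbT /G'/= /wt; case: ifP => //; rewrite mul0e.
- move=> w; apply: integral_ge0 => t; rewrite /= in_itv/= andbT => t0.
  by rewrite mule_ge0// lee_fin exprn_ge0// ltW.
- apply/(measurable_restrictT _ mBS); apply: measurable_funTS; apply: measurable_radial => //.
  exact: ltW.
move=> w w1; rewrite patchE; case: ifPn => [|].
  rewrite inE => -[Bw [Sw Iw]]; rewrite /radial integral_mkcond [RHS]integral_mkcond.
  apply: eq_integral => t _; rewrite !patchE !mem_setE !in_itv/= !andbT /G patchE.
  have [t0|t0] := ltP 0 t; last by rewrite ltNge (le_trans t0 (ltW r0)).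
  have [rt|rt] := ltP r t.
    rewrite mem_set//; split; first exact: scalep_Espace (simplex_Espace Sw).
      by rewrite norm1_scalep_simplex.
    by rewrite angle_scalep_simplex.
  rewrite memNset ?mule0// => -[_]; rewrite norm1_scalep_simplex// => rt'.
  by move: rt; rewrite leNgt rt'.
rewrite notin_setE => BSw; apply: integral0_eq => t; rewrite /= in_itv/= andbT => t0.
rewrite /G patchE; case: ifPn => [|_]; last by rewrite mule0.
rewrite inE => -[Et nt Bt]; have [It|/on_face0 ->] := pselect (Eface I (scalep t w));
  last by rewrite mule0.
exfalso; apply: BSw; have Iw : Eface I w by apply/(Eface_scalep I w t0).
have Sw : simplex w.
  split=> // i; rewrite (Eface_ge0 Iw)/= -w1 (bigD1 i)//= lerDl.
  by apply: sumr_ge0 => j _; exact: Eface_ge0 Iw _.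
by split => //; rewrite -(angle_scalep_simplex t0 Sw).
Qed.

End family.

Section measures.
Context (L : {measure set (rvec R k) -> \bar R}) (H : probability (rvec R k) R).
Hypothesis LH : angular_measure L H.

Lemma exponent_cone r B : 0 < r -> measurable B -> B `<=` @simplex R k ->
  L (cone r B) = ((k%:R * r^-1)%:E * H B)%E.
Proof. by case: LH => _; exact. Qed.

Lemma exponent_cone_lty r B : 0 < r -> measurable B -> B `<=` @simplex R k ->
  (L (cone r B) < +oo)%E.
Proof.
move=> r0 mB BS; rewrite exponent_cone// lte_mul_pinfty// ?lee_fin.
- by rewrite divr_ge0// ltW.
- by rewrite (le_lt_trans (probability_le1 _ mB)) ?ltry.
Qed.

Definition radial_density (h : {set 'I_k} -> rvec R k -> R) I z : R :=
  k%:R * (norm1 z) ^- (#|I|.+1) * h I (scalep (norm1 z)^-1 z).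

(** By [measure_eq_cone] it is enough to compare L with the measure of density
    [radial_density h] on cones; there the powers of the norm combine to r^-2,
    whose integral beyond r is 1/r. *)
Lemma exponent_density_of_angular h : angular_density H h ->
  exponent_density L (radial_density h).
Proof.
move=> [mh h0 Hh].
have SFangle I z : I != finset.set0 -> Eface I z -> simplex_face I (angle z).
  move=> I0 Iz; have Ez := Eface_Espace I0 Iz; split; first exact: angle_simplex.
  by apply/Eface_scalep => //; rewrite invr_gt0; exact: Espace_norm_gt0.
have mlam I : I != finset.set0 -> measurable_fun (Eface I) (radial_density h I).
  move=> I0; apply: measurable_funM.
    apply: measurable_funM => //.
    apply: measurable_funTS; apply: (measurableT_comp (@measurable_invr R)).
    by apply: measurable_funX; exact: measurable_norm1.
  apply: (@measurable_comp _ _ _ _ _ _ (simplex_face I)).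
  - exact: measurable_simplex_face.
  - by move=> _ [z Iz <-]; exact: SFangle.
  - exact: mh.
  - by apply: measurable_funTS; exact: measurable_angle.
have lam0 I : I != finset.set0 -> forall z, Eface I z -> 0 <= radial_density h I z.
  move=> I0 z Iz; apply: mulr_ge0; last by apply: h0 => //; exact: SFangle.
  by rewrite mulr_ge0// invr_ge0 exprn_ge0// ltW// Espace_norm_gt0//; exact: Eface_Espace Iz.
split=> // A mA AE.
rewrite integral_glue//.
have [m' m'E] := with_density_measure (refmeas R k) (measurable_glue mlam) (glue_ge0 lam0).
rewrite -m'E; apply: measure_eq_cone => //; last first.
  by move=> r r0; apply: exponent_cone_lty => //; exact: measurable_simplex.
move=> r B r0 mB BS; have mC := measurable_cone r mB.
rewrite exponent_cone// m'E -integral_glue// Hh//.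
have kr0 : 0 <= k%:R * r^-1 by rewrite divr_ge0// ltW.
rewrite ge0_sume_distrr; last first.
  by move=> I I0; apply: integral_ge0 => w [_ Sw]; rewrite lee_fin; exact: h0.
apply: eq_bigr => I I0.
rewrite integral_on_face// integral_cone// -ge0_integralZl//; last 3 first.
- by apply: measurableI => //; exact: measurable_simplex_face.
- apply/measurable_EFinP; apply: measurable_funS (mh I I0) => //.
  exact: measurable_simplex_face.
- by move=> w [_ Sw]; rewrite lee_fin; exact: h0.
apply: eq_integral => w; rewrite inE => -[Bw Sw].
have [SSw Iw] := Sw.
have hw := h0 _ I0 _ Sw.
transitivity (\int[mu]_(t in `]r, +oo[) ((k%:R * h I w)%:E * (t ^- 2)%:E))%E.
  rewrite ge0_integralZl//.
  - by rewrite integral_powN2// -!EFinM; congr (_%:E); ring.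
  - by apply/measurable_EFinP; apply: measurable_funTS;
      apply: (measurableT_comp (@measurable_invr R)); exact: exprn_measurable.
  - by move=> t _; rewrite lee_fin invr_ge0 sqr_ge0.
  - by rewrite lee_fin mulr_ge0.
apply: eq_integral => t; rewrite inE/= in_itv/= andbT => rt.
have t0 : 0 < t by exact: lt_trans rt.
rewrite on_faceE; last by apply/Eface_scalep.
rewrite /radial_density -/(angle _) norm1_scalep_simplex// angle_scalep_simplex//.
rewrite -!EFinM; congr (_%:E).
have [n ->] : exists n, #|I| = n.+1 by exists #|I|.-1; rewrite prednK// card_gt0.
rewrite /= -[n.+2]addn2 exprD; field.
by rewrite gt_eqF//= expf_neq0// gt_eqF.
Qed.

(** Integrating radially over norms beyond 1 recovers H, so only the part of
    the exponent measure away from the origin matters. There L is finite,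
    whence the radial integrals are finite almost everywhere and can be
    replaced by real numbers. *)
Lemma angular_density_of_far (lam : {set 'I_k} -> rvec R k -> R) : (0 < k)%N ->
  (forall I : {set 'I_k}, I != finset.set0 -> measurable_fun (Eface I) (lam I)) ->
  (forall I : {set 'I_k}, I != finset.set0 -> forall z, Eface I z -> 0 <= lam I z) ->
  (forall A, measurable A -> A `<=` cone 1 (@simplex R k) ->
    L A = (\sum_(I : {set 'I_k} | I != finset.set0)
          \int[face_measure R I]_(z in A `&` Eface I) (lam I z)%:E)%E) ->
  exists h, angular_density H h.
Proof.
move=> k0 mlam lam0 Llam.
have k0' : 0 < k%:R :> R by rewrite ltr0n.
exists (fun I w => k%:R^-1 * fine (radial lam I 1 w)).
have mrad I : I != finset.set0 -> measurable_fun setT (radial lam I 1).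
  by move=> I0; exact: measurable_radial.
have rad0 I w : I != finset.set0 -> (0 <= radial lam I 1 w)%E.
  by move=> I0; exact: radial_ge0.
have HE B : measurable B -> B `<=` @simplex R k ->
    H B = (\sum_(I : {set 'I_k} | I != finset.set0) (k%:R^-1)%:E *
      \int[simplex_measure R I]_(w in B `&` simplex_face I) radial lam I 1 w)%E.
  move=> mB BS; have := exponent_cone ltr01 mB BS.
  rewrite invr1 mulr1 Llam; last 2 first.
  - exact: measurable_cone.
  - by move=> z [Ez nz /BS Bz]; split.
  move=> h; have : H B = ((k%:R^-1)%:E * (k%:R%:E * H B))%E.
    by rewrite muleA -EFinM mulVf ?mul1e// gt_eqF.
  move=> ->; rewrite -h ge0_sume_distrr; last first.
    by move=> I I0; apply: integral_ge0 => w [_ Iw]; rewrite lee_fin lam0.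
  apply: eq_bigr => I I0; rewrite integral_on_face//; last exact: measurable_cone.
  by rewrite integral_cone.
have fin I : I != finset.set0 ->
    (\int[simplex_measure R I]_(w in simplex_face I) radial lam I 1 w < +oo)%E.
  move=> I0; have := HE _ (@measurable_simplex R k) (@subset_refl _ _).
  case: LH => -> _ h; rewrite ltey; apply/eqP => hoo; move: h.
  rewrite (bigD1 I)//= [X in (_ * X)%E](_ : _ = +oo%E); last first.
    by rewrite setIA setIid.
  rewrite gt0_muley ?lte_fin ?invr_gt0//.
  rewrite addye; first by move=> /eqP.
  rewrite gt_eqF//; apply: (@lt_le_trans _ _ 0%E) => //; apply: sume_ge0 => J /andP[J0 _].
  apply: mule_ge0; first by rewrite lee_fin invr_ge0 ltW.
  by apply: integral_ge0 => w _; exact: rad0.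
split.
- move=> I I0; apply: measurable_funTS; apply: measurable_funM => //.
  by apply: measurableT_comp => //; exact: mrad.
- by move=> I I0 w _; rewrite mulr_ge0 ?invr_ge0 ?fine_ge0 ?rad0// ltW.
move=> B mB BS; rewrite HE//; apply: eq_bigr => I I0.
have mBS : measurable (B `&` simplex_face I).
  by apply: measurableI => //; exact: measurable_simplex_face.
rewrite -ge0_integralZl//; last 2 first.
- by apply: measurable_funTS; exact: mrad.
- by move=> w _; exact: rad0.
apply: ae_eq_integral => //.
- by apply: measurable_funTS; apply: emeasurable_funM => //; exact: mrad.
- apply/measurable_EFinP; apply: measurable_funTS; apply: measurable_funM => //.
  by apply: measurableT_comp => //; exact: mrad.
have int : (simplex_measure R I).-integrable (B `&` simplex_face I) (radial lam I 1).
  apply/integrableP; split; first by apply: measurable_funTS; exact: mrad.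
  apply: le_lt_trans (fin I I0).
  under eq_integral do rewrite gee0_abs ?rad0//.
  apply: ge0_subset_integral => //.
  - exact: measurable_simplex_face.
  - by apply: measurable_funTS; exact: mrad.
  - by move=> w _; exact: rad0.
have := integrable_ae mBS int; apply: filterS => w hw Dw.
by rewrite EFinM fineK// hw.
Qed.

Lemma angular_density_of_exponent lam : (0 < k)%N -> exponent_density L lam ->
  exists h, angular_density H h.
Proof.
move=> k0 [mlam lam0 Llam]; apply: (angular_density_of_far k0 mlam lam0) => A mA AC.
by apply: Llam => // z /AC [].
Qed.

(** Densities of a finite measure agree almost everywhere; L is finite on each
    of the cones of norm beyond 1/n, which exhaust the face. *)
Lemma exponent_density_unique lam lam' : exponent_density L lam ->
  exponent_density L lam' -> forall I : {set 'I_k}, I != finset.set0 ->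
  {ae face_measure R I, forall z, Eface I z -> lam I z = lam' I z}.
Proof.
move=> [mlam lam0 Llam] [mlam' lam0' Llam'] I I0.
pose D n := cone (n.+1%:R^-1) (@simplex R k) `&` Eface I.
have mD n : measurable (D n).
  apply: measurableI; last exact: measurable_Eface.
  exact: (measurable_cone _ (@measurable_simplex R k)).
(* subsets of one face only involve the density on that face *)
have single l A : (forall J : {set 'I_k}, J != finset.set0 -> measurable_fun (Eface J) (l J)) ->
    measurable A -> A `<=` Eface I ->
    (\sum_(J : {set 'I_k} | J != finset.set0)
       \int[face_measure R J]_(z in A `&` Eface J) (l J z)%:E =
     \int[face_measure R I]_(z in A) (l I z)%:E)%E.
  move=> ml mA AI; rewrite (bigD1 I)//= big1 ?adde0; last first.
    move=> J /andP[J0 JI]; rewrite (_ : _ `&` _ = set0) ?integral_set0//.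
    apply/seteqP; split => // z [/AI Iz Jz].
    by move/eqP: JI; apply; exact: Eface_inj Jz Iz.
  by rewrite setIidl.
have DI n : D n `<=` Eface I by exact: subIsetr.
have AE A : A `<=` Eface I -> A `<=` @Espace R k.
  by move=> AI z /AI; exact: Eface_Espace.
have sub n : {ae face_measure R I, forall z, D n z -> (lam I z)%:E = (lam' I z)%:E}.
  apply: integral_ae_eq => //.
  - apply/integrableP; split.
      by apply/measurable_EFinP; apply: measurable_funS (mlam I I0) => //; exact: measurable_Eface.
    rewrite (eq_integral (fun z => (lam I z)%:E)).
      rewrite -(single lam)// -Llam//; last exact/AE/DI.
      apply: (@le_lt_trans _ _ (L (cone (n.+1%:R^-1) (@simplex R k)))).
        apply: le_measure; rewrite ?inE//; first exact: (measurable_cone _ (@measurable_simplex R k)).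
        exact: subIsetl.
      by apply: exponent_cone_lty => //; exact: measurable_simplex.
    by move=> z; rewrite inE => /DI Iz; rewrite /= ger0_norm// lam0.
  - by apply/measurable_EFinP; apply: measurable_funS (mlam' I I0) => //; exact: measurable_Eface.
  - move=> E ED mE; have EI : E `<=` Eface I by apply: subset_trans (DI n).
    by rewrite -(single lam)// -(single lam')// -Llam ?Llam'//; exact: AE.
have := ae_foralln sub; apply: filterS => z h Iz.
have Ez := Eface_Espace I0 Iz; have n0 := Espace_norm_gt0 Ez.
have [n hn] := exists_lt_invS n0.
by apply: EFin_inj; apply: (h n); split => //; split => //; exact: angle_simplex.
Qed.

End measures.
End face_densities.

(** * Densities of the distribution function and of the exponent measure *)

Section null_helpers.
Context d (T : measurableType d) (R : realType).

Lemma integral_null_set (m : {measure set T -> \bar R}) (N : set T) (f : T -> \bar R) :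
  measurable N -> m N = 0%E -> measurable_fun N f -> (\int[m]_(x in N) f x = 0)%E.
Proof.
move=> mN N0 mf; rewrite (ae_eq_integral (cst 0%E))//; first by rewrite integral0.
exact: ae_eq0.
Qed.

Lemma measure_null_subset (m : {measure set T -> \bar R}) (A B : set T) :
  measurable A -> measurable B -> A `<=` B -> m B = 0%E -> m A = 0%E.
Proof.
move=> mA mB AB B0; apply/eqP; rewrite eq_le measure_ge0 andbT -[leRHS]B0.
by apply: le_measure; rewrite ?inE.
Qed.

Lemma measure_null_bigcup (m : {measure set T -> \bar R}) (A : set T) (F : nat -> set T) :
  measurable A -> (forall n, measurable (F n)) -> (forall n, m (F n) = 0%E) ->
  A `<=` \bigcup_n F n -> m A = 0%E.
Proof.
move=> mA mF F0 AF; apply/negligibleP; [exact: mA|]; apply: negligibleS AF _.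
apply: negligible_bigcup => n; apply/negligibleP; [exact: mF|exact: F0].
Qed.

(** Used with the faces: it reduces the density of L to one density per face. *)
Lemma measure_fin_partition (m : {measure set T -> \bar R}) (I : finType)
    (P : pred I) (F : I -> set T) (A : set T) :
  measurable A -> (forall i, measurable (F i)) ->
  (forall x, A x -> exists2 i, P i & F i x) ->
  (forall x i j, F i x -> F j x -> i = j) ->
  (m A = \sum_(i | P i) m (A `&` F i))%E.
Proof.
move=> mA mF AF Finj.
have H i : (\int[m]_(x in A) (if P i then (\1_(F i) x)%:E else 0) =
    if P i then m (A `&` F i) else 0)%E.
  by case: (P i); rewrite ?integral0// integral_indic// setIC.
transitivity (\sum_i (if P i then m (A `&` F i) else 0))%E; last exact/esym/big_mkcond.
under eq_bigr do rewrite -H.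
rewrite -ge0_integral_sum//; last 2 first.
- move=> i; case: (P i) => //.
  by apply/measurable_EFinP; exact: measurable_indic.
- by move=> i x _; case: (P i).
rewrite -[LHS]mul1e -integral_cst//; apply: eq_integral => x; rewrite inE => Ax.
have [i Pi Fi] := AF _ Ax.
rewrite (bigD1 i)//= Pi indicE mem_set//= big1 ?adde0// => j ji.
case: (P j) => //; rewrite indicE memNset// => Fj.
by move/eqP: ji; apply; exact: Finj Fj Fi.
Qed.

End null_helpers.

Section absolute_continuity.
Context (R : realType) (k : nat) (d : measure_display) (T : measurableType d)
  (P : probability T R) (Z : {RV P >-> rvec R k})
  (L : {measure set (rvec R k) -> \bar R}) (H : probability (rvec R k) R).
Local Notation RM := (measurableTypeR R).
Local Notation V := (exponent_function Z).
Hypothesis Zms : simple_max_stable Z.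
Hypothesis LV : exponent_measure V L.
Hypothesis LH : angular_measure L H.

Lemma tuple_measure_hyperplane (m : 'I_k -> {sigma_finite_measure set RM -> \bar R}) i c :
  m i [set c] = 0%E -> tuple_measure m [set x | entry x i = c] = 0%E.
Proof.
move=> h; have -> : [set x : rvec R k | entry x i = c] =
    tbox (fun j => if j == i then [set c] else setT : set RM).
  apply/seteqP; split => x; last by move=> /(_ i); rewrite eqxx.
  by move=> xi j; case: eqP => [->|].
have -> := @tuple_measure_tbox _ RM R k m
  (fun j => if j == i then [set c] else setT : set RM).
  by rewrite (bigD1 i)//= eqxx h mul0e.
by move=> j; case: ifP => // _; exact: measurable_set1.
Qed.

Lemma measurable_hyperplane i (c : R) : measurable [set x : rvec R k | entry x i = c].
Proof.
rewrite (_ : mkset _ = (fun x : rvec R k => entry x i) @^-1` [set c])//.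
by apply: measurable_preimage => //; exact: measurable_entry.
Qed.

(** The distribution function speaks of z_i <= t and the density formula of 0
    < z_i < t; the difference lies on finitely many hyperplanes. *)
Lemma orthant_lbox_boundary z : orthant z ->
  lebesgue_vec R k ((lbox z `&` @orthant R k) `\` obox z) = 0%E.
Proof.
move=> z0; apply/eqP; rewrite eq_le measure_ge0 andbT.
apply: (@le_trans _ _ (\sum_i lebesgue_vec R k [set x | entry x i = entry z i])%E).
  apply: measure_fin_cover.
  - apply: measurableD; last exact: measurable_obox.
    by apply: measurableI; [exact: measurable_lbox|exact: measurable_orthant].
  - by move=> i; exact: measurable_hyperplane.
  move=> x [[xz x0] /existsNP[i /negP]]; rewrite (x0 i)/= -leNgt => h.
  by exists i; apply/eqP; rewrite eq_le (xz i) h.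
rewrite big1// => i _; apply: tuple_measure_hyperplane; exact: lebesgue_measure_set1.
Qed.

Let law : {measure set (rvec R k) -> \bar R} := image_measure P Z.

Let lawE A : law A = P (Z @^-1` A). Proof. by []. Qed.

Lemma law_orthant A : measurable A -> P (Z @^-1` A) = P (Z @^-1` (A `&` @orthant R k)).
Proof.
move=> mA; have mo := @measurable_orthant R k.
have -> : Z @^-1` A = Z @^-1` (A `&` @orthant R k) `|` Z @^-1` (A `\` @orthant R k).
  by rewrite -preimage_setU setUIDK.
rewrite measureU.
- rewrite [X in (_ + X)%E](_ : _ = 0%E) ?adde0//.
  apply: (measure_null_subset _ _ _ (RV_orthant Zms)).
  + by apply: measurable_RV_preimage; exact: measurableD.
  + by apply: measurableC; exact: measurable_RV_preimage.
  + by move=> x [].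
- by apply: measurable_RV_preimage; exact: measurableI.
- by apply: measurable_RV_preimage; exact: measurableD.
- by apply/seteqP; split => // x [[_ h] [_]].
Qed.

(** Away from the boundary of the orthant the law of Z is absolutely
    continuous by [law_null_of_exponent], at each of the levels 1/n. The
    boundary has probability 0, so the Radon-Nikodym theorem gives a density
    of the whole law. *)
Lemma cdf_density_of_exponent lam : exponent_density L lam ->
  exists f, cdf_density (joint_cdf Z) f.
Proof.
move=> [mlam lam0 Llam]; have mo := @measurable_orthant R k.
have acL A : measurable A -> refmeas R k A = 0%E -> L (A `&` @Espace R k) = 0%E.
  move=> mA A0; have mAE : measurable (A `&` @Espace R k).
    by apply: measurableI => //; exact: measurable_Espace.
  rewrite Llam; [|exact: mAE|exact: subIsetr].
  rewrite integral_glue//; apply: integral_null_set => //.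
    by apply: (measure_null_subset _ mA _ A0) => //; exact: subIsetl.
  by apply: measurable_funTS; exact: measurable_glue.
have acP N : measurable N -> lebesgue_vec R k N = 0%E ->
    P (Z @^-1` (N `&` @orthant R k)) = 0%E.
  move=> mN N0; have mNo : measurable (N `&` @orthant R k) by exact: measurableI.
  pose U n : set (rvec R k) := [set x | forall i, n.+1%:R^-1 < entry x i].
  have mU n : measurable (U n).
    rewrite (_ : U n = tbox (fun=> `]n.+1%:R^-1, +oo[%classic : set RM)).
      exact: measurable_tbox.
    by apply/seteqP; split => x h i; have := h i; rewrite /= in_itv/= andbT.
  apply: (@measure_null_bigcup _ _ _ _ _ (fun n => Z @^-1` ((N `&` @orthant R k) `&` U n))).
  - exact: measurable_RV_preimage.
  - by move=> n; apply: measurable_RV_preimage; exact: measurableI.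
  - move=> n; apply: (law_null_of_exponent Zms LV (e := n.+1%:R^-1)) => //.
    + exact: measurableI.
    + apply: (@measure_null_subset _ _ _ (refmeas R k) _ (N `&` @orthant R k)) => //.
        exact: measurableI.
      apply: etrans (esym (refmeas_orthant mNo (@subIsetr _ _ _))) _.
      by apply: (measure_null_subset _ mN _ N0) => //; exact: subIsetl.
  - move=> x [Nx ox].
    have /choice[g hg] : forall i, exists n : nat, n.+1%:R^-1 < entry (Z x) i.
      by move=> i; apply: exists_lt_invS; exact: ox.
    exists (\max_i g i)%N => //; split => // i.
    apply: le_lt_trans (hg i); rewrite lef_pV2 ?posrE// ler_nat ltnS.
    exact: leq_bigmax.
have loo : (law (@orthant R k) < +oo)%E.
  by rewrite lawE; apply: le_lt_trans (probability_le1 _ _) (ltry _);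
    exact: measurable_RV_preimage.
pose nu : {finite_measure set (rvec R k) -> \bar R} := mfrestr mo loo.
have nuE A : nu A = P (Z @^-1` (A `&` @orthant R k)) by [].
have dom : nu `<< lebesgue_vec R k.
  by apply/null_content_dominatesP => A mA A0; rewrite nuE acP.
have [f [f0 ffin fint nuf]] := radon_nikodym_sigma_finite dom.
have mf : measurable_fun setT f by apply: measurable_int fint.
exists (fine \o f); split.
- by apply: measurable_funTS; exact: measurableT_comp.
- by move=> y _; exact: fine_ge0.
- move=> z z0; rewrite joint_cdfE law_orthant; last exact: measurable_lbox.
  under eq_integral do rewrite /= fineK//.
  rewrite -nuf; last exact: measurable_obox.
  have mlo : measurable (lbox z `&` @orthant R k).
    by apply: measurableI => //; exact: measurable_lbox.
  have ob : obox z `<=` lbox z `&` @orthant R k.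
    by move=> x xz; split => i; have /andP[? /ltW] := xz i.
  have moz : measurable (obox z) by exact: measurable_obox.
  have -> : nu (obox z) = P (Z @^-1` (obox z)).
    by rewrite nuE -law_orthant.
  have -> : lbox z `&` @orthant R k =
      obox z `|` ((lbox z `&` @orthant R k) `\` obox z).
    by rewrite setDUK.
  rewrite preimage_setU measureU.
  + rewrite [X in (_ + X)%E](_ : _ = 0%E) ?adde0//.
    apply: etrans (law_orthant _) _; first exact: measurableD.
    by apply: acP (orthant_lbox_boundary z0); exact: measurableD.
  + exact: measurable_RV_preimage.
  + by apply: measurable_RV_preimage; exact: measurableD.
  + by apply/seteqP; split => // x [h [_]].
Qed.

(** A law is determined by its distribution function, so the density of F over
    boxes is a density of the law. *)
Lemma law_null_of_cdf_density f : cdf_density (joint_cdf Z) f ->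
  forall A, measurable A -> lebesgue_vec R k A = 0%E -> P (Z @^-1` A) = 0%E.
Proof.
move=> [mf f0 Ff] A mA A0; have mo := @measurable_orthant R k.
pose g := (EFin \o f) \_ (@orthant R k).
have mg : measurable_fun setT g.
  by apply/(measurable_restrictT _ mo)/measurable_EFinP.
have g0 x : (0 <= g x)%E.
  by rewrite /g patchE; case: ifPn => // /[!inE] ox; rewrite lee_fin f0.
have [m mE] := with_density_measure (lebesgue_vec R k) mg g0.
rewrite -lawE (@measure_eq_lbox _ _ law m) ?mE//.
- by apply: integral_null_set => //; exact: measurable_funTS.
- by rewrite lawE preimage_setT probability_setT ltry.
move=> z; rewrite lawE mE law_orthant; last exact: measurable_lbox.
rewrite -integral_mkcondr.
have [z0|z0] := pselect (orthant z); last first.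
  rewrite (_ : lbox z `&` _ = set0) ?preimage_set0 ?measure0 ?integral_set0//.
  apply/seteqP; split => // x [xz x0]; apply: z0 => i.
  exact: lt_le_trans (x0 i) (xz i).
rewrite -law_orthant; last exact: measurable_lbox.
rewrite -joint_cdfE Ff//.
have ob : obox z `<=` lbox z `&` @orthant R k.
  by move=> x xz; split => i; have /andP[? /ltW] := xz i.
rewrite -[in RHS](setDUK ob) ge0_integral_setU//.
- rewrite [X in (_ + X)%E](_ : _ = 0%E) ?adde0//.
  apply: integral_null_set.
  + apply: measurableD; last exact: measurable_obox.
    by apply: measurableI => //; exact: measurable_lbox.
  + exact: orthant_lbox_boundary.
  + by apply/measurable_EFinP; apply: measurable_funS mf => // x [[]].
- exact: measurable_obox.
- apply: measurableD; last exact: measurable_obox.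
  by apply: measurableI => //; exact: measurable_lbox.
- rewrite setDUK//; apply/measurable_EFinP; exact: measurable_funS mf.
- by rewrite setDUK// => x [_ x0]; rewrite lee_fin f0.
- by rewrite disj_set2E; apply/eqP/seteqP; split => // x [h [_]].
Qed.

(** A null set A of the face of I generates a cylinder C, free in the
    coordinates outside I, which is null in R^k; Z avoids C by its density.
    Where the coordinates in I exceed 1/n, the condition C is not affected by
    [clamp], so [exponent_null_of_law] shows that L does not charge C there;
    and these parts of C cover A. *)
Lemma exponent_face_null f (I : {set 'I_k}) A : cdf_density (joint_cdf Z) f ->
  I != finset.set0 -> measurable A -> A `<=` Eface I -> face_measure R I A = 0%E ->
  L A = 0%E.
Proof.
move=> df I0 mA AI A0; have mo := @measurable_orthant R k.
pose C := (fun x : rvec R k => assemble I x (cvec k 0)) @^-1` A.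
have mC : measurable C.
  by apply: measurable_preimage => //; exact: measurable_assemble.
(* an independent copy equal to 0 has positive mass and assembles points of C into A *)
have C0 : refmeas R k C = 0%E.
  have h := @tuple_measure_assemble_null R k (fun=> @atom_lebesgue R) I A mA
    (etrans (esym (refmeas_Eface mA AI)) A0).
  have m0 : measurable [set cvec k (0 : R)] by exact: measurable_set1_cvec0.
  have : (refmeas R k \x refmeas R k)%E (C `*` [set cvec k (0 : R)]) = 0%E.
    apply: (measure_null_subset _ _ _ h).
    - exact: measurableX.
    - apply: measurable_preimage => //.
      by apply: measurable_assemble; [exact: measurable_fst|exact: measurable_snd].
    - by move=> [x y] [/= Cx ->].
  have -> := product_measure1E (refmeas R k) (refmeas R k) mC m0.
  move/eqP; rewrite mule_eq0 => /orP[/eqP//|/eqP h1]; exfalso.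
  have : (refmeas R k [set cvec k 0%R] = \prod_(i < k) @atom_lebesgue R [set 0%R])%E.
    have <- := @tuple_measure_tbox _ RM R k (fun=> @atom_lebesgue R) (fun=> [set 0]);
      last by move=> i; exact: measurable_set1.
    by rewrite set1_cvec0E.
  rewrite h1 big1 => [/eqP|i _]; first by rewrite eq_sym onee_eq0.
  by rewrite atom_lebesgueE lebesgue_measure_set1 adde0 diracE mem_set.
have PC : P (Z @^-1` C) = 0%E.
  rewrite law_orthant//; apply: (law_null_of_cdf_density df); first exact: measurableI.
  rewrite refmeas_orthant//.
    apply: (measure_null_subset _ mC _ C0); first exact: measurableI.
    exact: subIsetl.
  exact: measurableI.
(* where [clamp] at level 1/(n + 1) does not affect the coordinates in I *)
pose U n : set (rvec R k) := [set x | forall i, i \in I -> n.+1%:R^-1 < entry x i].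
have mU n : measurable (U n).
  rewrite (_ : U n = tbox (fun i => if i \in I then `]n.+1%:R^-1, +oo[%classic
      else setT : set RM)).
    by apply: measurable_tbox => i; case: ifP.
  apply/seteqP; split => x h i; have := h i; case: ifP => //.
    by move=> _ /(_ isT); rewrite /= in_itv/= andbT.
  by rewrite /= in_itv/= andbT.
have mfr n : measurable (@far R k n.+1%:R^-1) by exact: measurable_far.
apply: (@measure_null_bigcup _ _ _ _ _ (fun n => (C `&` U n) `&` @far R k n.+1%:R^-1)) => //.
- by move=> n; apply: measurableI => //; exact: measurableI.
- move=> n; apply: (exponent_null_of_law Zms LV (e := n.+1%:R^-1)) => //.
  + exact: measurableI.
  + move=> x.
    have key : U n (clamp n.+1%:R^-1 x) <-> U n x.
      split=> h i Ii; have := h i Ii; rewrite entry_clamp lt_max ltxx orbF//.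
    have keyC : U n x -> (C (clamp n.+1%:R^-1 x) <-> C x).
      move=> Ux; rewrite /C/= (_ : assemble I (clamp _ x) _ = assemble I x (cvec k 0))//.
      apply: rvecP => i; rewrite !entry_assemble entry_clamp; case: ifP => // Ii.
      by rewrite max_l// ltW//; exact: Ux.
    split=> -[Cx Ux].
      by have Ux' := key.1 Ux; split => //; apply/(keyC Ux').
    by split; [apply/(keyC Ux)|apply/key].
  + apply: (measure_null_subset _ _ _ PC).
    * by apply: measurable_RV_preimage; exact: measurableI.
    * exact: measurable_RV_preimage.
    * by move=> x [].
move=> x Ax; have Ix := AI _ Ax.
have /choice[g hg] : forall i, exists n : nat, i \in I -> n.+1%:R^-1 < entry x i.
  move=> i; case: (boolP (i \in I)) => Ii; last by exists 0%N.
  have xi : 0 < entry x i by have := Ix i; rewrite Ii.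
  by have [n hn] := exists_lt_invS xi; exists n.
have Ux : U (\max_i g i)%N x.
  move=> i Ii; apply: le_lt_trans (hg i Ii).
  by rewrite lef_pV2 ?posrE// ler_nat ltnS; exact: leq_bigmax.
exists (\max_i g i)%N => //; split; first split => //.
  rewrite /C/= (_ : assemble _ _ _ = x)//; apply: rvecP => i.
  by rewrite entry_assemble entry_cvec; have := Ix i; case: ifP => // _ /eqP ->.
split; first exact: Eface_Espace Ix.
move=> /(_ _)h; have /set0Pn[i Ii] := I0; have := h i; rewrite entry_cvec.
by move=> /andP[_]; rewrite leNgt (Ux i Ii).
Qed.

(** Beyond norm 1 the exponent measure is finite and, by [exponent_face_null],
    absolutely continuous on each face, so that Radon-Nikodym densities exist
    there, which is what [angular_density_of_far] asks for. *)
Lemma angular_density_of_cdf f : (0 < k)%N -> cdf_density (joint_cdf Z) f ->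
  exists h, angular_density H h.
Proof.
move=> k0 df.
pose D := cone 1 (@simplex R k).
have mD : measurable D by exact: (measurable_cone _ (@measurable_simplex R k)).
have Doo I : (L (D `&` Eface I) < +oo)%E.
  apply: (@le_lt_trans _ _ (L D)).
    apply: le_measure; rewrite ?inE//.
    by apply: measurableI => //; exact: measurable_Eface.
  by apply: (exponent_cone_lty LH) => //; exact: measurable_simplex.
have mDI I : measurable (D `&` Eface I).
  by apply: measurableI => //; exact: measurable_Eface.
have /choice[g hg] : forall I : {set 'I_k}, exists g : rvec R k -> \bar R,
    I != finset.set0 -> [/\ forall x, (0 <= g x)%E, forall x, g x \is a fin_num,
      measurable_fun setT g &
      forall A, measurable A -> L (A `&` (D `&` Eface I)) =
        (\int[face_measure R I]_(x in A) g x)%E].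
  move=> I; have [->|I0] := eqVneq I finset.set0.
    by exists (cst 0%E).
  have dom : mfrestr (mDI I) (Doo I) `<< face_measure R I.
    apply/null_content_dominatesP => A mA A0.
    apply: (exponent_face_null df I0).
    - exact: measurableI.
    - by move=> x [_ []].
    - apply: (measure_null_subset _ mA _ A0); first exact: measurableI.
      exact: subIsetl.
  have [g [g0 gfin gint hg]] := radon_nikodym_sigma_finite dom.
  exists g => _; split => //; exact: measurable_int gint.
apply: (angular_density_of_far LH (lam := fun I z => fine (g I z)) k0).
- move=> I I0; have [g0 gfin mg _] := hg I I0.
  by apply: measurable_funTS; exact: measurableT_comp.
- by move=> I I0 z _; have [g0 gfin mg _] := hg I I0; exact: fine_ge0.
move=> A mA AD.
rewrite (@measure_fin_partition _ _ _ L _ (fun I : {set 'I_k} => I != finset.set0)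
  (fun I => Eface I) A mA).
- apply: eq_bigr => I I0; have [g0 gfin mg gE] := hg I I0.
  under eq_integral do rewrite fineK//.
  rewrite -gE; last by apply: measurableI => //; exact: measurable_Eface.
  by congr (L _); apply/seteqP; split => x; [move=> [/[dup] Ax /AD Dx Ix]|move=> [[Ax Ix] _]].
- by move=> I; exact: measurable_Eface.
- move=> x /AD [[x0 [i xi]] _ _].
  exists [set i | entry x i != 0]%SET.
    by apply/set0Pn; exists i; rewrite inE.
  move=> j; rewrite inE; case: ifPn => [|/negPn//].
  by rewrite lt_neqAle eq_sym => -> /=; exact: x0.
- by move=> x I J; exact: Eface_inj.
Qed.

End absolute_continuity.

(** * Integrals of a density over part of the coordinates *)

Section partial_integrals.
Context (R : realType) (k : nat).
Local Notation RM := (measurableTypeR R).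
Local Notation mu := (@lebesgue_measure R).
Implicit Types (z u y b : rvec R k) (I S : {set 'I_k}).
Context (l : rvec R k -> \bar R).
Hypotheses (ml : measurable_fun setT l) (l0 : forall z, (0 <= l z)%E).

Definition off_factor S (i : 'I_k) : {sigma_finite_measure set RM -> \bar R} :=
  if i \in S then \d_ ((0 : R) : RM) : {sigma_finite_measure set RM -> \bar R}
  else @atom_lebesgue R.

(** As in [partial_integral], the coordinates in S of the variable of
    integration carry a Dirac mass and are replaced by those of z. *)
Definition off_measure S : {sigma_finite_measure set (rvec R k) -> \bar R} :=
  tuple_measure (off_factor S).

Definition off_box S z : set (rvec R k) :=
  [set u | forall i, i \notin S -> 0 <= entry u i < entry z i].

(** The candidate for the partial derivative of the integral of [l] along the
    coordinates in S. *)
Definition pint S z : \bar R :=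
  (\int[off_measure S]_(u in off_box S z) l (assemble S z u))%E.

Lemma measurable_off_box S z : measurable (off_box S z).
Proof.
rewrite (_ : off_box S z = tbox (fun i => if i \in S then setT
    else `[0, entry z i[%classic : set RM)).
  by apply: measurable_tbox => i; case: ifP.
apply/seteqP; split => u h i; have := h i; case: ifP => //=.
by move=> _ /(_ isT); rewrite in_itv/=.
Qed.

Lemma measurable_assemble_fixed S z : measurable_fun setT (assemble S z : rvec R k -> rvec R k).
Proof. exact: measurable_assemble. Qed.

Lemma pint_ge0 S z : (0 <= pint S z)%E.
Proof. exact: integral_ge0. Qed.

Lemma pint_patch S z :
  pint S z = (\int[off_measure S]_u ((fun u => l (assemble S z u)) \_ (off_box S z)) u)%E.
Proof. by rewrite /pint integral_mkcond. Qed.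

Lemma measurable_pint S : measurable_fun setT (pint S).
Proof.
pose D : set (rvec R k * rvec R k) :=
  [set p | forall i, i \notin S -> 0 <= entry p.2 i < entry p.1 i].
have mD : measurable D.
  rewrite (_ : D = \bigcap_(i in [set: 'I_k]) [set p | i \notin S ->
      0 <= entry p.2 i < entry p.1 i]); last first.
    by apply/seteqP; split => [p h i _|p h i]; [exact: h|exact: (h i I)].
  apply: fin_bigcap_measurable => // i _.
  case: (boolP (i \in S)) => iS.
    by rewrite (_ : mkset _ = setT)//; apply/seteqP; split.
  have m1 : measurable_fun setT (fun p : rvec R k * rvec R k => entry p.1 i).
    by apply: measurable_entry_comp; exact: measurable_fst.
  have m2 : measurable_fun setT (fun p : rvec R k * rvec R k => entry p.2 i).
    by apply: measurable_entry_comp; exact: measurable_snd.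
  rewrite (_ : mkset _ = (fun p : rvec R k * rvec R k =>
      (0 <= entry p.2 i) && (entry p.2 i < entry p.1 i)) @^-1` [set true]).
    apply: measurable_preimage => //; apply: measurable_and.
      exact: measurable_fun_ler.
    exact: measurable_fun_ltr.
  by apply/seteqP; split => p /=; [exact|move=> h _].
pose G := (fun p : rvec R k * rvec R k => l (assemble S p.1 p.2)) \_ D.
have mG : measurable_fun setT G.
  apply/(measurable_restrictT _ mD); apply: measurable_funTS.
  apply: (measurableT_comp ml).
  by apply: measurable_assemble; [exact: measurable_fst|exact: measurable_snd].
rewrite (_ : pint S = fun z => \int[off_measure S]_u G (z, u))%E.
  apply: (@measurable_fun_fubini_tonelli_F _ _ _ _ _ (off_measure S) G) => // p.
  by rewrite /G patchE; case: ifP.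
by apply/funext => z; rewrite pint_patch.
Qed.

Lemma off_box_le S y z : (forall j, j \notin S -> entry y j <= entry z j) ->
  off_box S y `<=` off_box S z.
Proof. by move=> yz u h i iS; have /andP[-> /lt_le_trans] := h i iS; apply; exact: yz. Qed.

Lemma assemble_eq S y z u : (forall j, j \in S -> entry y j = entry z j) ->
  assemble S y u = assemble S z u.
Proof.
by move=> yz; apply: rvecP => j; rewrite !entry_assemble; case: ifP => // /yz.
Qed.

Lemma pint_le S y z : (forall j, j \in S -> entry y j = entry z j) ->
  (forall j, j \notin S -> entry y j <= entry z j) -> (pint S y <= pint S z)%E.
Proof.
move=> yz ylez; rewrite /pint.
under eq_integral do rewrite (assemble_eq _ yz).
apply: ge0_subset_integral => //; last exact: off_box_le.
- exact: measurable_off_box.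
- exact: measurable_off_box.
- apply: measurable_funTS; apply: (measurableT_comp ml).
  exact: measurable_assemble_fixed.
Qed.

(** Fubini in the coordinate i, whose range in the box is [0, t). *)
Lemma pint_disint S i z t : i \notin S ->
  pint S (upd z i t) =
  (\int[@atom_lebesgue R]_(x in `[0%R, t[) pint (i |: S)%SET (upd z i x))%E.
Proof.
move=> iS; rewrite pint_patch.
rewrite (@ge0_integral_disintr _ _ (off_factor S) (off_factor (i |: S)%SET) i); last first.
- by move=> u; rewrite patchE; case: ifP.
- apply/(measurable_restrictT _ (measurable_off_box _ _)); apply: measurable_funTS.
  by apply: (measurableT_comp ml); exact: measurable_assemble_fixed.
- by rewrite /off_factor setU11; exact: diracT.
- by move=> j ji; rewrite /off_factor in_setU1 (negbTE ji).
rewrite [RHS]integral_mkcond /off_factor (negbTE iS).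
apply: eq_integral => x _; rewrite patchE mem_setE in_itv/=.
case: ifPn => xt.
  rewrite pint_patch; apply: eq_integral => u _; rewrite !patchE.
  have -> : assemble S (upd z i t) (upd u i x) = assemble (i |: S)%SET (upd z i x) u.
    apply: rvecP => j; rewrite !entry_assemble !entry_upd in_setU1.
    by case: eqP => [->|]; rewrite ?(negbTE iS).
  congr (if _ then _ else _); apply/idP/idP; rewrite !inE => h j.
    rewrite in_setU1 negb_or => /andP[ji jS]; have := h j jS.
    by rewrite !entry_upd (negbTE ji).
  move=> jS; rewrite !entry_upd; case: eqP => // /eqP ji.
  by have := h j; rewrite in_setU1 negb_or ji jS entry_upd (negbTE ji); apply.
apply: integral0_eq => u _; rewrite patchE memNset// => /(_ i iS).
by rewrite !entry_upd eqxx; apply/negP.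
Qed.

Lemma measurable_pint_upd S i z : measurable_fun setT (fun x : R => pint S (upd z i x)).
Proof.
apply: (measurableT_comp (measurable_pint S)).
by apply: measurable_upd => //; exact: measurable_id.
Qed.

(** The lower bound c is positive, so the mass at 0 does not contribute and
    Lebesgue measure remains. *)
Lemma pint_increment S i z c t : i \notin S -> 0 < c -> c <= t ->
  (pint S (upd z i t) = pint S (upd z i c) +
   \int[mu]_(x in `[c, t[) pint (i |: S)%SET (upd z i x))%E.
Proof.
move=> iS c0 ct; rewrite !pint_disint//.
have -> : `[0, t[%classic = `[0, c[%classic `|` `[c, t[%classic :> set RM.
  by rewrite -itv_bndbnd_setU// bnd_simp ltW.
rewrite ge0_integral_setU//.
- congr (_ + _)%E; apply: eq_measure_integral => A mA Act.
  apply: lebesgue_set1N => // x /Act /=; rewrite !in_itv/= andbT => /andP[cx _].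
  exact: lt_le_trans cx.
- by apply: measurable_funTS; exact: measurable_pint_upd.
- by move=> x _; exact: pint_ge0.
- rewrite disj_set2E; apply/eqP/seteqP; split => // x /=; rewrite !in_itv/=.
  by move=> [/andP[_ xc] /andP[+ _]]; rewrite leNgt xc.
Qed.

Definition slab i z (c t : R) : set (rvec R k) :=
  [set u | forall j, if j == i then c <= entry u j < t else 0 <= entry u j < entry z j].

Lemma measurable_slab i z c t : measurable (slab i z c t).
Proof.
rewrite (_ : slab i z c t = tbox (fun j => if j == i then `[c, t[%classic
    else `[0, entry z j[%classic : set RM)).
  by apply: measurable_tbox => j; case: ifP.
by apply/seteqP; split => u h j; have := h j; case: ifP => //= _; rewrite in_itv.
Qed.

Lemma slab_integral i z c t : 0 < c ->
  (\int[refmeas R k]_(u in slab i z c t) l u =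
   \int[mu]_(x in `[c, t[) pint [set i]%SET (upd z i x))%E.
Proof.
move=> c0; rewrite integral_mkcond.
rewrite (@ge0_integral_disintr _ _ (fun=> @atom_lebesgue R) (off_factor [set i]%SET) i);
  last first.
- by move=> u; rewrite patchE; case: ifP.
- by apply/(measurable_restrictT _ (measurable_slab _ _ _ _)); exact: measurable_funTS.
- by rewrite /off_factor set11; exact: diracT.
- by move=> j ji; rewrite /off_factor finset.in_set1 (negbTE ji).
transitivity (\int[@atom_lebesgue R]_(x in `[c, t[) pint [set i]%SET (upd z i x))%E; last first.
  apply: eq_measure_integral => A mA Act.
  apply: lebesgue_set1N => // x /Act /=; rewrite !in_itv/= andbT => /andP[cx _].
  exact: lt_le_trans cx.
rewrite [RHS]integral_mkcond; apply: eq_integral => x _; rewrite patchE mem_setE in_itv/=.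
case: ifPn => xt.
  rewrite pint_patch; apply: eq_integral => u _; rewrite !patchE.
  have -> : assemble [set i]%SET (upd z i x) u = upd u i x.
    apply: rvecP => j; rewrite !entry_assemble !entry_upd finset.in_set1.
    by case: eqP.
  congr (if _ then _ else _); apply/idP/idP; rewrite !inE => h j.
    rewrite finset.in_set1 => ji; have := h j.
    by rewrite !entry_upd (negbTE ji).
  rewrite !entry_upd; case: eqP => // /eqP ji.
  by have := h j; rewrite finset.in_set1 ji entry_upd (negbTE ji); apply.
apply: integral0_eq => u _; rewrite patchE memNset// => /(_ i).
by rewrite eqxx !entry_upd eqxx; apply/negP.
Qed.

Lemma off_hyperplane S i (c : R) : i \notin S -> 0 < c ->
  off_measure S [set u | entry u i = c] = 0%E.
Proof.
move=> iS c0; apply: tuple_measure_hyperplane; rewrite /off_factor (negbTE iS).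
rewrite [LHS]atom_lebesgueE lebesgue_measure_set1 adde0 diracE memNset//.
by move=> /= h; rewrite h ltxx in c0.
Qed.

(** The boundary of the box is null, as its sides are at positive coordinates
    where the reference measure has no atom; so the indicators of the boxes
    converge almost everywhere, dominated by the box at B. *)
Lemma pint_cvg S z (b : nat -> rvec R k) B :
  orthant z -> (pint S B < +oo)%E ->
  (forall j, j \in S -> entry B j = entry z j) ->
  (forall n j, j \in S -> entry (b n) j = entry z j) ->
  (forall n j, j \notin S -> entry (b n) j <= entry B j) ->
  (forall j, j \notin S -> entry (b n) j @[n --> \oo] --> entry z j) ->
  pint S (b n) @[n --> \oo] --> pint S z.
Proof.
move=> z0 Boo BS bS bB bz.
pose h u := l (assemble S z u).
have mh : measurable_fun setT h.
  by apply: (measurableT_comp ml); exact: measurable_assemble_fixed.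
have pE y : (forall j, j \in S -> entry y j = entry z j) ->
    pint S y = (\int[off_measure S]_u (h \_ (off_box S y)) u)%E.
  move=> yS; rewrite /pint; under eq_integral do rewrite (assemble_eq _ yS).
  by rewrite integral_mkcond.
rewrite (pE z)//; under eq_fun do rewrite (pE _ (bS _)).
have mhp y : measurable_fun setT (h \_ (off_box S y)).
  apply/(measurable_restrictT _ (measurable_off_box _ _)); exact: measurable_funTS.
have hp0 y u : (0 <= (h \_ (off_box S y)) u)%E by rewrite patchE; case: ifP => // _; exact: l0.
have [] // := @dominated_convergence _ _ _ (off_measure S) setT measurableT
  (fun n => h \_ (off_box S (b n))) (h \_ (off_box S z)) (h \_ (off_box S B)).
- pose F (j : 'I_k) : set (rvec R k) :=
    if j \notin S then [set u | entry u j = entry z j] else set0.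
  have mF j : measurable (F j).
    by rewrite /F; case: ifP => // _; exact: measurable_hyperplane.
  pose N := \big[setU/set0]_(j | j \notin S) [set u : rvec R k | entry u j = entry z j].
  have mN : measurable N by apply: bigsetU_measurable => j _; exact: measurable_hyperplane.
  have NF u : N u -> exists j, F j u.
    rewrite /N; elim/big_ind : _ => [//|A A' hA hA' [/hA|/hA']//|j jS uj].
    by exists j; rewrite /F jS.
  have N0 : off_measure S N = 0%E.
    apply/eqP; rewrite eq_le measure_ge0 andbT.
    apply: le_trans (measure_fin_cover (off_measure S) mN mF NF) _.
    rewrite big1// => j _; rewrite /F; case: ifPn => [jS|_]; last by rewrite measure0.
    exact: off_hyperplane.
  exists N; split => //.
  move=> u /= hu; apply: contrapT => Nu; apply: hu => _.
  have une j : j \notin S -> entry u j != entry z j.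
    move=> jS; apply/eqP => uz; by apply: Nu; rewrite /N (bigD1 j)//=; left.
  have [uz|uz] := pselect (off_box S z u).
    rewrite patchE mem_set//.
    have near_in : \forall n \near \oo, off_box S (b n) u.
      have : \forall n \near \oo, forall j, j \notin S -> entry u j < entry (b n) j.
        apply: filter_forall => j; case: (boolP (j \in S)) => jS; first exact: nearW.
        have /andP[_ uj] := uz j jS.
        have h1 : \forall t \near \oo, entry u j < entry (b t) j.
          exact: (cvgr_gt _ (bz j jS)).
        by apply: filterS h1 => n hn _.
      by apply: filterS => n hn j jS; have /andP[-> _] := uz j jS; exact: hn.
    apply: cvg_near_cst; apply: filterS near_in => n hn.
    by rewrite patchE mem_set.
  rewrite patchE memNset//.
  have near_out : \forall n \near \oo, ~ off_box S (b n) u.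
    move/existsNP : uz => [j /not_implyP[jS /negP]].
    rewrite negb_and -ltNge -leNgt => /orP[uj|uj].
      by apply: nearW => n /(_ j jS); rewrite leNgt uj.
    have {}uj : entry z j < entry u j by rewrite lt_neqAle eq_sym une.
    have h1 : \forall t \near \oo, entry (b t) j < entry u j.
      exact: (cvgr_lt _ (bz j jS)).
    apply: filterS h1 => n hn /(_ j jS) /andP[_].
    by rewrite ltNge (ltW hn).
  apply: cvg_near_cst; apply: filterS near_out => n hn.
  by rewrite patchE memNset.
- apply/integrableP; split => //; under eq_integral do rewrite gee0_abs//.
  by rewrite -pE.
- apply: aeW => u n _; rewrite gee0_abs// !patchE.
  case: ifPn => [|_]; last by case: ifP => // _; exact: l0.
  by rewrite inE => ub; rewrite mem_set//; apply: off_box_le ub; exact: bB.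
Qed.

End partial_integrals.

(** * Lebesgue differentiation as growth rates of windows *)

Section rates.
Context (R : realType).
Local Notation mu := (@lebesgue_measure R).

(** A one-sided derivative for a quantity given directly as a function of the
    increment, possibly infinite for large increments. *)
Definition rate (D : R -> \bar R) (g : R) := forall e, 0 < e ->
  exists2 d, 0 < d & forall h, 0 < h -> h < d ->
    ((h * (g - e))%:E <= D h /\ D h <= (h * (g + e))%:E)%E.

(** Restricting to rational increments makes this a measurable condition on a
    parameter of D, see [measurable_rateQ]. *)
Definition rateQ (D : R -> \bar R) (g : \bar R) := forall n : nat, exists m : nat,
  forall q : rat, 0 < ratr q :> R -> ratr q < m.+1%:R^-1 :> R ->
    ((ratr q)%:E * g <= D (ratr q) + (ratr q / n.+1%:R)%:E /\
     D (ratr q) <= (ratr q)%:E * g + (ratr q / n.+1%:R)%:E)%E.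

Lemma rate_rateQ D g : rate D g -> rateQ D g%:E.
Proof.
move=> h n; have [d d0 hd] := h (n.+1%:R^-1) ltac:(by rewrite invr_gt0).
have [m hm] := exists_lt_invS d0; exists m => q q0 qm.
have [h1 h2] := hd _ q0 (lt_trans qm hm); split.
  apply: (@le_trans _ _ ((ratr q * (g - n.+1%:R^-1))%:E + (ratr q / n.+1%:R)%:E)%E).
    by rewrite -EFinM -EFinD lee_fin mulrBr subrK.
  exact: leeD.
by apply: le_trans h2 _; rewrite -EFinM -EFinD lee_fin mulrDr.
Qed.

(** Rational increments near h control D h because D is monotone in h; the
    comparison functions D1 and D2 only need to have growth rates close to g. *)
Lemma rate_squeeze D g :
  (forall h h', 0 < h -> h <= h' -> (D h <= D h')%E) -> 0 <= g ->
  (forall h, 0 < h -> (0 <= D h)%E) ->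
  (forall e, 0 < e -> exists D1 g1 D2 g2, [/\ rateQ D1 g1%:E, rateQ D2 g2%:E,
    forall h, 0 < h -> (D1 h <= D h /\ D h <= D2 h)%E, g - e <= g1 & g2 <= g + e]) ->
  rate D g.
Proof.
move=> Dmon g0 D0 H e e0.
(* so that (1 + eta) (g + 2 eta) <= g + e and (1 - eta) (g - 2 eta) >= g - e *)
pose eta := Num.min 1 (e / (g + 4)).
have g4 : 0 < g + 4 by rewrite ltr_wpDl.
have eta0 : 0 < eta by rewrite lt_min ltr01 divr_gt0.
have eta1 : eta <= 1 by rewrite ge_min lexx.
have etae : eta * (g + 4) <= e by rewrite -ler_pdivlMr// ge_min lexx orbT.
clearbody eta.
have [D1 [g1 [D2 [g2 [r1 r2 D12 gg1 gg2]]]]] := H _ eta0.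
have [n hn] := exists_lt_invS eta0.
have [m1 hm1] := r1 n; have [m2 hm2] := r2 n.
pose d := Num.min (m1.+1%:R^-1) (m2.+1%:R^-1 / 2) : R.
have d0 : 0 < d by rewrite lt_min invr_gt0 ltr0n divr_gt0// invr_gt0 ltr0n.
exists d => // h h0 hd.
have hd1 : h < m1.+1%:R^-1 by apply: lt_le_trans hd _; rewrite ge_min lexx.
have hd2 : h * 2 < m2.+1%:R^-1.
  by rewrite -ltr_pdivlMr//; apply: lt_le_trans hd _; rewrite ge_min lexx orbT.
split.
  have lt1 : h * (1 - eta) < h by rewrite gtr_pMr// ltrBlDr ltrDl.
  have [q] := rat_in_itvoo lt1; rewrite in_itv/= => /andP[hq qh].
  have q0 : 0 < ratr q :> R.
    by apply: le_lt_trans hq; rewrite mulr_ge0 ?subr_ge0// ltW.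
  have [A _] := hm1 q q0 (lt_trans qh hd1).
  have [B _] := D12 _ q0.
  have C : (D (ratr q) <= D h)%E by apply: Dmon => //; exact: ltW.
  have E : ((ratr q * (g - 2 * eta))%:E <= D h)%E.
    apply: le_trans C; apply: le_trans B.
    rewrite -(@leeD2rE _ ((ratr q / n.+1%:R)%:E))//.
    apply: le_trans A; rewrite -EFinM -EFinD lee_fin -mulrDr ler_pM2l//.
    by move: gg1 hn; move: (n.+1%:R^-1 : R) => a; lra.
  have [neg|pos] := ltP (g - 2 * eta) 0.
    apply: le_trans (D0 _ h0); rewrite lee_fin.
    rewrite pmulr_rle0//; move: etae; have : 0 <= eta * g by rewrite mulr_ge0// ltW.
    by have : 0 < eta := eta0; lra.
  apply: le_trans E; rewrite lee_fin.
  apply: (@le_trans _ _ (h * (1 - eta) * (g - 2 * eta))); last first.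
    by rewrite ler_wpM2r// ltW.
  rewrite -mulrA ler_pM2l//.
  have : 0 <= eta * eta by rewrite mulr_ge0// ltW.
  have : 0 <= eta * g by rewrite mulr_ge0// ltW.
  by move: etae eta0; rewrite mulrDr; nra.
have lt1 : h < h * (1 + eta) by rewrite ltr_pMr// ltrDl.
have [q] := rat_in_itvoo lt1; rewrite in_itv/= => /andP[hq qh].
have q0 : 0 < ratr q :> R by apply: lt_trans hq.
have qm : ratr q < m2.+1%:R^-1 :> R.
  apply: lt_trans qh _; apply: le_lt_trans hd2; rewrite ler_pM2l//.
  by move: eta1; lra.
have [_ A] := hm2 q q0 qm.
have [_ B] := D12 _ q0.
have C : (D h <= D (ratr q))%E by apply: Dmon => //; exact: ltW.
apply: le_trans C _; apply: le_trans B _; apply: le_trans A _.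
rewrite -EFinM -EFinD lee_fin -mulrDr.
apply: (@le_trans _ _ (ratr q * (g + 2 * eta))).
  by rewrite ler_pM2l//; move: gg2 hn; move: (n.+1%:R^-1 : R) => a; lra.
apply: (@le_trans _ _ (h * (1 + eta) * (g + 2 * eta))).
  by rewrite ler_wpM2r ?addr_ge0 ?mulr_ge0// ltW.
rewrite -mulrA ler_pM2l//.
have : eta * eta <= eta by rewrite ger_pMl.
have : 0 <= eta * g by rewrite mulr_ge0// ltW.
by move: etae eta0; rewrite mulrDr; nra.
Qed.

(** The bridge to derivatives: a derivative is the common rate of the
    increments to the right and to the left. *)
Lemma is_derive_rate (F : R -> R) (x v : R) :
  is_derive x 1 F v <->
  rate (fun h => (F (x + h) - F x)%:E) v /\ rate (fun h => (F x - F (x - h))%:E) v.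
Proof.
split=> [dF|[rr rl]].
  have [dF1 dF2] := dF.
  have cv : h^-1 *: (F (h + x) - F x) @[h --> 0^'] --> v.
    rewrite -dF2 /derive; move: dF1; rewrite /derivable => /cvg_ex [w hw].
    have := hw; rewrite (cvg_lim _ hw)//.
    by under eq_fun do rewrite /= [_%:A]mulr1.
  have key e : 0 < e -> exists2 d, 0 < d & forall h, `|h| < d -> h != 0 ->
      `|F (h + x) - F x - h * v| <= `|h| * e.
    move=> e0; move/cvgrPdist_le : (cv) => /(_ _ e0).
    rewrite near_withinE => -/nbhs_ballP [d d0 hd]; exists d => // h hd' h0.
    have := hd h; rewrite /ball/= sub0r normrN => /(_ hd' h0).
    rewrite /GRing.scale/= => hh.
    have -> : F (h + x) - F x - h * v = - h * (v - h^-1 * (F (h + x) - F x)).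
      by rewrite mulrBr mulNr mulNr mulrA divff// mul1r; ring.
    by rewrite normrM normrN ler_pM2l// normr_gt0.
  split=> e e0; have [d d0 hd] := key e e0; exists d => // h h0 hd'.
    have := hd h; rewrite gtr0_norm// gt_eqF// => /(_ hd' isT).
    rewrite ler_norml addrC => /andP[h1 h2]; rewrite !lee_fin (addrC x).
    by split; rewrite ?mulrBr ?mulrDr; lra.
  have := hd (- h); rewrite normrN gtr0_norm// oppr_eq0 gt_eqF// => /(_ hd' isT).
  rewrite ler_norml addrC => /andP[h1 h2]; rewrite !lee_fin.
  by move: h1 h2; rewrite (addrC (- h)) => h1 h2; split; rewrite ?mulrBr ?mulrDr; lra.
have cv : h^-1 *: (F (h + x) - F x) @[h --> 0^'] --> v.
  apply/cvgrPdist_le => e e0; rewrite near_withinE; apply/nbhs_ballP.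
  have [d1 d10 h1] := rr e e0; have [d2 d20 h2] := rl e e0.
  exists (Num.min d1 d2); first by rewrite /= lt_min d10.
  move=> h; rewrite /ball/= sub0r normrN lt_min => /andP[hd1 hd2] h0.
  rewrite -(ler_pM2l (_ : 0 < `|h|)) ?normr_gt0// -normrM mulrBr.
  rewrite /GRing.scale/= mulrA divff// mul1r.
  have [hn|hp|h00] := ltgtP h 0; last by rewrite h00 eqxx in h0.
    have nh0 : 0 < - h by rewrite oppr_gt0.
    have := h2 (- h) nh0; rewrite ltr0_norm// in hd2 *; move=> /(_ hd2).
    rewrite !lee_fin opprK (addrC x) ler_norml => -[A B].
    by apply/andP; split; move: A B; rewrite mulrBr mulrDr !mulNr; lra.
  have := h1 h hp; rewrite gtr0_norm// in hd1 *; move=> /(_ hd1).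
  rewrite !lee_fin (addrC x) ler_norml => -[A B].
  by apply/andP; split; move: A B; rewrite mulrBr mulrDr; lra.
have cv' : h^-1 *: ((F \o shift x) (h *: 1) - F x) @[h --> 0^'] --> v.
  by under eq_fun do rewrite /= [_%:A]mulr1.
apply: DeriveDef; first by apply/cvg_ex; exists v.
exact: cvg_lim cv'.
Qed.

(** Lebesgue's differentiation theorem. It is applied on the compact intervals
    from 1/n to n, where g is integrable. *)
Lemma rate_ae (g : R -> \bar R) : measurable_fun setT g -> (forall x, (0 <= g x)%E) ->
  (forall c t, 0 < c -> (\int[mu]_(x in `[c, t[) g x < +oo)%E) ->
  {ae mu, forall t, 0 < t -> [/\ (g t < +oo)%E,
    rate (fun h => \int[mu]_(x in `[t, (t + h)%R[) g x)%E (fine (g t)) &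
    rate (fun h => \int[mu]_(x in `[(t - h)%R, t[) g x)%E (fine (g t))]}.
Proof.
move=> mg g0 goo.
pose J n : set (measurableTypeR R) := `[n.+1%:R^-1, n.+1%:R]%classic.
have mJ n : measurable (J n) by exact: measurable_itv.
have Joo n : (\int[mu]_(x in J n) g x < +oo)%E.
  rewrite -(integral_itv_bndo_bndc); last by apply: measurable_funTS.
  exact: goo.
have step n : {ae mu, forall t, n.+1%:R^-1 < t -> t < n.+1%:R -> [/\ (g t < +oo)%E,
    rate (fun h => \int[mu]_(x in `[t, (t + h)%R[) g x)%E (fine (g t)) &
    rate (fun h => \int[mu]_(x in `[(t - h)%R, t[) g x)%E (fine (g t))]}.
  have int : mu.-integrable (J n) g.
    apply/integrableP; split; first exact: measurable_funTS.
    by under eq_integral do rewrite gee0_abs//.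
  pose f := (fine \o g) \_ (J n).
  have gf : {ae mu, forall x, J n x -> (f x)%:E = g x}.
    have := integrable_ae (mJ n) int; apply: filterS => x hx Jx.
    by rewrite /f patchE mem_set//= fineK// hx.
  have mf : measurable_fun setT f.
    by apply/(measurable_restrictT _ (mJ n)); apply: measurable_funTS; exact: measurableT_comp.
  have f0 x : 0 <= f x by rewrite /f patchE; case: ifP => // _; exact: fine_ge0.
  have intf : mu.-integrable setT (EFin \o f).
    apply/integrableP; split; first exact/measurable_EFinP.
    under eq_integral do rewrite /= ger0_norm//.
    rewrite (_ : (fun x => (f x)%:E) = (EFin \o fine \o g) \_ (J n)); last first.
      by apply/funext => x; rewrite /f !patchE; case: ifP.
    rewrite -integral_mkcond; apply: le_lt_trans (Joo n).
    rewrite le_eqVlt; apply/orP; left; apply/eqP; apply: ae_eq_integral => //.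
    - by apply/measurable_EFinP; apply: measurable_funTS; exact: measurableT_comp.
    - exact: measurable_funTS.
    - have := integrable_ae (mJ n) int; apply: filterS => x hx Jx.
      by rewrite /= fineK// hx.
  have intfS (A : set R) : measurable A -> mu.-integrable A (EFin \o f).
    by move=> mA; apply: integrableS intf.
  have := @FTC1Ny R f (fun y => intfS _ (measurable_itv `]-oo, y]))
    (@open_integrable_locally R setT f openT intf).
  move=> /= FT; apply: filterS2 FT (gf); first exact: (ae_filter_ringOfSetsType mu).
  move=> t [dF dFt] gft nt tn.
  pose F (y : R) := (\int[mu]_(x in `]-oo, y]) f x)%R.
  have Jt : J n t by rewrite /J/= in_itv/= !ltW.
  have gt : (f t)%:E = g t by exact: gft.
  have Finc x y : n.+1%:R^-1 < x -> x <= y -> y < n.+1%:R ->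
      (\int[mu]_(u in `[x, y[) g u = (F y - F x)%:E)%E.
    move=> nx xy yn.
    have -> : (\int[mu]_(u in `[x, y[) g u = \int[mu]_(u in `]x, y]) (f u)%:E)%E.
      rewrite integral_itv_bndoo; last exact: measurable_funTS.
      rewrite [RHS]integral_itv_bndoo; last by apply/measurable_EFinP/measurable_funTS.
      apply: ae_eq_integral => //.
      - exact: measurable_funTS.
      - by apply/measurable_EFinP/measurable_funTS.
      - apply: filterS (gf) => u hu /=; rewrite in_itv/= => /andP[xu uy]; rewrite hu//.
        by rewrite /J/= in_itv/= (ltW (lt_trans nx xu)) (ltW (lt_trans uy yn)).
    have fin A : measurable A -> (\int[mu]_(u in A) (f u)%:E)%E \is a fin_num.
      by move=> mA; exact: integrable_fin_num (intfS A mA).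
    rewrite /F /Rintegral.
    have -> : (\int[mu]_(u in `]-oo, y]) (f u)%:E = \int[mu]_(u in `]-oo, x]) (f u)%:E +
        \int[mu]_(u in `]x, y]) (f u)%:E)%E.
      rewrite -ge0_integral_setU//.
      - by rewrite -itv_bndbnd_setU// bnd_simp.
      - by apply/measurable_EFinP/measurable_funTS.
      - by move=> u _; rewrite lee_fin.
      - rewrite disj_set2E; apply/eqP/seteqP; split => // u /=; rewrite !in_itv/=.
        by move=> [ux /andP[+ _]]; rewrite ltNge ux.
    by rewrite fineD ?fin// EFinB EFinD !fineK ?fin// addeAC subee ?fin// add0e.
  have gtoo : (g t < +oo)%E by rewrite -gt ltry.
  have ft : fine (g t) = f t by rewrite -gt.
  have isd : is_derive t 1 F (fine (g t)).
    by apply: DeriveDef => //; rewrite ft -dFt derive1E.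
  have [r1 r2] := (is_derive_rate F t (fine (g t))).1 isd.
  split=> // e e0.
    have [d d0 hd] := r1 e e0; exists (Num.min d (n.+1%:R - t)).
      by rewrite lt_min d0 subr_gt0.
    move=> h h0; rewrite lt_min => /andP[h1 h2].
    rewrite Finc//; first exact: hd.
      by rewrite lerDl ltW.
    by rewrite addrC -ltrBrDr.
  have [d d0 hd] := r2 e e0; exists (Num.min d (t - n.+1%:R^-1)).
    by rewrite lt_min d0 subr_gt0.
  move=> h h0; rewrite lt_min => /andP[h1 h2].
  rewrite Finc//; first exact: hd.
    by rewrite ltrBrDr addrC -ltrBrDr.
  by rewrite gerBl ltW.
have := ae_foralln step; apply: filterS => t ht t0.
have [n1 hn1] := exists_lt_invS t0.
pose n := maxn n1 (Num.bound t).
apply: (ht n).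
  apply: le_lt_trans hn1; rewrite lef_pV2 ?posrE// ler_nat ltnS; exact: leq_maxl.
apply: lt_le_trans (archi_boundP (ltW t0)) _; rewrite ler_nat.
by apply: leqW; exact: leq_maxr.
Qed.

End rates.

Section rates_measurable.
Context (R : realType).
Local Notation mu := (@lebesgue_measure R).

Lemma rate_near D D' (g d0 : R) : 0 < d0 ->
  (forall h, 0 < h -> h < d0 -> D h = D' h) -> rate D g -> rate D' g.
Proof.
move=> d00 DD r e e0; have [d dp hd] := r e e0; exists (Num.min d d0).
  by rewrite lt_min dp.
move=> h h0; rewrite lt_min => /andP[h1 h2]; rewrite -DD//; exact: hd.
Qed.

(** The indicator of the window is jointly measurable in the parameter and the
    variable, so this is the measurability part of Fubini's theorem. *)
Lemma measurable_integral_window d (T : measurableType d) (a b : T -> R)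
    (G : T * R -> \bar R) :
  measurable_fun setT a -> measurable_fun setT b -> measurable_fun setT G ->
  (forall p, (0 <= G p)%E) ->
  measurable_fun setT (fun z => \int[mu]_(x in `[a z, b z[) G (z, x))%E.
Proof.
move=> ma mb mG G0.
pose D : set (T * R) := [set p | (a p.1 <= p.2) && (p.2 < b p.1)].
have mD : measurable D.
  rewrite (_ : D = (fun p : T * R => (a p.1 <= p.2) && (p.2 < b p.1)) @^-1` [set true]).
    apply: measurable_preimage => //; apply: measurable_and.
      apply: measurable_fun_ler; last exact: measurable_snd.
      exact: (measurableT_comp ma measurable_fst).
    apply: measurable_fun_ltr; first exact: measurable_snd.
    exact: (measurableT_comp mb measurable_fst).
  by apply/seteqP; split => p.
have mGD : measurable_fun setT (G \_ D).
  by apply/(measurable_restrictT _ mD); exact: measurable_funTS.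
rewrite (_ : (fun z => _) = fun z => \int[mu]_x (G \_ D) (z, x))%E.
  apply: (@measurable_fun_fubini_tonelli_F _ _ _ _ _ mu (G \_ D)) => // p.
  by rewrite patchE; case: ifP.
apply/funext => z; rewrite integral_mkcond; apply: eq_integral => x _.
rewrite !patchE; congr (if _ then _ else _); apply/idP/idP; rewrite !inE/= in_itv/=; exact.
Qed.

Lemma measurable_rateQ d (T : measurableType d) (D : T -> R -> \bar R) (g : T -> \bar R) :
  (forall h, measurable_fun setT (D ^~ h)) -> measurable_fun setT g ->
  measurable [set z | rateQ (D z) (g z)].
Proof.
move=> mD mg.
rewrite (_ : mkset _ = \bigcap_n \bigcup_m \bigcap_i [set z |
   if unpickle i is Some q then
    0 < ratr q :> R -> ratr q < m.+1%:R^-1 :> R ->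
    ((ratr q)%:E * g z <= D z (ratr q) + (ratr q / n.+1%:R)%:E /\
     D z (ratr q) <= (ratr q)%:E * g z + (ratr q / n.+1%:R)%:E)%E
   else True]); last first.
  apply/seteqP; split => z.
    move=> h n _; have [m hm] := h n; exists m => // i _ /=.
    by case: (unpickle i) => // q; exact: hm.
  move=> h n; have [m _ hm] := h n I; exists m => q.
  by move: (hm (pickle q) I); rewrite /mkset pickleK; exact.
apply: bigcapT_measurable => n; apply: bigcupT_measurable => m.
apply: bigcapT_measurable => i; case: (unpickle i) => [q|]; last first.
  by rewrite (_ : mkset _ = setT)//; apply/seteqP; split.
have [/andP[q0 qm]|qn] := boolP ((0 < ratr q :> R) && (ratr q < m.+1%:R^-1 :> R));
    last first.
  rewrite (_ : mkset _ = setT)//; apply/seteqP; split => // z _ /= h1 h2.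
  by rewrite h1 h2 in qn.
rewrite (_ : mkset _ =
  [set z | (ratr q)%:E * g z <= D z (ratr q) + (ratr q / n.+1%:R)%:E]%E `&`
  [set z | D z (ratr q) <= (ratr q)%:E * g z + (ratr q / n.+1%:R)%:E]%E); last first.
  by apply/seteqP; split => z /=; [exact|move=> h _ _].
have mqg : measurable_fun setT (fun z => (ratr q)%:E * g z)%E.
  by apply: emeasurable_funM.
apply: measurableI; rewrite -[X in measurable X]setTI; apply: measurable_lee => //;
  by apply: emeasurable_funD.
Qed.

Lemma dist_le_bounds (a b e : R) : `|a - b| <= e -> a - e <= b /\ b <= a + e.
Proof. by rewrite ler_norml => /andP[h1 h2]; split; lra. Qed.

Lemma rat_approx_gt (y : R) (e : R) : 0 < e ->
  exists q : rat, y < ratr q /\ ratr q < y + e.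
Proof.
move=> e0; have lt1 : y < y + e by rewrite ltrDl.
by have [q] := rat_in_itvoo lt1; rewrite in_itv/= => /andP[]; exists q.
Qed.

Lemma rat_approx_lt (y : R) (e : R) : 0 < e -> 0 < y ->
  exists q : rat, [/\ 0 < ratr q :> R, ratr q < y & y - e < ratr q].
Proof.
move=> e0 y0; have lt1 : Num.max 0 (y - e) < y by rewrite gt_max y0 ltrBlDr ltrDl.
have [q] := rat_in_itvoo lt1; rewrite in_itv/= gt_max => /andP[/andP[q0 qe] qy].
by exists q.
Qed.

End rates_measurable.

(** * Existence of the iterated partial derivatives almost everywhere *)

Section regularity.
Context (R : realType) (k : nat).
Local Notation RM := (measurableTypeR R).
Local Notation mu := (@lebesgue_measure R).
Local Notation leb := (lebesgue_vec R k).
Implicit Types (z u y b : rvec R k) (I S : {set 'I_k}).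
Context (l : rvec R k -> \bar R) (psi : rvec R k -> R).
Hypotheses (ml : measurable_fun setT l) (l0 : forall z, (0 <= l z)%E).
(** [psi] is a primitive of [l] in each variable. Only increments are prescribed,
    since -V is the negative of an integral over an unbounded region. *)
Hypothesis psi_slab : forall i z c t, orthant z -> 0 < c -> c <= t ->
  ((psi (upd z i t) - psi (upd z i c))%:E = \int[refmeas R k]_(u in slab i z c t) l u)%E.

(** The partial derivative of psi along S, in the form in which the induction
    on S produces it: [psi] itself for empty S. *)
Definition psiS S z : R := if S == finset.set0 then psi z else fine (pint l S z).

(** Finiteness on the whole cylinder of points that share the coordinates of z
    in S, since the later derivatives move all the others. *)
Definition finite_partials S z := S != finset.set0 -> forall y, orthant y ->
  (forall j, j \in S -> entry y j = entry z j) -> (pint l S y < +oo)%E.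

Let l0' S z : (0 <= pint l S z)%E.
Proof. exact: pint_ge0. Qed.

Lemma finite_partials_eq S y z : (forall j, j \in S -> entry y j = entry z j) ->
  finite_partials S y -> finite_partials S z.
Proof.
by move=> yz fy S0 w w0 wz; apply: fy => // j jS; rewrite wz// yz.
Qed.

Lemma orthant_upd z i t : orthant z -> 0 < t -> orthant (upd z i t).
Proof. by move=> z0 t0 j; rewrite entry_upd; case: eqP. Qed.

Lemma orthant_assemble S z b : orthant z -> orthant b -> orthant (assemble S z b).
Proof. by move=> z0 b0 j; rewrite entry_assemble; case: ifP. Qed.

(** By Fubini's theorem, psiS along S is a primitive in the i-th coordinate of
    the integrals along S and i. *)
Lemma psiS_increment S i z c t : i \notin S -> orthant z -> 0 < c -> c <= t ->
  finite_partials S z ->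
  ((psiS S (upd z i t) - psiS S (upd z i c))%:E =
   \int[mu]_(x in `[c, t[) pint l (i |: S)%SET (upd z i x))%E.
Proof.
move=> iS z0 c0 ct fz; rewrite /psiS; case: eqVneq => [S0|S0].
  rewrite (psi_slab i z0 c0 ct) (slab_integral ml l0 i z t c0) S0.
  by rewrite finset.setU0.
have t0 : 0 < t by exact: lt_le_trans ct.
have finw s : 0 < s -> pint l S (upd z i s) \is a fin_num.
  move=> s0; rewrite ge0_fin_numE//; apply: fz => //; first exact: orthant_upd.
  by move=> j jS; rewrite entry_upd; case: eqP => // ji; rewrite -ji jS in iS.
rewrite EFinB !fineK ?finw//.
rewrite (pint_increment ml l0 z iS c0 ct) addeAC subee ?finw// add0e//.
Qed.

Lemma pint_window_lty S i z c t : i \notin S -> orthant z -> 0 < c -> finite_partials S z ->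
  (\int[mu]_(x in `[c, t[) pint l (i |: S)%SET (upd z i x) < +oo)%E.
Proof.
move=> iS z0 c0 fz; have [ct|tc] := leP c t.
  by rewrite -psiS_increment// ltry.
by rewrite set_itv_ge ?integral_set0// -leNgt bnd_simp ltW.
Qed.

Definition window_right S i z h : \bar R :=
  (\int[mu]_(x in `[entry z i, (entry z i + h)%R[) pint l S (upd z i x))%E.

Definition window_left S i z h : \bar R :=
  (\int[mu]_(x in `[(entry z i - h)%R, entry z i[) pint l S (upd z i x))%E.

(** At the point whose coordinates in S are those of z and whose others are
    those of b. With b fixed this is a condition on z alone, so that it can
    hold almost everywhere; only countably many b will be used. *)
Definition rates_match S i b z := let w := assemble S z b in
  [/\ (pint l S w < +oo)%E, rateQ (window_right S i w) (pint l S w) &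
      rateQ (window_left S i w) (pint l S w)].

Lemma measurable_rates_match S i b : measurable [set z | rates_match S i b z].
Proof.
have mw : measurable_fun setT (fun z => assemble S z b).
  by apply: measurable_assemble.
have mp := measurable_pint ml l0 S.
have mpw : measurable_fun setT (fun z => pint l S (assemble S z b)).
  exact: measurableT_comp.
have mi : measurable_fun setT (fun z => entry (assemble S z b) i).
  exact: measurable_entry_comp.
have mG : measurable_fun setT (fun p : rvec R k * R =>
    pint l S (upd (assemble S p.1 b) i p.2)).
  apply: (measurableT_comp mp); apply: measurable_upd; last exact: measurable_snd.
  exact: (measurableT_comp mw measurable_fst).
rewrite (_ : mkset _ = [set z | (pint l S (assemble S z b) < +oo)%E] `&`
  ([set z | rateQ (window_right S i (assemble S z b)) (pint l S (assemble S z b))] `&`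
   [set z | rateQ (window_left S i (assemble S z b)) (pint l S (assemble S z b))]));
  last by apply/seteqP; split => z [] => [h1 h2 h3|h1 [h2 h3]].
apply: measurableI; last apply: measurableI.
- rewrite (_ : mkset _ = ~` [set z | (+oo <= pint l S (assemble S z b))%E]); last first.
    by apply/seteqP; split => z /=; rewrite ltNge => /negP.
  apply: measurableC; rewrite -[X in measurable X]setTI.
  by apply: measurable_lee.
- apply: measurable_rateQ => // h; rewrite /window_right.
  apply: (measurable_integral_window (G := fun p => pint l S (upd (assemble S p.1 b) i p.2)))
    => //.
  by apply: measurable_funD.
- apply: measurable_rateQ => // h; rewrite /window_left.
  apply: (measurable_integral_window (G := fun p => pint l S (upd (assemble S p.1 b) i p.2)))
    => //.
  by apply: measurable_funB.
Qed.

(** On each line in the direction i the integral along S and i is a function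
    of one variable, to which Lebesgue's theorem applies. The exceptional sets
    are measurable by [measurable_rates_match], so Fubini's theorem adds them
    up to a null set. Finiteness along S makes this function locally
    integrable on every line not contained in N. *)
Lemma rates_match_ae S i b : i \notin S -> orthant b ->
  {ae leb, forall z, orthant z -> finite_partials S z} ->
  {ae leb, forall z, orthant z -> rates_match (i |: S)%SET i b z}.
Proof.
move=> iS b0 [N [mN N0 hN]]; set S' := (i |: S)%SET.
have mo := @measurable_orthant R k.
(* the new exceptional points; it is enough that every line in the direction i meets them in a null set *)
pose B := (@orthant R k `&` ~` [set z | rates_match S' i b z]) `\` N.
have mB : measurable B.
  apply: measurableD => //; apply: measurableI => //; apply: measurableC.
  exact: measurable_rates_match.
suff B0 : leb B = 0%E.
  exists (N `|` B); split; first exact: measurableU.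
    by apply/eqP; rewrite -measure_le0 -(adde0 0%E) -{1}N0 -B0; apply: measureU2.
  move=> z /= /not_implyP[z0 ng].
  by have [Nz|Nz] := pselect (N z); [left|right; split].
pose m' (j : 'I_k) : {sigma_finite_measure set RM -> \bar R} :=
  if j == i then \d_ (0 : RM) : {sigma_finite_measure set RM -> \bar R} else mu.
have mB1 : measurable_fun setT (fun z => (\1_B z)%:E : \bar R).
  by apply/measurable_EFinP; exact: measurable_indic.
transitivity (\int[leb]_x (\1_B x)%:E)%E; first by rewrite integral_indic// setIT.
rewrite (@ge0_integral_disint _ _ (fun=> mu) m' i)//; last 2 first.
- by move=> j ji; rewrite /m' (negbTE ji).
- by rewrite /m' eqxx; exact: diracT.
apply: integral0_eq => u _.
rewrite (_ : (fun t => (\1_B (upd u i t))%:E) =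
    (fun t => (\1_((fun t => upd u i t) @^-1` B) t)%:E)); last first.
  by apply/funext => t; rewrite !indicE; congr (_%:R%:E).
have mBu : measurable ((fun t : RM => upd u i t) @^-1` B).
  by apply: measurable_preimage => //; apply: measurable_upd => //; exact: measurable_id.
rewrite integral_indic// setIT.
have [[t0 Bt0]|nB] := pselect (exists t0, B (upd u i t0)); last first.
  rewrite (_ : _ @^-1` B = set0) ?measure0//.
  by apply/seteqP; split => // t Bt; apply: nB; exists t.
have [[ou ng] Nu] := Bt0.
have fu : finite_partials S (upd u i t0) by apply: contrapT => nf; apply/Nu/hN => /(_ ou).
pose w := assemble S' (upd u i t0) b.
have w0 : orthant w by exact: orthant_assemble.
have fw : finite_partials S w.
  apply: finite_partials_eq fu => j jS; rewrite entry_assemble in_setU1 jS orbT//.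
have mg : measurable_fun setT (fun x : R => pint l S' (upd w i x)).
  exact: measurable_pint_upd.
have goo c t : 0 < c -> (\int[mu]_(x in `[c, t[) pint l S' (upd w i x) < +oo)%E.
  by move=> c0; exact: pint_window_lty.
have [E [mE E0 hE]] := rate_ae mg (fun x => l0' S' (upd w i x)) goo.
apply: (@measure_null_subset _ _ _ mu _ E) => //.
move=> t [[ot ngt] _]; apply: hE => /= ht; apply: ngt.
have t_gt0 : 0 < t by have := ot i; rewrite entry_upd eqxx.
have [h1 h2 h3] := ht t_gt0.
have wE : assemble S' (upd u i t) b = upd w i t.
  apply: rvecP => j; rewrite !entry_upd !entry_assemble !entry_upd.
  by case: (eqVneq j i) => [->|//]; rewrite setU11.
have fin : pint l S' (upd w i t) \is a fin_num by rewrite (ge0_fin_numE (l0' _ _)).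
have wi : entry (upd w i t) i = t by rewrite entry_upd eqxx.
have uu x : upd (upd w i t) i x = upd w i x.
  by apply: rvecP => j; rewrite !entry_upd; case: eqP.
have wR : window_right S' i (upd w i t) =
    (fun h => \int[mu]_(x in `[t, (t + h)%R[) pint l S' (upd w i x))%E.
  apply/funext => h; rewrite /window_right wi; apply: eq_integral => x _.
  by rewrite uu.
have wL : window_left S' i (upd w i t) =
    (fun h => \int[mu]_(x in `[(t - h)%R, t[) pint l S' (upd w i x))%E.
  apply/funext => h; rewrite /window_left wi; apply: eq_integral => x _.
  by rewrite uu.
change (rates_match S' i b (upd u i t)); rewrite /rates_match; cbv zeta; rewrite wE wR wL.
have h2' := rate_rateQ h2; have h3' := rate_rateQ h3.
cbv beta in h1, h2', h3'; rewrite (fineK fin) in h2' h3'.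
split; [exact: h1|exact: h2'|exact: h3'].
Qed.

Definition ratvec (r : k.-tuple rat) : rvec R k := [tuple ratr (tnth r j) | j < k].

Lemma entry_ratvec r j : entry (ratvec r) j = ratr (tnth r j).
Proof. by rewrite /entry tnth_mktuple. Qed.

(** In the free coordinates the integrals are monotone and continuous. So at
    an arbitrary y the windows lie between those at rational points just below
    and just above y, and the rates at these points converge to the integral
    at y. *)
Lemma regular_of_rates_match S i z : i \notin S -> orthant z -> finite_partials S z ->
  (forall r, orthant (ratvec r) -> rates_match (i |: S)%SET i (ratvec r) z) ->
  forall y, orthant y -> (forall j, j \in (i |: S)%SET -> entry y j = entry z j) ->
  (pint l (i |: S)%SET y < +oo)%E /\
  is_derive (entry y i) 1 (fun t => psiS S (upd y i t)) (fine (pint l (i |: S)%SET y)).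
Proof.
set S' := (i |: S)%SET => iS z0 fz H y y0 yz.
have iS' : i \in S' by rewrite /S' setU11.
(* the rational point qB dominates the sequences qp above y and qm below y *)
have /choice[qB hqB] : forall j, exists q : rat, entry y j + 1 < ratr q.
  by move=> j; have [q []] := @rat_approx_gt R (entry y j + 1) 1 ltr01; exists q.
have /choice[qp hqp] : forall j, exists q : nat -> rat, forall n,
    entry y j < ratr (q n) < entry y j + n.+1%:R^-1.
  move=> j; suff /choice[q hq] : forall n, exists q : rat,
    entry y j < ratr q < entry y j + n.+1%:R^-1 by exists q.
  move=> n; have [q [h1 h2]] := @rat_approx_gt R (entry y j) n.+1%:R^-1 ltac:(by []).
  by exists q; rewrite h1 h2.
have /choice[qm hqm] : forall j, exists q : nat -> rat, forall n,
    [/\ 0 < ratr (q n) :> R, ratr (q n) < entry y j & entry y j - n.+1%:R^-1 < ratr (q n)].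
  move=> j; suff /choice[q hq] : forall n, exists q : rat,
    [/\ 0 < ratr q :> R, ratr q < entry y j & entry y j - n.+1%:R^-1 < ratr q] by exists q.
  by move=> n; exact: rat_approx_lt.
pose rB : k.-tuple rat := [tuple qB j | j < k].
pose rp n : k.-tuple rat := [tuple qp j n | j < k].
pose rm n : k.-tuple rat := [tuple qm j n | j < k].
pose w r := assemble S' z (ratvec r).
have oB : orthant (ratvec rB).
  move=> j; rewrite entry_ratvec tnth_mktuple; apply: lt_trans (hqB j).
  by rewrite ltr_wpDr.
have op n : orthant (ratvec (rp n)).
  move=> j; rewrite entry_ratvec tnth_mktuple; have /andP[h _] := hqp j n.
  exact: lt_trans h.
have om n : orthant (ratvec (rm n)).
  by move=> j; rewrite entry_ratvec tnth_mktuple; have [] := hqm j n.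
have wS r j : j \in S' -> entry (w r) j = entry y j.
  by move=> jS; rewrite entry_assemble jS yz.
have wN r j : j \notin S' -> entry (w r) j = ratr (tnth r j).
  by move=> jS; rewrite entry_assemble (negbTE jS) entry_ratvec.
have wBoo : (pint l S' (w rB) < +oo)%E by have [] := H _ oB.
have wple n j : j \notin S' -> entry (w (rp n)) j <= entry (w rB) j.
  move=> jS; rewrite !wN// !tnth_mktuple; have /andP[_ h] := hqp j n.
  apply: ltW; apply: lt_trans h _; apply: le_lt_trans (hqB j).
  by rewrite lerD2l invf_le1// ler1n.
have wmle n j : j \notin S' -> entry (w (rm n)) j <= entry (w rB) j.
  move=> jS; rewrite !wN// !tnth_mktuple; have [_ h _] := hqm j n.
  by apply: ltW; apply: lt_trans h _; apply: lt_trans (hqB j); rewrite ltrDl.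
have yp n : forall j, j \notin S' -> entry y j <= entry (w (rp n)) j.
  by move=> j jS; rewrite wN// tnth_mktuple; have /andP[/ltW] := hqp j n.
have my n : forall j, j \notin S' -> entry (w (rm n)) j <= entry y j.
  by move=> j jS; rewrite wN// tnth_mktuple; have [_ /ltW] := hqm j n.
have yoo : (pint l S' y < +oo)%E.
  apply: le_lt_trans wBoo; apply: (le_trans (y := pint l S' (w (rp 0%N)))).
    by apply: (pint_le ml l0) (yp 0%N) => j jS; rewrite wS.
  by apply: (pint_le ml l0) (wple 0%N) => j jS; rewrite !wS.
split=> //.
have yfin : pint l S' y \is a fin_num by rewrite (ge0_fin_numE (l0' _ _)).
have rfin r : orthant (ratvec r) -> pint l S' (w r) \is a fin_num.
  by move=> or; rewrite (ge0_fin_numE (l0' _ _)); have [] := H _ or.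
have cvp j : ratr (qp j n) @[n --> \oo] --> entry y j.
  apply: (@squeeze_cvgr _ _ _ _ (fun=> entry y j) (fun n => entry y j + n.+1%:R^-1)).
  - by apply: nearW => n; have /andP[/ltW -> /ltW ->] := hqp j n.
  - exact: cvg_cst.
  - by rewrite -[X in _ --> X]addr0; apply: cvgD; [exact: cvg_cst|exact: cvg_harmonic].
have cvm j : ratr (qm j n) @[n --> \oo] --> entry y j.
  apply: (@squeeze_cvgr _ _ _ _ (fun n => entry y j - n.+1%:R^-1) (fun=> entry y j)).
  - by apply: nearW => n; have [_ /ltW -> /ltW ->] := hqm j n.
  - by rewrite -[X in _ --> X]subr0; apply: cvgB; [exact: cvg_cst|exact: cvg_harmonic].
  - exact: cvg_cst.
have cp : pint l S' (w (rp n)) @[n --> \oo] --> pint l S' y.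
  apply: (pint_cvg ml l0 (B := w rB)) => //.
  - by move=> j jS; rewrite wS.
  - by move=> n j jS; rewrite wS.
  - by move=> j jS; under eq_fun do rewrite wN// tnth_mktuple; exact: cvp.
have cm : pint l S' (w (rm n)) @[n --> \oo] --> pint l S' y.
  apply: (pint_cvg ml l0 (B := w rB)) => //.
  - by move=> j jS; rewrite wS.
  - by move=> n j jS; rewrite wS.
  - by move=> j jS; under eq_fun do rewrite wN// tnth_mktuple; exact: cvm.
rewrite -(fineK yfin) in cp cm.
have cpf : fine (pint l S' (w (rp n))) @[n --> \oo] --> fine (pint l S' y).
  exact: (fine_cvg cp).
have cmf : fine (pint l S' (w (rm n))) @[n --> \oo] --> fine (pint l S' y).
  exact: (fine_cvg cm).
have upd_le r r' h : (forall j, j \notin S' -> entry r j <= entry r' j) ->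
    (forall j, j \in S' -> entry r j = entry r' j) ->
    (pint l S' (upd r i h) <= pint l S' (upd r' i h))%E.
  move=> le eq; apply: (pint_le ml l0) => j jS; rewrite !entry_upd; case: eqP => // _;
    [exact: eq|exact: le].
have mwin r A : measurable A -> measurable_fun A (fun x : R => pint l S' (upd r i x)).
  by move=> mA; apply: measurable_funTS; exact: measurable_pint_upd.
have win_le (r r' : rvec R k) (A : set RM) : measurable A ->
    (forall j, j \notin S' -> entry r j <= entry r' j) ->
    (forall j, j \in S' -> entry r j = entry r' j) ->
    (\int[mu]_(x in A) pint l S' (upd r i x) <= \int[mu]_(x in A) pint l S' (upd r' i x))%E.
  move=> mA le eq; apply: ge0_le_integral.
  - exact: mA.
  - by move=> x _; exact: l0'.
  - exact: (mwin _ _ mA).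
  - exact: (mwin _ _ mA).
  - by move=> x _; exact: upd_le.
(* continuity in the free coordinates, from both sides *)
have close e : 0 < e -> exists n, fine (pint l S' y) - e <= fine (pint l S' (w (rm n))) /\
    fine (pint l S' (w (rp n))) <= fine (pint l S' y) + e.
  move=> e0; move/cvgrPdist_le : cpf => /(_ _ e0) h1; move/cvgrPdist_le : cmf => /(_ _ e0) h2.
  have [n _ hn] := filterI h1 h2; exists n; have [] := hn n (leqnn n).
  by move=> /dist_le_bounds[_ ?] /dist_le_bounds[? _].
have yi : 0 < entry y i by exact: y0.
have fy : finite_partials S y.
  by apply: finite_partials_eq fz => j jS; rewrite yz// /S' in_setU1 jS orbT.
have r_right : rate (window_right S' i y) (fine (pint l S' y)).
  apply: rate_squeeze => [h h' h0 hh'||h h0|e e0].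
  - apply: ge0_subset_integral => //; first exact: mwin.
    by apply: subset_itvl; rewrite bnd_simp lerD2l.
  - exact: fine_ge0.
  - exact: integral_ge0.
  have [n [hm hp]] := close _ e0.
  exists (window_right S' i (w (rm n))), (fine (pint l S' (w (rm n)))),
    (window_right S' i (w (rp n))), (fine (pint l S' (w (rp n)))).
  split.
  - by rewrite (fineK (rfin _ (om n))); case: (H _ (om n)).
  - by rewrite (fineK (rfin _ (op n))); case: (H _ (op n)).
  - move=> h h0; rewrite /window_right !(wS _ _ iS'); split; apply: win_le.
    + exact: measurable_itv.
    + exact: my.
    + exact: wS.
    + exact: measurable_itv.
    + exact: yp.
    + by move=> j jS; rewrite wS.
  - exact: hm.
  - exact: hp.
have r_left : rate (window_left S' i y) (fine (pint l S' y)).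
  apply: rate_squeeze => [h h' h0 hh'||h h0|e e0].
  - apply: ge0_subset_integral => //; first exact: mwin.
    by apply: subset_itvr; rewrite bnd_simp lerB.
  - exact: fine_ge0.
  - exact: integral_ge0.
  have [n [hm hp]] := close _ e0.
  exists (window_left S' i (w (rm n))), (fine (pint l S' (w (rm n)))),
    (window_left S' i (w (rp n))), (fine (pint l S' (w (rp n)))).
  split.
  - by rewrite (fineK (rfin _ (om n))); case: (H _ (om n)).
  - by rewrite (fineK (rfin _ (op n))); case: (H _ (op n)).
  - move=> h h0; rewrite /window_left !(wS _ _ iS'); split; apply: win_le.
    + exact: measurable_itv.
    + exact: my.
    + exact: wS.
    + exact: measurable_itv.
    + exact: yp.
    + by move=> j jS; rewrite wS.
  - exact: hm.
  - exact: hp.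
apply/is_derive_rate; split.
  apply: rate_near r_right; first exact: yi.
  by move=> h h0 _; rewrite psiS_increment// lerDl ltW.
apply: rate_near r_left; first exact: yi.
by move=> h h0 hy; rewrite psiS_increment// ?subr_gt0// gerBl ltW.
Qed.

(** Induction on S: finiteness along S without i gives, by [rates_match_ae],
    almost everywhere finiteness along S at rational values of the free
    coordinates, and monotonicity gives the others. *)
Lemma finite_partials_ae S : {ae leb, forall z, orthant z -> finite_partials S z}.
Proof.
move: {2}#|S| (leqnn #|S|) => n; elim: n => [|n IH] in S *.
  rewrite leqn0 cards_eq0 => /eqP ->; apply: aeW => z _.
  by rewrite /finite_partials eqxx.
move=> Sn; have [->|S0] := eqVneq S finset.set0.
  by apply: aeW => z _; rewrite /finite_partials eqxx.
have /set0Pn[i iS] := S0; pose S1 := (S :\ i)%SET.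
have iS1 : i \notin S1 by rewrite finset.setD11.
have SE : (i |: S1)%SET = S by rewrite finset.setD1K.
have S1n : (#|S1| <= n)%N by move: Sn; rewrite (cardsD1 i S) iS.
have g r : {ae leb, forall z, orthant z -> orthant (ratvec r) -> rates_match (i |: S1)%SET i (ratvec r) z}.
  have [or|nor] := pselect (orthant (ratvec r)); last by apply: aeW => z _ /nor.
  have := rates_match_ae iS1 or (IH _ S1n); apply: filterS => z h oz _; exact: h.
have : {ae leb, forall z, forall m : nat, orthant z -> forall r, unpickle m = Some r ->
    orthant (ratvec r) -> rates_match (i |: S1)%SET i (ratvec r) z}.
  apply: ae_foralln => m; case: (unpickle m) => [r|]; last by apply: aeW.
  by have := g r; apply: filterS => z h oz r' [<-]; exact: h.
move=> G; apply: filterS2 G (IH _ S1n) => z Gz fz oz _ y oy yz.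
have := @regular_of_rates_match S1 i z iS1 oz (fz oz).
rewrite SE => /(_ _ y oy yz)[]// r or.
by have := Gz (pickle r) oz r; rewrite pickleK SE; exact.
Qed.

(** Differentiability on whole cylinders: an iterated derivative at z involves
    derivatives along S at points near z whose other coordinates have moved,
    while those in S are still the coordinates of z. *)
Definition regular z := forall S i, i \notin S -> forall y, orthant y ->
  (forall j, j \in (i |: S)%SET -> entry y j = entry z j) ->
  (pint l (i |: S)%SET y < +oo)%E /\
  is_derive (entry y i) 1 (fun t => psiS S (upd y i t)) (fine (pint l (i |: S)%SET y)).

(** A countable intersection over the sets S, the coordinates i and the
    rational points. *)
Lemma regular_ae : {ae leb, forall z, orthant z -> regular z}.
Proof.
pose Q (p : {set 'I_k} * 'I_k) z := orthant z -> p.2 \notin p.1 ->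
   forall y, orthant y -> (forall j, j \in (p.2 |: p.1)%SET -> entry y j = entry z j) ->
  (pint l (p.2 |: p.1)%SET y < +oo)%E /\
  is_derive (entry y p.2) 1 (fun t => psiS p.1 (upd y p.2 t))
    (fine (pint l (p.2 |: p.1)%SET y)).
have H p : {ae leb, forall z, Q p z}.
  case: p => S i; rewrite /Q /=; have [iS|iS] := boolP (i \notin S); last by apply: aeW.
  have g r : {ae leb, forall z, orthant z -> orthant (ratvec r) ->
      rates_match (i |: S)%SET i (ratvec r) z}.
    have [or|nor] := pselect (orthant (ratvec r)); last by apply: aeW => z _ /nor.
    have := rates_match_ae iS or (finite_partials_ae S); apply: filterS => z h oz _; exact: h.
  have : {ae leb, forall z, forall m : nat, orthant z -> forall r, unpickle m = Some r ->
      orthant (ratvec r) -> rates_match (i |: S)%SET i (ratvec r) z}.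
    apply: ae_foralln => m; case: (unpickle m) => [r|]; last by apply: aeW.
    by have := g r; apply: filterS => z h oz r' [<-]; exact: h.
  move=> G; apply: filterS2 G (finite_partials_ae S) => z Gz fz oz _.
  apply: regular_of_rates_match => // [|r or]; first exact: fz.
  by apply: (Gz (pickle r) oz r) => //; rewrite pickleK.
have HQ : {ae leb, forall z p, Q p z} by apply: filter_forall.
apply: filterS HQ => z h oz S i iS y oy yz; exact: (h (S, i)).
Qed.

Lemma regular_derive z S i y : regular z -> i \notin S -> orthant y ->
  (forall j, j \in (i |: S)%SET -> entry y j = entry z j) ->
  is_derive (entry y i) 1 (fun t => psiS S (upd y i t)) (psiS (i |: S)%SET y).
Proof.
move=> rz iS oy yz; have [_] := rz S i iS y oy yz.
rewrite [psiS (i |: S)%SET y]/psiS ifF//.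
by apply/negP => /eqP/setP/(_ i); rewrite in_setU1 eqxx finset.in_set0.
Qed.

(** The value only depends on the set of the entries of s: this is why the
    order of differentiation is irrelevant. *)
Lemma regular_partials z s : regular z -> uniq s -> forall y, orthant y ->
  (forall j, j \in s -> entry y j = entry z j) ->
  has_partials s psi y /\ partials s psi y = psiS [set j in s]%SET y.
Proof.
move=> rz; elim: s => [_ y oy _|i s IH /= /andP[ins us] y oy yz].
  split=> //=; rewrite /psiS ifT//; apply/eqP/setP => j; by rewrite !inE.
have iS : i \notin [set j in s]%SET by rewrite inE.
have SE : [set j in i :: s]%SET = (i |: [set j in s])%SET.
  by apply/setP => j; rewrite !inE.
have dpsi := @regular_derive z [set j in s]%SET i y rz iS oy.
have {}dpsi : is_derive (entry y i) 1 (fun t => psiS [set j in s]%SET (upd y i t))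
    (psiS (i |: [set j in s])%SET y).
  apply: dpsi => j; rewrite -SE inE; exact: yz.
have ne : \forall t \near entry y i,
    has_partials s psi (upd y i t) /\ partials s psi (upd y i t) = psiS [set j in s]%SET (upd y i t).
  have : \forall t \near entry y i, 0 < t by apply: lt_nbhsr; exact: oy.
  apply: filterS => t t0; apply: IH => //; first exact: orthant_upd.
  move=> j js; rewrite entry_upd; case: eqP => [ji|_]; first by rewrite -ji js in ins.
  by apply: yz; rewrite inE js orbT.
have dp : is_derive (entry y i) 1 (fun t => partials s psi (upd y i t))
    (psiS (i |: [set j in s])%SET y).
  apply: near_eq_is_derive dpsi.
  by move: ne; apply: filterS => t [_ ->].
split; last by rewrite SE derive1E; exact: derive_val.
split; last by case: dp.
by move: ne; apply: filterS => t [].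
Qed.

End regularity.

(** * Sums over partitions and the formula of Faa di Bruno *)

Section partition_sums.
Context (R : realType) (k : nat).
Implicit Types (S X B C : {set 'I_k}) (phi : {set 'I_k} -> R).

(** The complete Bell polynomial of the values of phi at the subsets of X. *)
Definition partition_sum phi X : R :=
  \sum_(tau : {set {set 'I_k}} | finset.partition tau X) \prod_(B in tau) phi B.

Lemma partition_set0 (tau : {set {set 'I_k}}) :
  finset.partition tau finset.set0 = (tau == finset.set0).
Proof.
apply/idP/eqP => [/and3P[/eqP cov _ n0]|->]; last first.
  by apply/and3P; split; rewrite ?finset.in_set0// /finset.cover ?big_set0//;
    apply/finset.trivIsetP => A B; rewrite finset.in_set0.
apply/eqP; rewrite -finset.subset0; apply/fintype.subsetP => B Btau.
suff B0 : B = finset.set0 by rewrite -B0 Btau in n0.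
apply/eqP; rewrite -finset.subset0 -cov; exact: (finset.bigcup_sup B).
Qed.

Lemma partition_sum0 phi : partition_sum phi finset.set0 = 1.
Proof.
rewrite /partition_sum; under eq_bigl do rewrite partition_set0.
by rewrite big_pred1_eq big_set0.
Qed.

Lemma partition_add_block B X (tau : {set {set 'I_k}}) : B != finset.set0 -> B \subset X ->
  finset.partition tau (X :\: B)%SET ->
  B \notin tau /\ finset.partition (B |: tau)%SET X.
Proof.
move=> B0 BX /and3P[/eqP cov tI n0].
have nB : B \notin tau.
  apply/negP => Bt; have /finset.set0Pn[j jB] := B0.
  have : j \in (X :\: B)%SET by rewrite -cov; apply/finset.bigcupP; exists B.
  by rewrite finset.in_setD jB.
have dis C : C \in tau -> fintype.disjoint (mem B) (mem C).
  move=> Ct; rewrite -finset.setI_eq0; apply/eqP/finset.setP => j; rewrite finset.in_setI finset.in_set0.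
  apply/negP => /andP[jB jC].
  have : j \in (X :\: B)%SET by rewrite -cov; apply/finset.bigcupP; exists C.
  by rewrite finset.in_setD jB.
split=> //; apply/and3P; split.
- rewrite /finset.cover big_setU1//= -/(finset.cover tau) cov.
  by rewrite -[X in _ == X](finset.setID X B) (finset.setIidPr BX).
- apply/finset.trivIsetP => C D; rewrite !in_setU1.
  move=> /orP[/eqP ->|Ct] /orP[/eqP ->|Dt]; first by rewrite eqxx.
  + by move=> _; exact: dis.
  + by move=> _; rewrite disjoint_sym; exact: dis.
  + by move/finset.trivIsetP: tI; apply.
- by rewrite in_setU1 negb_or eq_sym B0.
Qed.

Lemma partition_remove_block B X (tau : {set {set 'I_k}}) : finset.partition tau X ->
  B \in tau -> finset.partition (tau :\ B)%SET (X :\: B)%SET.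
Proof.
move=> /and3P[/eqP cov tI n0] Bt; apply/and3P; split.
- apply/eqP/finset.setP => j; rewrite finset.in_setD; apply/finset.bigcupP/andP.
    move=> [C]; rewrite finset.in_setD1 => /andP[CB Ct] jC; split; last first.
      by rewrite -cov; apply/finset.bigcupP; exists C.
    apply/negP => jB; move/finset.trivIsetP: tI => /(_ C B Ct Bt CB).
    by rewrite -finset.setI_eq0 => /eqP/finset.setP/(_ j); rewrite finset.in_setI jC jB finset.in_set0.
  move=> [jB]; rewrite -cov => /finset.bigcupP[C Ct jC]; exists C => //.
  rewrite finset.in_setD1 Ct andbT; apply/eqP => CB; by rewrite -CB jC in jB.
- by apply: finset.trivIsetS tI; exact: finset.subsetDl.
- by rewrite finset.in_setD1 negb_and n0 orbT.
Qed.

(** Partitions of X are classified by the block of j. *)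
Lemma partition_sum_block phi X j : j \in X ->
  partition_sum phi X =
  \sum_(B : {set 'I_k} | (j \in B) && (B \subset X)) phi B * partition_sum phi (X :\: B)%SET.
Proof.
move=> jX; rewrite /partition_sum.
rewrite (partition_big (fun tau : {set {set 'I_k}} => finset.pblock tau j)
  (fun B : {set 'I_k} => (j \in B) && (B \subset X))) /=; last first.
  move=> tau pt; have /and3P[/eqP cov tI n0] := pt.
  have jc : j \in finset.cover tau by rewrite cov.
  rewrite finset.mem_pblock jc /= -cov; exact: (finset.bigcup_sup _ (finset.pblock_mem jc)).
apply: eq_bigr => B /andP[jB BX].
have B0 : B != finset.set0 by apply/finset.set0Pn; exists j.
rewrite (reindex_onto (fun tau : {set {set 'I_k}} => (B |: tau)%SET)
  (fun tau : {set {set 'I_k}} => (tau :\ B)%SET)) /=; last first.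
  move=> tau /andP[pt /eqP pB]; apply: finset.setD1K; rewrite -pB.
  by apply: finset.pblock_mem; have /and3P[/eqP -> _ _] := pt.
rewrite mulr_sumr; apply: eq_big => [tau|tau].
  apply/idP/idP.
    move=> /andP[/andP[pt _] /eqP tE]; rewrite -tE; apply: partition_remove_block => //.
    by rewrite setU11.
  move=> pt; have [nB pt'] := partition_add_block B0 BX pt; rewrite pt' /=.
  apply/andP; split; last first.
    apply/eqP/finset.setP => C; rewrite finset.in_setD1 in_setU1.
    by case: (eqVneq C B) => //= ->; rewrite (negbTE nB).
  have /and3P[_ tI _] := pt'.
  by rewrite (finset.def_pblock tI _ jB)// setU11.
move=> /andP[/andP[pt _] /eqP tE].
by rewrite big_setU1//= -tE finset.setD11.
Qed.

Lemma setU1D_notin i S B : i \notin B -> ((i |: S) :\: B = i |: (S :\: B))%SET.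
Proof.
move=> iB; apply/finset.setP => j; rewrite !(finset.in_setD, in_setU1).
by case: (eqVneq j i) => [->|//]; rewrite iB.
Qed.

Lemma setU1D_in i S B : i \notin S -> ((i |: S) :\: (i |: B) = S :\: B)%SET.
Proof.
move=> iS; apply/finset.setP => j; rewrite !(finset.in_setD, in_setU1).
by case: (eqVneq j i) => [->|//]; rewrite (negbTE iS) andbF.
Qed.

(** In a partition of the larger set, either i is in the block of j or it is
    not; removing the block of j leaves a partition of the rest. *)
Lemma partition_sum_setU1 phi S i j : i \notin S -> j \in S ->
  partition_sum phi (i |: S)%SET =
  \sum_(B : {set 'I_k} | (j \in B) && (B \subset S))
    (phi (i |: B)%SET * partition_sum phi (S :\: B)%SET +
     phi B * partition_sum phi (i |: (S :\: B))%SET).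
Proof.
move=> iS jS; have jX : j \in (i |: S)%SET by rewrite in_setU1 jS orbT.
have ij : j != i by apply: contraNneq iS => <-.
rewrite (partition_sum_block phi jX) big_split/= (bigID (fun B : {set 'I_k} => i \in B))/=; congr (_ + _).
  rewrite (reindex_onto (fun B : {set 'I_k} => (i |: B)%SET) (fun B : {set 'I_k} => (B :\ i)%SET)) /=; last first.
    by move=> B /andP[_ iB]; exact: finset.setD1K.
  apply: eq_big => [B|B]; last first.
    by move=> _; rewrite setU1D_in.
  rewrite setU11 andbT in_setU1 (negbTE ij)/=.
  apply/idP/idP.
    move=> /andP[/andP[jB BX] /eqP BE]; rewrite jB/=; apply/fintype.subsetP => x xB.
    have : x \in (i |: S)%SET by apply: (fintype.subsetP BX); rewrite in_setU1 xB orbT.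
    rewrite in_setU1 => /orP[/eqP xi|//].
    by move: xB; rewrite -BE xi finset.in_setD1 eqxx.
  move=> /andP[jB BS]; rewrite jB finset.setUS//=.
  apply/eqP/finset.setP => x; rewrite finset.in_setD1 in_setU1.
  case: (eqVneq x i) => //= ->; apply/esym/negbTE.
  by apply: contra iS => iB; exact: (fintype.subsetP BS).
apply: eq_big => [B|B /andP[_ iB]]; last by rewrite setU1D_notin.
apply/idP/idP.
  move=> /andP[/andP[jB BX] iB]; rewrite jB/=; apply/fintype.subsetP => x xB.
  have := fintype.subsetP BX x xB; rewrite in_setU1 => /orP[/eqP xi|//].
  by rewrite -xi xB in iB.
move=> /andP[jB BS]; rewrite jB/= (fintype.subset_trans BS (finset.subsetU1 _ _))/=.
by apply: contra iS => iB; exact: (fintype.subsetP BS).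
Qed.

End partition_sums.

Lemma is_derive_bigsum (R : realType) (I : Type) (r : seq I) (P : pred I)
    (f : I -> R -> R) (df : I -> R) (x : R) :
  (forall i, P i -> is_derive x 1 (f i) (df i)) ->
  is_derive x 1 (fun t => \sum_(i <- r | P i) f i t) (\sum_(i <- r | P i) df i).
Proof.
move=> h; elim: r => [|i r IH].
  under eq_fun do rewrite big_nil.
  by rewrite big_nil; exact: is_derive_cst.
under eq_fun do rewrite big_cons.
rewrite big_cons; case: (boolP (P i)) => Pi //.
exact: (@is_deriveD _ _ _ _ _ _ _ _ _ (h i Pi) IH).
Qed.

Lemma is_derive_mul (R : realType) (f g : R -> R) (df dg x : R) :
  is_derive x 1 f df -> is_derive x 1 g dg ->
  is_derive x 1 (fun t => f t * g t) (df * g x + f x * dg).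
Proof.
move=> hf hg; apply: (is_derive_eq (is_deriveM hf hg)).
by rewrite /GRing.scale/= addrC mulrC.
Qed.

Section faa_di_bruno.
Context (R : realType) (k : nat).
Implicit Types (z u y b : rvec R k) (I S : {set 'I_k}).
Context (phi : {set 'I_k} -> rvec R k -> R) (z : rvec R k).
Hypothesis dphi : forall S i y, S != finset.set0 -> i \notin S -> orthant y ->
  (forall j, j \in (i |: S)%SET -> entry y j = entry z j) ->
  is_derive (entry y i) 1 (fun t => phi S (upd y i t)) (phi (i |: S)%SET y).

Lemma upd_entry y i : upd y i (entry y i) = y.
Proof. by apply: rvecP => j; rewrite entry_upd; case: eqP => [->|]. Qed.

Local Notation psum S y := (partition_sum (phi ^~ y) S).

(** Induction on the size of S: splitting off the block of a point j of S
    leaves smaller sets. By [partition_sum_setU1] the product rule gives all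
    partitions of the larger set, except those in which i forms a block on its
    own. *)
Lemma is_derive_partition_sum S i y : i \notin S -> orthant y ->
  (forall j, j \in (i |: S)%SET -> entry y j = entry z j) ->
  is_derive (entry y i) 1 (fun t => psum S (upd y i t))
    (psum (i |: S)%SET y - phi [set i]%SET y * psum S y).
Proof.
move: {2}#|S| (leqnn #|S|) => n; elim: n => [|n IH] in S * => Sn iS oy yz.
  move: Sn; rewrite leqn0 cards_eq0 => /eqP S0.
  rewrite S0 (_ : (fun t => _) = cst 1); last first.
    by apply/funext => t; exact: partition_sum0.
  rewrite partition_sum0 finset.setU0 mulr1.
  have iI : i \in [set i]%SET by rewrite finset.set11.
  rewrite (partition_sum_block _ iI) (big_pred1 [set i]%SET); last first.
    move=> B /=; apply/idP/eqP => [/andP[iB Bi]|->]; last by rewrite finset.set11/=.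
    by apply/eqP; rewrite finset.eqEsubset Bi finset.sub1set.
  rewrite finset.setDv partition_sum0 mulr1 subrr.
  exact: is_derive_cst.
have [S0|S0] := eqVneq S finset.set0.
  by apply: IH => //; rewrite S0 cards0.
have /finset.set0Pn[j jS] := S0.
under eq_fun do rewrite (partition_sum_block _ jS).
rewrite (partition_sum_setU1 _ iS jS) (partition_sum_block _ jS).
rewrite mulr_sumr -sumrB.
apply: is_derive_bigsum => B /andP[jB BS].
have B0 : B != finset.set0 by apply/finset.set0Pn; exists j.
have iB : i \notin B by apply: contra iS => iB; exact: (fintype.subsetP BS).
have dB := dphi B0 iB oy.
have {}dB : is_derive (entry y i) 1 (fun t => phi B (upd y i t)) (phi (i |: B)%SET y).
  apply: dB => l; rewrite in_setU1 => /orP[/eqP ->|lB]; apply: yz.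
    by rewrite setU11.
  by rewrite in_setU1 (fintype.subsetP BS)// orbT.
have SBn : (#|S :\: B| <= n)%N.
  rewrite -ltnS; apply: leq_trans Sn; apply: proper_card.
  apply/properP; split; first exact: finset.subsetDl.
  by exists j => //; rewrite finset.in_setD jB.
have iSB : i \notin (S :\: B)%SET by rewrite finset.in_setD (negbTE iS) andbF.
have dSB := IH (S :\: B)%SET SBn iSB oy.
have {}dSB : is_derive (entry y i) 1 (fun t => psum (S :\: B)%SET (upd y i t))
    (psum (i |: (S :\: B))%SET y - phi [set i]%SET y * psum (S :\: B)%SET y).
  apply: dSB => l; rewrite in_setU1 => /orP[/eqP ->|]; first by apply: yz; rewrite setU11.
  by rewrite finset.in_setD => /andP[_ lS]; apply: yz; rewrite in_setU1 lS orbT.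
apply: (is_derive_eq (is_derive_mul dB dSB)).
by rewrite upd_entry; ring.
Qed.

Context (psi F : rvec R k -> R).
Hypothesis dpsi : forall i y, orthant y -> entry y i = entry z i ->
  is_derive (entry y i) 1 (fun t => psi (upd y i t)) (phi [set i]%SET y).
Hypothesis Fpsi : forall y, orthant y -> F y = expR (psi y).

(** The derivative of exp(psi) supplies the partitions in which the new point
    i forms a block on its own, which [is_derive_partition_sum] leaves out. *)
Lemma partials_expR s : uniq s -> forall y, orthant y ->
  (forall j, j \in s -> entry y j = entry z j) ->
  partials s F y = F y * psum [set j in s]%SET y.
Proof.
elim: s => [_ y oy _|i s IH /= /andP[ins us] y oy yz].
  have -> : [set j in [::]]%SET = finset.set0 :> {set 'I_k}.
    by apply/finset.setP => j; rewrite !inE.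
  by rewrite partition_sum0 mulr1.
have iS : i \notin [set j in s]%SET by rewrite inE.
have SE : [set j in i :: s]%SET = (i |: [set j in s])%SET.
  by apply/finset.setP => j; rewrite !inE.
have yi : entry y i = entry z i by apply: yz; rewrite inE eqxx.
have nearpos : \forall t \near entry y i, 0 < t by apply: lt_nbhsr; exact: oy.
have opos t : 0 < t -> orthant (upd y i t).
  by move=> t0 j; rewrite entry_upd; case: eqP.
have ne : \forall t \near entry y i, expR (psi (upd y i t)) * psum [set j in s]%SET (upd y i t) =
    partials s F (upd y i t).
  apply: filterS nearpos => t t0; rewrite IH ?Fpsi//; try exact: opos.
  move=> j js; rewrite entry_upd; case: eqP => [ji|_]; first by rewrite -ji js in ins.
  by apply: yz; rewrite inE js orbT.
have dP : is_derive (entry y i) 1 (fun t => psum [set j in s]%SET (upd y i t))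
    (psum (i |: [set j in s])%SET y - phi [set i]%SET y * psum [set j in s]%SET y).
  by apply: is_derive_partition_sum => // j; rewrite -SE inE; exact: yz.
have dE : is_derive (entry y i) 1 (fun t => expR (psi (upd y i t)))
    (expR (psi y) * phi [set i]%SET y).
  have dp := dpsi oy yi.
  have de : is_derive (psi (upd y i (entry y i))) 1 (@expR R) (expR (psi (upd y i (entry y i)))).
    exact: is_derive_expR.
  have := @is_derive1_comp _ _ (fun t => psi (upd y i t)) _ _ _ de dp.
  by move=> h; apply: (is_derive_eq h); rewrite upd_entry.
rewrite derive1E SE.
have := near_eq_is_derive ne (is_derive_mul dE dP).
by move=> h; rewrite derive_val upd_entry Fpsi//; ring.
Qed.

End faa_di_bruno.

(** * The partial derivatives of V and the density of F *)

Section partial_integral_glue.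
Context (R : realType) (k : nat).
Local Notation RM := (measurableTypeR R).
Implicit Types (z u : rvec R k) (I S : {set 'I_k}).
Context (lam : {set 'I_k} -> rvec R k -> R).
Hypothesis mlam : forall I : {set 'I_k}, I != finset.set0 -> measurable_fun (Eface I) (lam I).
Hypothesis lam0 : forall I : {set 'I_k}, I != finset.set0 ->
  forall z, Eface I z -> 0 <= lam I z.

Lemma off_measure_face S I X : S \subset I -> measurable X ->
  X `<=` tbox (fun j => if j \in S then setT else @Efactor R k I j) ->
  face_measure R (I :\: S)%SET X = off_measure R S X.
Proof.
move=> SI mX XE.
apply: (@tuple_measure_restrict _ RM _ _
  (fun i => if i \in (I :\: S)%SET then
      @lebesgue_measure R : {sigma_finite_measure set RM -> \bar R}
    else \d_ ((0 : R) : RM)) (@off_factor R k S)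
  (fun j => if j \in S then setT else @Efactor R k I j)) => //.
  by move=> i; case: ifP => // _; exact: measurable_Efactor.
move=> i A mA; rewrite finset.in_setD /off_factor /Efactor.
case: (boolP (i \in S)) => //= iS; case: ifP => _ AI.
  by rewrite [RHS]lebesgue_set1N.
by rewrite [RHS]atom_lebesgue_set1.
Qed.

(** The assembled point has positive coordinates in S, so it lies on a face
    whose index set contains S; on that face [off_measure] is Lebesgue measure
    of the remaining coordinates. *)
Lemma partial_integral_glue S z : S != finset.set0 -> orthant z ->
  partial_integral lam S z = pint (glue lam) S z.
Proof.
move=> S0 oz; pose g I u := on_face lam I (assemble S z u).
have mbox := @measurable_off_box R k S z.
have mas : measurable_fun setT (assemble S z : rvec R k -> rvec R k).
  exact: measurable_assemble_fixed.
have mg I : I != finset.set0 -> measurable_fun setT (g I).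
  by move=> I0; exact: (measurableT_comp (measurable_on_face mlam I0) mas).
have -> : pint (glue lam) S z = (\int[off_measure R S]_(u in off_box S z)
    \sum_(I : {set 'I_k}) (if I != finset.set0 then g I u else 0))%E.
  by apply: eq_integral => u _; exact: big_mkcond.
rewrite ge0_integral_sum//; last 2 first.
- by move=> I; case: (boolP (I != finset.set0)) => // I0; apply: measurable_funTS; exact: mg.
- by move=> I u _; case: ifPn => // I0; exact: on_face_ge0.
transitivity (\sum_(I : {set 'I_k}) (if S \subset I then
  \int[face_measure R (I :\: S)%SET]_(u in off_box S z `&` assemble S z @^-1` Eface I)
      (lam I (assemble S z u))%:E else 0))%E.
  by rewrite -big_mkcond.
apply: eq_bigr => I _; case: ifPn => SI; last first.
  have [I0|I0] := boolP (I != finset.set0); last by rewrite integral0.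
  have [i iS iI] := fintype.subsetPn SI.
  apply/esym/integral0_eq => u _; apply: on_face0 => /(_ i).
  rewrite (negbTE iI) entry_assemble iS => /eqP zi.
  by have := oz i; rewrite zi ltxx.
have I0 : I != finset.set0.
  by apply: contraNneq S0 => I0; rewrite -finset.subset0 -I0.
rewrite I0; transitivity (\int[off_measure R S]_(u in off_box S z `&` assemble S z @^-1` Eface I)
      (lam I (assemble S z u))%:E)%E; last first.
  rewrite integral_mkcondr; apply: eq_integral => u _; rewrite patchE /g.
  case: ifPn => [|/negP]; rewrite inE => h; first by rewrite on_faceE.
  by rewrite on_face0.
apply: eq_measure_integral => X mX XI.
apply: off_measure_face => // u /XI [_ uI] j; case: ifP => // jS.
have := uI j; rewrite entry_assemble jS /Efactor.
by case: ifP => _ /=; [rewrite in_itv/= andbT|move/eqP].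
Qed.

End partial_integral_glue.

Section increments.
Context (R : realType) (k : nat).
Local Notation RM := (measurableTypeR R).
Implicit Types (z u : rvec R k).

Lemma refmeas_ae_entry i (c : R) : 0 < c ->
  {ae refmeas R k, forall u, entry u i != c}.
Proof.
move=> c0; exists [set u | entry u i = c]; split.
- exact: measurable_hyperplane.
- apply: (@tuple_measure_hyperplane R k (fun=> @atom_lebesgue R)).
  rewrite [LHS]atom_lebesgueE lebesgue_measure_set1 adde0 diracE memNset//.
  by move=> /= h; rewrite h ltxx in c0.
- by move=> u /= /negP; rewrite negbK => /eqP.
Qed.

(** The difference of two regions outside boxes is a slab, up to its sides,
    which are at positive coordinates and hence null. *)
Lemma exponent_increment (V : rvec R k -> R) (L : {measure set (rvec R k) -> \bar R})
    lam i z c t :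
  exponent_measure V L -> exponent_density L lam ->
  orthant z -> 0 < c -> c <= t ->
  (- V (upd z i t) - - V (upd z i c))%:E =
  (\int[refmeas R k]_(u in slab i z c t) glue lam u)%E.
Proof.
move=> [_ LV] [mlam lam0 Llam] oz c0 ct.
have t0 : 0 < t by exact: lt_le_trans ct.
have ou s : 0 < s -> orthant (upd z i s).
  exact: orthant_upd.
pose A s : set (rvec R k) := @Espace R k `\` cbox (upd z i s).
have mA s : measurable (A s).
  by apply: measurableD; [exact: measurable_Espace|exact: measurable_cbox].
have LA s : 0 < s -> L (A s) = (V (upd z i s))%:E.
  by move=> s0; apply: LV; exact: ou.
have AtAc : A t `<=` A c.
  move=> u [Eu ut]; split=> // uc; apply: ut => j; have := uc j; rewrite !entry_upd.
  by case: eqP => // _ /andP[-> /le_trans]; exact.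
have mAA : measurable (A c `\` A t) by exact: measurableD.
transitivity (L (A c `\` A t)).
  have Acoo : (L (A c) < +oo)%E by rewrite (LA _ c0) ltry.
  rewrite (measureD (mA c) (mA t) Acoo) (setIidr AtAc).
  transitivity (L (A c) - L (A t))%E; last by [].
  rewrite (LA _ c0) (LA _ t0).
  by rewrite -EFinB opprK addrC.
rewrite Llam//; last by move=> u [[]].
rewrite (integral_glue mlam lam0)//.
rewrite integral_mkcond [RHS]integral_mkcond.
have mgl := measurable_glue mlam.
have gl0 := glue_ge0 lam0.
apply: ge0_ae_eq_integral => //.
- by apply/(measurable_restrictT _ mAA); exact: measurable_funTS.
- by apply/(measurable_restrictT _ (measurable_slab _ _ _ _)); exact: measurable_funTS.
- by move=> u _; rewrite patchE; case: ifP.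
- by move=> u _; rewrite patchE; case: ifP.
have H1 := refmeas_ae_entry i c0; have H2 := refmeas_ae_entry i t0.
have H3 : {ae refmeas R k, forall u, forall j, entry u j != entry z j}.
  by apply: filter_forall => j; apply: refmeas_ae_entry; exact: oz.
move: H1 H2 H3; apply: filterS3 => u uc ut uz _; rewrite !patchE.
congr (if _ then _ else _); apply/idP/idP; rewrite !inE.
  move=> [[Eu nc] nt]; have ub : cbox (upd z i t) u by apply: contrapT => h; apply: (nt); split.
  move=> j; have := ub j; rewrite entry_upd; case: eqP => [ji|_] /andP[h1 h2]; last first.
    by rewrite h1 lt_neqAle uz h2.
  rewrite ji in h2 *; apply/andP; split; last by rewrite lt_neqAle ut.
  rewrite leNgt; apply/negP => h; apply: nc => l; have := ub l; rewrite !entry_upd.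
  by case: eqP => [->|//] /andP[-> _]; exact: ltW.
move=> us; have ui := us i; rewrite eqxx in ui; have /andP[cu ut'] := ui.
have u0 l : 0 <= entry u l.
  have := us l; case: eqP => [-> _|_ /andP[]//]; exact: le_trans (ltW c0) cu.
have Eu : Espace u by split => //; exists i; rewrite gt_eqF// (lt_le_trans c0).
split.
  split=> // /(_ i); rewrite entry_upd eqxx => /andP[_ h].
  by move: uc; rewrite eq_le h cu.
move=> [_]; apply=> l; rewrite u0 entry_upd /=; have := us l.
by case: eqP => [-> _|_ /andP[_ /ltW]//]; exact: ltW.
Qed.

(** The density only matters inside the orthant, where [refmeas] is Lebesgue
    measure. *)
Lemma cdf_increment (F : rvec R k -> \bar R) f i z c t :
  (forall y, F y \is a fin_num) -> cdf_density F f -> orthant z -> 0 < c -> c <= t ->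
  (fine (F (upd z i t)) - fine (F (upd z i c)))%:E =
  (\int[refmeas R k]_(u in slab i z c t) ((EFin \o f) \_ (@orthant R k)) u)%E.
Proof.
move=> Ffin [mf f0 Ff] oz c0 ct; have mo := @measurable_orthant R k.
have t0 : 0 < t by exact: lt_le_trans ct.
have ou s : 0 < s -> orthant (upd z i s).
  exact: orthant_upd.
have oo s : obox (upd z i s) `<=` @orthant R k.
  by move=> u h j; have /andP[] := h j.
pose C := slab i z c t `&` @orthant R k.
have mC : measurable C by apply: measurableI => //; exact: measurable_slab.
have obE : obox (upd z i t) = obox (upd z i c) `|` C.
  apply/seteqP; split => u.
    move=> h; have [uc|uc] := ltP (entry u i) c; [left|right].
      move=> j; have := h j; rewrite !entry_upd; case: eqP => // -> /andP[-> _].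
      by rewrite uc.
    split; last exact: oo h.
    move=> j; have := h j; rewrite !entry_upd; case: eqP => [-> /andP[_ ->]|_ /andP[/ltW -> ->]//].
    by rewrite uc.
  case=> [h|[h o]] j; have := h j; rewrite !entry_upd.
    by case: eqP => // _ /andP[-> /lt_le_trans]; exact.
  by case: eqP => [-> /andP[_ ->]|_ /andP[_ ->]]; rewrite o.
have mfE : measurable_fun (@orthant R k) (EFin \o f) by exact/measurable_EFinP.
have -> : (\int[refmeas R k]_(u in slab i z c t) ((EFin \o f) \_ (@orthant R k)) u =
    \int[lebesgue_vec R k]_(u in C) (f u)%:E)%E.
  rewrite -integral_mkcondr; apply: eq_measure_integral => X mX XC.
  by apply/esym/refmeas_orthant => // u /XC[].
have Fc := Ff _ (ou _ c0); have Ft := Ff _ (ou _ t0).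
rewrite obE ge0_integral_setU// in Ft; last 4 first.
- exact: measurable_obox.
- by rewrite -obE; apply: measurable_funS mfE; [exact: mo|exact: oo].
- by move=> u; rewrite -obE => /oo; exact: f0.
- rewrite disj_set2E; apply/eqP/seteqP; split => // u [/(_ i) h [/(_ i)]].
  by move: h; rewrite entry_upd eqxx => /andP[_ h] /andP[]; rewrite leNgt h.
rewrite -Fc in Ft.
by rewrite EFinB !fineK// Ft addeAC subee// add0e.
Qed.

End increments.

Section opposite.
Context (R : realType) (k : nat).
Implicit Types (y : rvec R k).

Lemma partials_opp (f : rvec R k -> R) s y : has_partials s f y ->
  has_partials s (fun z => - f z) y /\ partials s (fun z => - f z) y = - partials s f y.
Proof.
elim: s y => [//|i s IH] y /= [near_s df].
have near_opp : \forall t \near entry y i,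
    has_partials s (fun z => - f z) (upd y i t) /\
    partials s (fun z => - f z) (upd y i t) = - partials s f (upd y i t).
  by apply: filterS near_s => t; exact: IH.
have dN : is_derive (entry y i) 1 (fun t => partials s (fun z => - f z) (upd y i t))
    (- 'D_1 (fun t => partials s f (upd y i t)) (entry y i)).
  have /derivableP dfP := df.
  apply: near_eq_is_derive (is_deriveN dfP).
  by apply: filterS near_opp => t [_ ->].
split; last by rewrite !derive1E derive_val.
split; last by case: dN.
by apply: filterS near_opp => t [].
Qed.

End opposite.

Section full_partial_integral.
Context (R : realType) (k : nat).
Local Notation RM := (measurableTypeR R).
Implicit Types (z u : rvec R k).

(** Nothing is left to integrate: the measure is a unit mass and the integrand
    is constant. *)
Lemma pint_setT (l : rvec R k -> \bar R) z : pint l [set: 'I_k]%SET z = l z.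
Proof.
rewrite /pint (_ : off_box _ z = setT); last first.
  by apply/seteqP; split => // u _ i; rewrite finset.in_setT.
transitivity (\int[off_measure R [set: 'I_k]%SET]_u l z)%E.
  apply: eq_integral => u _; congr l; apply: rvecP => j.
  by rewrite entry_assemble finset.in_setT.
have m1 : off_measure R [set: 'I_k]%SET setT = 1%E.
  have := @tuple_measure_box _ RM R k (@off_factor R k [set: 'I_k]%SET) (fun=> setT)
    (fun=> measurableT).
  rewrite (_ : [set t | _] = setT); last by apply/seteqP; split.
  move=> h; apply: (etrans h); rewrite big1// => i _.
  by rewrite /off_factor finset.in_setT; exact: diracT.
rewrite integral_cst//.
transitivity (l z * off_measure R [set: 'I_k]%SET setT)%E; first by [].
by rewrite m1 mule1.
Qed.

End full_partial_integral.

Section conclusions.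
Context (R : realType) (k : nat) (d : measure_display) (T : measurableType d)
  (P : probability T R) (Z : {RV P >-> rvec R k})
  (L : {measure set (rvec R k) -> \bar R}).
Implicit Types (z u y : rvec R k) (S : {set 'I_k}).
Local Notation F := (joint_cdf Z).
Local Notation V := (exponent_function Z).
Local Notation negV := (fun y => - V y).
Hypothesis Zms : simple_max_stable Z.
Hypothesis LV : exponent_measure V L.
Context (lam : {set 'I_k} -> rvec R k -> R).
Hypothesis Llam : exponent_density L lam.

Let mlam I : I != finset.set0 -> measurable_fun (Eface I) (lam I).
Proof. by case: Llam => h _ _; exact: h. Qed.

Let lam0 I : I != finset.set0 -> forall z, Eface I z -> 0 <= lam I z.
Proof. by case: Llam => _ h _; exact: h. Qed.

Local Notation gl := (glue lam).

Lemma regular_exponent_ae :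
  {ae lebesgue_vec R k, forall z, orthant z -> regular gl negV z}.
Proof.
apply: (@regular_ae R k gl negV).
- exact: measurable_glue.
- exact: glue_ge0.
- by move=> i z c t oz c0 ct; exact: exponent_increment LV Llam oz c0 ct.
Qed.

(** The sign of V is carried through [partials_opp], so that the regularity
    theory is only needed for functions with nonnegative increments. *)
Lemma regular_dpartial z : orthant z -> regular gl negV z ->
  forall S, S != finset.set0 ->
  (forall s, perm_eq s (enum S) -> has_partials s V z /\ partials s V z = dpartial S V z) /\
  - dpartial S V z = psiS gl negV S z.
Proof.
move=> oz rz S S0.
have H s : perm_eq s (enum S) ->
    has_partials s V z /\ partials s V z = - psiS gl negV S z.
  move=> sS; have us : uniq s by rewrite (perm_uniq sS) enum_uniq.
  have [hp pE] := @regular_partials R k gl negV z s rz us z oz (fun _ _ => erefl).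
  have [] := partials_opp hp.
  have -> : (fun y => - negV y) = V by apply/funext => y; rewrite opprK.
  rewrite pE => h1 h2; split=> //; rewrite h2; congr (- psiS gl negV _ z).
  by apply/finset.setP => j; rewrite inE (perm_mem sS) mem_enum.
have dE : dpartial S V z = - psiS gl negV S z by have [] := H (enum S) (perm_refl _).
split; last by rewrite dE opprK.
by move=> s /H [h1 h2]; split=> //; rewrite h2 dE.
Qed.

Lemma regular_partial_integral z : orthant z -> regular gl negV z ->
  forall S, S != finset.set0 -> (psiS gl negV S z)%:E = partial_integral lam S z.
Proof.
move=> oz rz S S0; rewrite partial_integral_glue//.
rewrite /psiS (negbTE S0) fineK// ge0_fin_numE; last first.
  by apply: pint_ge0; exact: glue_ge0.
have /finset.set0Pn[i iS] := S0.
have iN : i \notin (S :\ i)%SET by rewrite finset.setD11.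
by have [+ _] := rz _ i iN z oz (fun _ _ => erefl); rewrite finset.setD1K.
Qed.

(** Differentiate F along all coordinates in two ways, at points where both F
    and -V are regular: as a primitive of f the result is f, and as exp(-V) it
    is the sum over partitions. *)
Lemma cdf_density_formula f : (0 < k)%N -> cdf_density F f ->
  {ae lebesgue_vec R k, forall z, orthant z ->
    f z = \sum_(tau : {set {set 'I_k}} | finset.partition tau [set: 'I_k]%SET)
            expR (- V z) * \prod_(B in tau) (- dpartial B V z)}.
Proof.
move=> k0 Ff; have [mf f0 _] := Ff; have mo := @measurable_orthant R k.
pose lf := (EFin \o f) \_ (@orthant R k).
have mlf : measurable_fun setT lf.
  by apply/(measurable_restrictT _ mo); exact/measurable_EFinP.
have lf0 z : (0 <= lf z)%E.
  by rewrite /lf patchE; case: ifP => //; rewrite inE => oz; rewrite lee_fin f0.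
pose fF z := fine (F z).
have regF : {ae lebesgue_vec R k, forall z, orthant z -> regular lf fF z}.
  apply: (regular_ae mlf lf0) => i z c t oz c0 ct.
  apply: cdf_increment Ff oz c0 ct => y; exact: joint_cdf_fin.
apply: filterS2 regular_exponent_ae regF => z rV rF oz.
have {}rV := rV oz; have {}rF := rF oz.
have T0 : [set: 'I_k]%SET != finset.set0.
  by apply/finset.set0Pn; exists (Ordinal k0); rewrite finset.in_setT.
have TE : [set j in enum 'I_k]%SET = [set: 'I_k]%SET.
  by apply/finset.setP => j; rewrite !inE mem_enum.
have [_ pF] := @regular_partials R k lf fF z (enum 'I_k) rF (enum_uniq _) z oz (fun _ _ => erefl).
rewrite TE /psiS (negbTE T0) pint_setT /lf patchE mem_set//= in pF.
rewrite -pF.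
have dphi S i y : S != finset.set0 -> i \notin S -> orthant y ->
    (forall j, j \in (i |: S)%SET -> entry y j = entry z j) ->
    is_derive (entry y i) 1 (fun t => psiS gl negV S (upd y i t)) (psiS gl negV (i |: S)%SET y).
  by move=> S0 iS oy yz; exact: (regular_derive rV).
have dpsi i y : orthant y -> entry y i = entry z i ->
    is_derive (entry y i) 1 (fun t => negV (upd y i t)) (psiS gl negV [set i]%SET y).
  move=> oy yz; have := @regular_derive R k gl negV z finset.set0 i y rV.
  rewrite finset.in_set0 finset.setU0 [psiS _ _ finset.set0]/psiS eqxx; apply=> // j.
  by rewrite finset.in_set1 => /eqP ->.
have FexpR y : orthant y -> fF y = expR (negV y).
  by move=> oy; rewrite /fF joint_cdf_expR.
rewrite (partials_expR dphi dpsi FexpR (enum_uniq _) oz)//.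
rewrite TE /partition_sum mulr_sumr; apply: eq_bigr => tau ptau.
rewrite FexpR//; congr (_ * _).
apply: eq_bigr => B Btau; apply/esym.
have B0 : B != finset.set0.
  by have /and3P[_ _ n0] := ptau; apply: contraNneq n0 => <-.
by have [] := regular_dpartial oz rV B0.
Qed.

End conclusions.

(** * The equivalence and the density formulas *)

Theorem proposition2p1 (R : realType) (k : nat) (k_ge1 : (1 <= k)%N)
    (d : measure_display) (T : measurableType d) (P : probability T R)
    (Z : {RV P >-> rvec R k})
    (L : {measure set (rvec R k) -> \bar R}) (H : probability (rvec R k) R) :
  let F := joint_cdf Z in
  let V := exponent_function Z in
  simple_max_stable Z -> exponent_measure V L -> angular_measure L H ->
  [/\ (exists f, cdf_density F f) <-> (exists lam, exponent_density L lam),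
      (exists lam, exponent_density L lam) <-> (exists h, angular_density H h),
      forall lam, exponent_density L lam ->
        [/\ forall z, orthant z ->
              (V z)%:E = (\sum_(I : {set 'I_k} | I != finset.set0)
                \int[face_measure R I]_(u in (@Espace R k `\` cbox z) `&` Eface I)
                  (lam I u)%:E)%E,
            {ae lebesgue_vec R k, forall z, orthant z ->
              forall S : {set 'I_k}, S != finset.set0 ->
                (forall s, perm_eq s (enum S) ->
                   has_partials s V z /\ partials s V z = dpartial S V z) /\
                (- dpartial S V z)%:E = partial_integral lam S z} &
            forall f, cdf_density F f ->
              {ae lebesgue_vec R k, forall z, orthant z ->
                f z = \sum_(tau : {set {set 'I_k}} | finset.partition tau [set: 'I_k]%SET)
                        expR (- V z) * \prod_(B in tau) (- dpartial B V z)}] &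
      forall lam h, exponent_density L lam -> angular_density H h ->
        forall I : {set 'I_k}, I != finset.set0 ->
          {ae face_measure R I, forall z, Eface I z ->
            lam I z = k%:R * (norm1 z) ^- (#|I|.+1)
                      * h I (scalep (norm1 z)^-1 z)}].
Proof.
move=> F V Zms LV LH.
have exp_ang lam : exponent_density L lam -> exists h, angular_density H h.
  by move=> Llam; exact: (angular_density_of_exponent LH k_ge1 Llam).
have ang_exp h : angular_density H h -> exponent_density L (radial_density h).
  by move=> Hh; exact: (exponent_density_of_angular LH Hh).
split.
- split=> [[f Ff]|[lam Llam]]; last exact: (cdf_density_of_exponent Zms LV Llam).
  have [h Hh] := angular_density_of_cdf Zms LV LH k_ge1 Ff.
  by exists (radial_density h); exact: ang_exp.
- split=> [[lam Llam]|[h Hh]]; first exact: exp_ang Llam.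
  by exists (radial_density h); exact: ang_exp.
- move=> lam Llam; split.
  + move=> z oz; have [_ <-//] := LV; have [_ _ ->//] := Llam.
    by apply: measurableD; [exact: measurable_Espace|exact: measurable_cbox].
  + apply: filterS (regular_exponent_ae LV Llam) => z rz oz S S0.
    have {}rz := rz oz; have [hs ->] := regular_dpartial oz rz S0.
    by split=> //; exact: (regular_partial_integral Llam).
  + by move=> f Ff; exact: (cdf_density_formula Zms LV Llam k_ge1 Ff).
- move=> lam h Llam Hh I I0.
  exact: (exponent_density_unique LH Llam (ang_exp _ Hh) I0).
Qed.
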